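(* Let $Q$ be a smooth $n$-dimensional manifold, let $U\subseteq Q\times Q$ be open, and let $\tilde\Gamma:U\to Q$ be a smooth map such that $(q_1,\tilde\Gamma(q_0,q_1))\in U$ for all $(q_0,q_1)\in U$. Let $\Gamma:U\to U\times U$, $\Gamma(q_0,q_1)=(q_0,q_1,q_1,\tilde\Gamma(q_0,q_1))$, be the corresponding explicit second order difference equation $q_{k+1}=\tilde\Gamma(q_{k-1},q_k)$. Then $q_{k+1}=\tilde\Gamma(q_{k-1},q_k)$ is variational if and only if there is a local diffeomorphism $F:U\to T^*Q$ satisfying $\alpha_Q=\pi_Q\circ F$ on $U$ and such that $\operatorname{Im}(\gamma_{F,\Gamma})$ is a Lagrangian submanifold of $(T^*Q\times T^*Q,\Omega_Q)$, where $\gamma_{F,\Gamma}:=(F\times F)\circ\Gamma$.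
   Context: All maps are smooth. $\alpha_Q:Q\times Q\to Q$ is the projection onto the first factor and $\pi_Q:T^*Q\to Q$ is the cotangent projection. $\omega_Q=-d\theta_Q$ is the canonical symplectic form on $T^*Q$ ($\theta_Q$ the Liouville one-form), $\alpha_{T^*Q},\beta_{T^*Q}:T^*Q\times T^*Q\to T^*Q$ are the projections onto the first and second factor, and $\Omega_Q:=\beta_{T^*Q}^*\omega_Q-\alpha_{T^*Q}^*\omega_Q$, a symplectic form. Since $F$ is only a local diffeomorphism, ''$\operatorname{Im}(\gamma_{F,\Gamma})$ is a Lagrangian submanifold'' is understood in the immersed sense: $\gamma_{F,\Gamma}$ is an immersion of the $2n$-dimensional manifold $U$ and $\gamma_{F,\Gamma}^*\Omega_Q=0$. A (locally defined) discrete Lagrangian $L_d$ on $U$ is an open cover $\{U_i\}$ of $U$ with smooth functions $L_i:U_i\to\mathbb{R}$ such that $dL_i=dL_j$ on $U_i\cap U_j$. The partial differentials $D_1L_d(q_0,q_1)\in T^*_{q_0}Q$, $D_2L_d(q_0,q_1)\in T^*_{q_1}Q$ (the components of $dL_d(q_0,q_1)$ under $T^*_{(q_0,q_1)}(Q\times Q)\cong T^*_{q_0}Q\times T^*_{q_1}Q$) are then well defined on $U$. $L_d$ is regular if the mixed second derivative matrix $D_{12}L_d=\left(\partial^2L_d/\partial q_0^i\partial q_1^j\right)$ is invertible at every point of $U$. The equation $q_{k+1}=\tilde\Gamma(q_{k-1},q_k)$ is variational if there is a regular discrete Lagrangian $L_d$ on $U$ such that the systems $q_{k+1}=\tilde\Gamma(q_{k-1},q_k)$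 and $D_1L_d(q_k,q_{k+1})+D_2L_d(q_{k-1},q_k)=0$ (discrete Euler-Lagrange equations) admit the same solutions; this is understood locally, i.e. the two solution sets coincide inside some open neighbourhood of the graph $\{(q_0,q_1,\tilde\Gamma(q_0,q_1)):(q_0,q_1)\in U\}$ in $\{(q_0,q_1,q_2)\in Q^3:(q_0,q_1)\in U,\ (q_1,q_2)\in U\}$. *)

(* Defs.v *)
From HB Require Import structures.
From mathcomp Require Import all_boot all_order all_algebra.
From mathcomp Require Import all_classical all_reals all_analysis.

Set Implicit Arguments.
Unset Strict Implicit.
Unset Printing Implicit Defensive.

Import Order.TTheory GRing.Theory Num.Theory.
Import numFieldNormedType.Exports.

Local Open Scope ring_scope.
Local Open Scope classical_set_scope.

(* The model spaces [E], [F] below are always finite-dimensional when these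
   notions are used: ['rV_n], ['cV_n], [R^o] and products of these.
   [smooth_on A f] is only used for an open set [A]. *)
Section SmoothFunctions.
Context {R : realType} {E F : normedModType R}.

Fixpoint Ck_on (k : nat) (A : set E) (f : E -> F) : Prop :=
  if k is k'.+1 then
    (forall x, A x -> differentiable f x) /\
    (forall v : E, Ck_on k' A ('D_v f))
  else forall x, A x -> {for x, continuous f}.

Definition smooth_on (A : set E) (f : E -> F) : Prop := forall k, Ck_on k A f.

End SmoothFunctions.

(* A chart is a homeomorphism between an open subset of [M] and an open subset
   of [E] (see [is_chart]); as usual the two inverse maps are total functions
   whose values off [cdom] and [ccod] are irrelevant. *)
Record chart (E M : Type) := Chart {
  cdom : set M;
  ccod : set E;
  cto : M -> E;
  cfrom : E -> M
}.

(* Besides the atlas we keep a preferred chart around each point. It carries no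
   mathematical content beyond the atlas (one exists for every atlas by choice);
   it only serves to represent tangent and cotangent vectors: the tangent space
   at [x] is [E], a vector being given by its components in [chart_at x]. *)
Record charted_space (E M : Type) := ChartedSpace {
  atlas : set (chart E M);
  chart_at : M -> chart E M
}.

Section Manifolds.
Context {R : realType}.

Definition is_chart {E : normedModType R} {M : topologicalType}
    (c : chart E M) : Prop :=
  [/\ open (cdom c) /\ open (ccod c),
      forall x, cdom c x -> ccod c (cto c x) /\ cfrom c (cto c x) = x,
      forall y, ccod c y -> cdom c (cfrom c y) /\ cto c (cfrom c y) = y,
      forall x, cdom c x -> {for x, continuous (cto c)} &
      forall y, ccod c y -> {for y, continuous (cfrom c)}].

Definition is_smooth_manifold {n : nat} {M : topologicalType}
    (A : charted_space 'rV[R]_n M) : Prop :=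
  [/\ hausdorff_space M /\ @second_countable M,
      forall c, atlas A c -> is_chart c,
      forall x, atlas A (chart_at A x) /\ cdom (chart_at A x) x &
      forall c d, atlas A c -> atlas A d ->
        smooth_on (ccod c `&` cfrom c @^-1` cdom d) (cto d \o cfrom c)].

Definition model_charted (E : normedModType R) : charted_space E E :=
  let c := Chart setT setT id id in ChartedSpace [set c] (fun=> c).

Definition prod_chart {E F : normedModType R} {M N : topologicalType}
    (c : chart E M) (d : chart F N) : chart (E * F)%type (M * N)%type :=
  Chart (cdom c `*` cdom d) (ccod c `*` ccod d)
    (fun x => (cto c x.1, cto d x.2)) (fun y => (cfrom c y.1, cfrom d y.2)).

Definition prod_charted {E F : normedModType R} {M N : topologicalType}
    (A : charted_space E M) (B : charted_space F N) :
    charted_space (E * F)%type (M * N)%type :=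
  ChartedSpace
    [set k | exists c d, [/\ atlas A c, atlas B d & k = prod_chart c d]]
    (fun x => prod_chart (chart_at A x.1) (chart_at B x.2)).

Section Maps.
Context {E F : normedModType R} {M N : topologicalType}.
Variables (A : charted_space E M) (B : charted_space F N).

(* A map defined on an open set [U] of [M] is represented by a total function
   considered on [U] only. *)
Definition smooth_map (U : set M) (f : M -> N) : Prop :=
  (forall x, U x -> {for x, continuous f}) /\
  forall c d, atlas A c -> atlas B d ->
    smooth_on (ccod c `&` cfrom c @^-1` (U `&` f @^-1` cdom d))
      (cto d \o f \o cfrom c).

Definition tangent_map (f : M -> N) (x : M) : E -> F :=
  'd (cto (chart_at B (f x)) \o f \o cfrom (chart_at A x))
     (cto (chart_at A x) x).

Definition immersion (U : set M) (f : M -> N) : Prop :=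
  smooth_map U f /\ forall x, U x -> injective (tangent_map f x).

End Maps.

Definition local_diffeomorphism {E F : normedModType R} {M N : topologicalType}
    (A : charted_space E M) (B : charted_space F N) (U : set M) (f : M -> N) :
    Prop :=
  forall x, U x -> exists V : set M,
    [/\ open V, V x, V `<=` U, open (f @` V) &
    exists g : N -> M, [/\ forall y, V y -> g (f y) = y,
      smooth_map A B V f & smooth_map B A (f @` V) g]].

Definition one_form {E M : Type} (_ : charted_space E M) := M -> E -> R^o.
Definition two_form {E M : Type} (_ : charted_space E M) := M -> E -> E -> R^o.

Definition pullback2 {E F : normedModType R} {M N : topologicalType}
    (A : charted_space E M) (B : charted_space F N) (f : M -> N)
    (w : two_form B) : two_form A :=
  fun x u v => w (f x) (tangent_map A B f x u) (tangent_map A B f x v).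

(* [local_form th c] is the expression of [th] in the chart [c], i.e. its
   pullback by [cfrom c]; the exterior derivative at [x] is computed in
   [chart_at x], where tangent vectors at [x] are their own components:
   dth(u, v) = D_u (th v) - D_v (th u) for constant fields u and v. *)
Definition local_form {E : normedModType R} {M : topologicalType}
    {A : charted_space E M} (th : one_form A) (c : chart E M) : E -> E -> R^o :=
  fun y u => th (cfrom c y) (tangent_map (model_charted E) A (cfrom c) y u).

Definition ext_deriv {E : normedModType R} {M : topologicalType}
    {A : charted_space E M} (th : one_form A) : two_form A :=
  fun x u v =>
    let c := chart_at A x in
    'D_u (fun y => local_form th c y v) (cto c x) -
    'D_v (fun y => local_form th c y u) (cto c x).

Definition differential {E : normedModType R} {M : topologicalType}
    (A : charted_space E M) (f : M -> R^o) : one_form A :=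
  tangent_map A (model_charted R^o) f.

End Manifolds.

(* A covector at [q] is given by the column [p] of its components in
   [chart_at A q]: it maps the tangent vector [v : 'rV_n] to [v *m p]. The
   topology is not the product topology of [Q * 'cV_n] but the one making all
   the bundle charts [cotangent_chart] homeomorphisms. *)
Definition cotangent (R : realType) (n : nat) (Q : topologicalType)
  (A : charted_space 'rV[R]_n Q) : Type := (Q * 'cV[R]_n)%type.

Section CotangentBundle.
Context {R : realType} {n : nat} {Q : topologicalType}.
Variable A : charted_space 'rV[R]_n Q.

HB.instance Definition _ := Choice.on (cotangent A).

Definition cotangent_proj (z : cotangent A) : Q := z.1.

Definition covector_at (z : cotangent A) (v : 'rV[R]_n) : R^o :=
  (v *m z.2) ord0 ord0.

(* Components of covectors are transformed by the Jacobians of the changes of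
   coordinates between [c] and the preferred chart at the base point. *)
Definition cotangent_chart (c : chart 'rV[R]_n Q) :
    chart ('rV[R]_n * 'cV[R]_n)%type (cotangent A) :=
  @Chart _ (cotangent A)
    [set z | cdom c z.1]
    (ccod c `*` setT)
    (fun z => (cto c z.1,
       jacobian (cto (chart_at A z.1) \o cfrom c) (cto c z.1) *m z.2))
    (fun y => let q := cfrom c y.1 in
      (q, jacobian (cto c \o cfrom (chart_at A q)) (cto (chart_at A q) q)
            *m y.2)).

Definition cotangent_open (W : set (cotangent A)) : Prop :=
  forall c, atlas A c -> forall y, ccod (cotangent_chart c) y ->
    W (cfrom (cotangent_chart c) y) ->
    nbhs y (cfrom (cotangent_chart c) @^-1` W).

Lemma cotangent_openT : cotangent_open setT.
Proof. by move=> c _ y _ _; exact: filterT. Qed.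

Lemma cotangent_openI : setI_closed cotangent_open.
Proof.
move=> V W oV oW c Ac y cy [Vy Wy].
by apply: filterI; [exact: oV|exact: oW].
Qed.

Lemma cotangent_open_bigU (I : Type) (f : I -> set (cotangent A)) :
  (forall i, cotangent_open (f i)) -> cotangent_open (\bigcup_i f i).
Proof.
move=> of_ c Ac y cy [i _ fiy].
by apply: filterS (of_ i c Ac y cy fiy) => z fz; exists i.
Qed.

HB.instance Definition _ := isOpenTopological.Build (cotangent A)
  cotangent_openT cotangent_openI cotangent_open_bigU.

Definition cotangent_charted :
    charted_space ('rV[R]_n * 'cV[R]_n)%type (cotangent A) :=
  ChartedSpace [set cotangent_chart c | c in atlas A]
    (fun z => cotangent_chart (chart_at A z.1)).

Definition liouville_form : one_form cotangent_charted :=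
  fun z w => covector_at z (tangent_map cotangent_charted A cotangent_proj z w).

Definition canonical_symplectic_form : two_form cotangent_charted :=
  fun z u v => - ext_deriv liouville_form z u v.

Definition cotangent2_charted := prod_charted cotangent_charted cotangent_charted.

Definition Omega : two_form cotangent2_charted :=
  fun z u v =>
    pullback2 cotangent2_charted snd canonical_symplectic_form z u v -
    pullback2 cotangent2_charted fst canonical_symplectic_form z u v.

(* The image of [g] is a Lagrangian submanifold in the immersed sense; it has
   half the dimension of [T^*Q x T^*Q] because [g] is an immersion of an open
   subset of [Q x Q]. *)
Definition lagrangian_immersion (U : set (Q * Q))
    (g : Q * Q -> cotangent A * cotangent A) : Prop :=
  immersion (prod_charted A A) cotangent2_charted U g /\
  forall x, U x -> forall u v,
    pullback2 (prod_charted A A) g Omega x u v = 0.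

End CotangentBundle.

Section DiscreteMechanics.
Context {R : realType} {n : nat} {Q : topologicalType}.
Variable A : charted_space 'rV[R]_n Q.

Record discrete_lagrangian (U : set (Q * Q)) := DiscreteLagrangian {
  dl_index : Type;
  dl_dom : dl_index -> set (Q * Q);
  dl_fun : dl_index -> Q * Q -> R^o;
  dl_open : forall i, open (dl_dom i);
  dl_cover : \bigcup_i dl_dom i = U;
  dl_smooth : forall i,
    smooth_map (prod_charted A A) (model_charted R^o) (dl_dom i) (dl_fun i);
  dl_compat : forall i j x, dl_dom i x -> dl_dom j x ->
    differential (prod_charted A A) (dl_fun i) x =
    differential (prod_charted A A) (dl_fun j) x
}.

Arguments dl_dom {U} d i _.
Arguments dl_fun {U} d i _.

Definition D1 (L : Q * Q -> R^o) (x : Q * Q) (v : 'rV[R]_n) : R^o :=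
  differential (prod_charted A A) L x (v, 0).

Definition D2 (L : Q * Q -> R^o) (x : Q * Q) (v : 'rV[R]_n) : R^o :=
  differential (prod_charted A A) L x (0, v).

Definition D12 (L : Q * Q -> R^o) (c d : chart 'rV[R]_n Q) (x : Q * Q) :
    'M[R]_n :=
  let cd := prod_chart c d in
  \matrix_(i, j) 'D_((delta_mx 0 i : 'rV[R]_n), (0 : 'rV[R]_n))
    ('D_((0 : 'rV[R]_n), (delta_mx 0 j : 'rV[R]_n)) (L \o cfrom cd)) (cto cd x).

Definition regular (U : set (Q * Q)) (L : discrete_lagrangian U) : Prop :=
  forall i x, dl_dom L i x ->
  forall c d, atlas A c -> atlas A d -> cdom c x.1 -> cdom d x.2 ->
    D12 (dl_fun L i) c d x \in unitmx.

(* By [dl_compat] the choice of the local functions defined around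
   [(q1, q2)] and [(q0, q1)] is irrelevant. *)
Definition discrete_euler_lagrange (U : set (Q * Q))
    (L : discrete_lagrangian U) (q0 q1 q2 : Q) : Prop :=
  forall i j, dl_dom L i (q1, q2) -> dl_dom L j (q0, q1) ->
  forall v, D1 (dl_fun L i) (q1, q2) v + D2 (dl_fun L j) (q0, q1) v = 0.

Definition variational (U : set (Q * Q)) (Gt : Q * Q -> Q) : Prop :=
  exists2 L : discrete_lagrangian U, regular L &
  exists W : set (Q * Q * Q),
    [/\ open W,
        forall q0 q1 q2, W (q0, q1, q2) -> U (q0, q1) /\ U (q1, q2),
        forall q0 q1, U (q0, q1) -> W (q0, q1, Gt (q0, q1)) &
        forall q0 q1 q2, W (q0, q1, q2) ->
          (q2 = Gt (q0, q1) <-> discrete_euler_lagrange L q0 q1 q2)].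

Definition Gamma (Gt : Q * Q -> Q) (x : Q * Q) : (Q * Q) * (Q * Q) :=
  (x, (x.2, Gt x)).

Definition gamma (F : Q * Q -> cotangent A) (Gt : Q * Q -> Q) :
    Q * Q -> cotangent A * cotangent A :=
  (fun y => (F y.1, F y.2)) \o Gamma Gt.

End DiscreteMechanics.

(* Main.v *)
Require Import Defs.
From HB Require Import structures.
From mathcomp Require Import all_boot all_order all_algebra.
From mathcomp Require Import all_classical all_reals all_analysis.
From mathcomp Require Import ring lra.

(** Write [Gamma2 x = (x.2, Gt x)]. On a chart, [F] has the form
    [(q0, q1) |-> (q0, p (q0, q1))] and pulls the Liouville form back to [p dq0],
    so [gamma F Gt] pulls [Omega] back to minus the exterior derivative of
    [alpha = (F o Gamma2) - F], where [F x] and [F (Gamma2 x)] are regarded as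
    covectors acting on the first, resp. second, component of a tangent vector
    at [x]. Hence [gamma F Gt] is isotropic iff [alpha] is closed, i.e. iff
    [alpha] is locally [dL], i.e. [D1 L = - F] and [D2 L = F o Gamma2].

    If [F] is given, the Poincaré lemma provides such local [L]; they are
    regular because [dp/dq1] is invertible, and the discrete Euler-Lagrange
    equations read [F (q1, q2) = F (q1, Gt (q0, q1))], which means
    [q2 = Gt (q0, q1)] where [F] is injective. Conversely, given [L], put
    [F = - D1 L]: it is a local diffeomorphism by regularity and the inverse
    function theorem, and the discrete Euler-Lagrange equations along the graph
    of [Gt] say that [F o Gamma2 = D2 L], so that [alpha = dL] is closed. *)

Set Implicit Arguments.
Unset Strict Implicit.
Unset Printing Implicit Defensive.

Import Order.TTheory GRing.Theory Num.Theory.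
Import numFieldNormedType.Exports.

Local Open Scope ring_scope.
Local Open Scope classical_set_scope.

(** * Smooth maps between normed spaces *)

(** Tangent and cotangent vectors are recorded in a preferred chart that may jump from point to
    point, so fields of components cannot be differentiated as they stand: each form or map is first
    rewritten in one chart fixed around the point. For the same reason [ext_deriv], taken at every
    point in that point's own chart, has to be compared between charts before a primitive can be
    built. Smoothness means iterated differentiability along constant directions, whereas the chain
    rule produces directions that vary with the point; this is why the model spaces carry
    coordinates. [F] is injective only locally, so equal momenta give [q2 = Gt (q0, q1)] only if
    [(q1, q2)] and [(q1, Gt (q0, q1))] lie in one open set on which [F] is injective. The
    neighbourhood of the graph in [variational] consists of the triples for which such a set exists.
    The local Lagrangians are never glued: only their common differential, a closed one-form,
    enters. That [gamma F Gt] is an immersion is read off from its first component [F]. *)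

Section Differentiability.
Context {R : realType} {E F : normedModType R}.

(** Restates the little-o definition, which is centred at [0] after a shift, as an estimate at [x].
    The criterion by partial derivatives and the differential of an inverse map are both proved
    through it. *)
Lemma is_diff_eps (f : E -> F) (df : {linear E -> F}) (x : E) :
  continuous df ->
  (forall e, 0 < e -> \forall y \near x,
     `|f y - f x - df (y - x)| <= e * `|y - x|) ->
  is_diff x f df.
Proof.
move=> cdf H.
have fdf : f \o shift x = cst (f x) + df +o_ (0 : E) id.
  apply/eqaddoP => e e0.
  have := H e e0.
  rewrite (near_shift 0) subr0; apply: filterS => y /=.
  by rewrite addrK opprD addrA.
have -> : (df : E -> F) = 'd f x by rewrite (diff_unique cdf fdf).
apply: differentiableP; apply/diff_locallyP.
by rewrite (diff_unique cdf fdf).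
Qed.

Lemma diff_eps (f : E -> F) (x : E) : differentiable f x ->
  forall e, 0 < e -> \forall y \near x,
     `|f y - f x - 'd f x (y - x)| <= e * `|y - x|.
Proof.
move=> /diff_locallyP[_ /eqaddoP H] e e0.
have := H e e0; rewrite [X in _ -> X](near_shift 0) subr0; apply: filterS => y /=.
by rewrite addrK opprD addrA.
Qed.

(** The maps of a chart are total functions with arbitrary values off their domains, so identities
    between coordinate expressions hold only near a point; differentials have to be insensitive to
    the rest. *)
Lemma near_eq_is_diff (f g : E -> F) (x : E) :
  {near x, f =1 g} -> differentiable f x -> is_diff x g ('d f x).
Proof.
move=> fg df; apply: is_diff_eps => [|e e0]; first exact: diff_continuous.
have fgx := nbhs_singleton fg.
near=> y.
have <- : f y = g y by near: y.
by rewrite -fgx; near: y; exact: diff_eps.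
Unshelve. all: end_near. Qed.

Lemma near_eq_differentiable (f g : E -> F) (x : E) :
  {near x, f =1 g} -> differentiable f x -> differentiable g x.
Proof. by move=> fg df; have := near_eq_is_diff fg df. Qed.

Lemma near_eq_diff (f g : E -> F) (x : E) :
  {near x, f =1 g} -> differentiable f x -> 'd g x = 'd f x :> (E -> F).
Proof. by move=> fg df; have [] := near_eq_is_diff fg df. Qed.

End Differentiability.

(** * Closure properties of maps of class C^k *)

Section CkOn.
Context {R : realType}.

Lemma Ck_onP (E F : normedModType R) k (A : set E) (f : E -> F) :
  Ck_on k A f <-> forall x, A x -> Ck_on k [set x] f.
Proof.
elim: k f => [|k IH] f /=.
  by split=> H x; [move=> Ax _ -> ; exact: H|move=> Ax; exact: H Ax x erefl].
split=> [[df H] x Ax|H].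
  split=> [_ -> |v]; first exact: df.
  by move: x Ax; exact/IH.
split=> [x Ax|v]; first exact: (H x Ax).1 x erefl.
by apply/IH => x Ax; exact: (H x Ax).2.
Qed.

Lemma Ck_on_subset (E F : normedModType R) k (A B : set E) (f : E -> F) :
  A `<=` B -> Ck_on k B f -> Ck_on k A f.
Proof. by move=> AB /Ck_onP H; apply/Ck_onP => x /AB; exact: H. Qed.

Lemma Ck_on_eq (E F : normedModType R) k (A : set E) (f g : E -> F) : open A ->
  (forall x, A x -> f x = g x) -> Ck_on k A f -> Ck_on k A g.
Proof.
move=> oA; elim: k f g => [|k IH] f g fg /=.
  move=> cf x Ax; rewrite /prop_for /continuous_at -(fg _ Ax).
  apply: cvg_trans (cf x Ax); apply: near_eq_cvg.
  by apply: filterS (open_nbhs_nbhs (conj oA Ax)) => y; exact: fg.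
have nfg x : A x -> {near x, f =1 g}.
  by move=> Ax; apply: filterS (open_nbhs_nbhs (conj oA Ax)) => y; exact: fg.
move=> [df H]; split=> [x Ax|v]; first exact: near_eq_differentiable (nfg x Ax)
  (df x Ax).
by apply: (IH ('D_v f)) => // x Ax; apply: near_eq_derive; exact: nfg.
Qed.

Lemma Ck_onW (E F : normedModType R) k (A : set E) (f : E -> F) :
  Ck_on k.+1 A f -> Ck_on k A f.
Proof.
elim: k f => [|k IH] f [df H]; first by move=> x Ax; exact/differentiable_continuous/df.
by split=> // v; exact/IH/H.
Qed.

Lemma Ck_on_cst (E F : normedModType R) k (A : set E) (w : F) : Ck_on k A (cst w : E ->
  F).
Proof.
elim: k w => [|k IH] w /=; first by move=> x _; exact: cst_continuous.
split=> // v; have -> : 'D_v (cst w : E -> F) = cst 0; last exact: IH.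
by apply/funext => x; rewrite derive_cst.
Qed.

Lemma Ck_on_linear (E F : normedModType R) k (A : set E) (l : {linear E -> F}) :
  continuous l -> Ck_on k A l.
Proof.
move=> cl; case: k => [x _|k]; first exact: cl.
split=> [x _|v]; first exact: linear_differentiable.
have -> : 'D_v l = cst (l v); last exact: Ck_on_cst.
by apply/funext => x; rewrite deriveE ?diff_lin//; exact: linear_differentiable.
Qed.

Lemma Ck_on_linear_comp (E F G : normedModType R) k (A : set E) (f : E -> F)
    (l : {linear F -> G}) : open A -> continuous l ->
  Ck_on k A f -> Ck_on k A (l \o f).
Proof.
move=> oA cl; elim: k f => [|k IH] f /=.
  by move=> H x Ax; apply: continuous_comp; [exact: H|exact: cl].
move=> [df H]; split=> [x Ax|v].
  by apply: differentiable_comp; [exact: df|exact: linear_differentiable].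
apply: (Ck_on_eq oA _ (IH _ (H v))) => x Ax /=.
have dl : differentiable l (f x) by exact: linear_differentiable.
have dfx := df x Ax.
rewrite (deriveE _ dfx) (deriveE _ (differentiable_comp dfx dl)).
by rewrite (diff_comp dfx dl) (diff_lin _ cl).
Qed.

Lemma Ck_onD (E F : normedModType R) k (A : set E) (f g : E -> F) : open A ->
  Ck_on k A f -> Ck_on k A g -> Ck_on k A (f + g).
Proof.
move=> oA; elim: k f g => [|k IH] f g /=.
  by move=> cf cg x Ax; apply: continuousD; [exact: cf|exact: cg].
move=> [df Hf] [dg Hg]; split=> [x Ax|v].
  by apply: differentiableD; [exact: df|exact: dg].
apply: (Ck_on_eq oA _ (IH _ _ (Hf v) (Hg v))) => x Ax.
by rewrite deriveD//; apply: diff_derivable; [exact: df|exact: dg].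
Qed.

Lemma Ck_on_sum (E F : normedModType R) k (A : set E) (I : Type) (r : seq I)
    (P : pred I) (f : I -> E -> F) : open A ->
  (forall i, Ck_on k A (f i)) -> Ck_on k A (fun x => \sum_(i <- r | P i) f i x).
Proof.
move=> oA H; elim: r => [|i r IH].
  by rewrite (_ : (fun x => _) = cst 0); [exact: Ck_on_cst|apply/funext => x;
    rewrite big_nil].
case: (boolP (P i)) => Pi; last first.
  by rewrite (_ : (fun x => _) = (fun x => \sum_(i <- r | P i) f i x)) //;
    apply/funext => x; rewrite big_cons (negbTE Pi).
rewrite (_ : (fun x => _) = f i + (fun x => \sum_(i <- r | P i) f i x));
  first exact: Ck_onD.
by apply/funext => x; rewrite big_cons Pi.
Qed.

Lemma Ck_on_pair (E F G : normedModType R) k (A : set E) (f : E -> F) (g : E -> G) :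
  open A -> Ck_on k A f -> Ck_on k A g -> Ck_on k A (fun x => (f x, g x)).
Proof.
move=> oA; elim: k f g => [|k IH] f g /=.
  by move=> cf cg x Ax; apply: cvg_pair; [exact: cf|exact: cg].
move=> [df Hf] [dg Hg]; split=> [x Ax|v].
  by apply: differentiable_pair; [exact: df|exact: dg].
apply: (Ck_on_eq oA _ (IH _ _ (Hf v) (Hg v))) => x Ax.
have dfx := df _ Ax; have dgx := dg _ Ax.
by rewrite [RHS](deriveE _ (differentiable_pair dfx dgx)) (diff_pair dfx dgx) !deriveE.
Qed.

End CkOn.

Section Scale.
Context {R : realType}.

(** The product rule for [c *: f] is obtained from the differential of a continuous bilinear map,
    composed with the pair of [c] and [f]. *)
Lemma scale_is_bilinear (F : normedModType R) :
  bilinear_for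
    (GRing.Scale.Law.clone _ _ *:%R _) (GRing.Scale.Law.clone _ _ *:%R _)
    (@GRing.scale R F : R^o -> F -> F).
Proof.
split=> [u'|u] a x y /=; first by rewrite scalerDl scalerA.
by rewrite scalerDr !scalerA mulrC.
Qed.

HB.instance Definition _ (F : normedModType R) :=
  bilinear_isBilinear.Build R R^o F F _ _ (@GRing.scale R F : R^o -> F -> F)
    (@scale_is_bilinear F).

Lemma differentiable_scale (E F : normedModType R) (c : E -> R^o) (f : E -> F) x :
  differentiable c x -> differentiable f x -> differentiable (fun y => c y *: f y) x.
Proof.
move=> dc df.
have ds := @differentiable_bilin _ _ _ _ (@GRing.scale R F : R^o -> F -> F)
  (c x, f x) (@scale_continuous _ F).
exact: (differentiable_comp (differentiable_pair dc df) ds).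
Qed.

Lemma derive_scale (E F : normedModType R) (c : E -> R^o) (f : E -> F) x v :
  differentiable c x -> differentiable f x ->
  'D_v (fun y => c y *: f y) x = c x *: 'D_v f x + 'D_v c x *: f x.
Proof.
move=> dc df.
have cs : continuous (fun p : R^o * F => p.1 *: p.2) by exact: scale_continuous.
have ds := @differentiable_bilin _ _ _ _ (@GRing.scale R F : R^o -> F -> F) (c x, f x)
  cs.
rewrite (deriveE v (differentiable_scale dc df)) (deriveE v dc) (deriveE v df).
have -> : (fun y => c y *: f y) = (fun p : R^o * F => p.1 *: p.2) \o (fun y => (c y,
  f y)) by [].
rewrite (diff_comp (differentiable_pair dc df) ds) (diff_pair dc df).
by rewrite (@diff_bilin _ _ _ _ (@GRing.scale R F : R^o -> F -> F) (c x, f x) cs).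
Qed.

Lemma Ck_on_scale (E F : normedModType R) k (A : set E) (c : E -> R^o) (f : E -> F) :
  open A -> Ck_on k A c -> Ck_on k A f -> Ck_on k A (fun x => c x *: f x).
Proof.
move=> oA; elim: k c f => [|k IH] c f.
  by move=> cc cf x Ax; apply: continuousZ; [exact: cc|exact: cf].
move=> Hc Hf; have [dc Dc] := Hc; have [df Df] := Hf.
split=> [x Ax|v]; first by apply: differentiable_scale; [exact: dc|exact: df].
apply: (@Ck_on_eq _ _ _ _ _ ((fun x => c x *: 'D_v f x) + (fun x => 'D_v c x *: f x)))
  => //.
  by move=> x Ax; rewrite derive_scale//; [exact: dc|exact: df].
have Wc := Ck_onW Hc; have Wf := Ck_onW Hf.
by apply: Ck_onD => //; [exact: (IH c _ Wc (Df v))|exact: (IH _ f (Dc v) Wf)].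
Qed.

End Scale.

(** * Finite-dimensional spaces in coordinates, and the chain rule *)

Section Coordinates.
Context {R : realType}.

(** A finite-dimensional normed space is given by a linear homeomorphism with
    some ['rV[R]_m]. *)
Record coords (m : nat) (E : normedModType R) := Coords {
  cphi : {linear E -> 'rV[R]_m};
  cpsi : {linear 'rV[R]_m -> E};
  cphi_continuous : continuous cphi;
  cpsi_continuous : continuous cpsi;
  cphiK : cancel cphi cpsi;
  cpsiK : cancel cpsi cphi
}.

Context {m : nat} {E : normedModType R} (C : coords m E).

Definition cbase (j : 'I_m) : E := cpsi C (delta_mx 0 j).
Definition ccoord (j : 'I_m) (w : E) : R^o := cphi C w 0 j.

Lemma ccoord_is_linear j : linear (ccoord j).
Proof. by move=> a u v; rewrite /ccoord linearP !mxE. Qed.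
HB.instance Definition _ j := GRing.isLinear.Build R E R^o _ (ccoord j)
  (ccoord_is_linear j).

Lemma ccoord_continuous j : continuous (ccoord j).
Proof.
move=> x; apply: (@continuous_comp _ _ _ (cphi C) (fun w : 'rV[R]_m => w 0 j : R^o)).
  exact: cphi_continuous.
exact: coord_continuous.
Qed.

Lemma coordsE w : w = \sum_j ccoord j w *: cbase j.
Proof.
rewrite -[LHS](cphiK C) [X in cpsi C X]row_sum_delta linear_sum.
by apply: eq_bigr => j _; rewrite linearZ.
Qed.

Lemma linear_coordsE (F : lmodType R) (l : {linear E -> F}) w :
  l w = \sum_j ccoord j w *: l (cbase j).
Proof.
by rewrite [in LHS](coordsE w) linear_sum; apply: eq_bigr => j _; rewrite linearZ.
Qed.

Lemma linear_coords_continuous (F : normedModType R) (l : {linear E -> F})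
  : continuous l.
Proof.
have -> : (l : E -> F) = fun w => \sum_j ccoord j w *: l (cbase j).
  by apply/funext => w; rewrite linear_coordsE.
have H : Ck_on 0 setT (fun w => \sum_j ccoord j w *: l (cbase j)).
  apply: Ck_on_sum => [|j]; first exact: openT.
  apply: Ck_on_scale; first exact: openT.
    by move=> x _; exact: ccoord_continuous.
  exact: Ck_on_cst.
by move=> x; exact: H.
Qed.

Lemma diff_coordsE (F : normedModType R) (f : E -> F) x v : differentiable f x ->
  'D_v f x = \sum_j ccoord j v *: 'D_(cbase j) f x.
Proof.
move=> df; rewrite deriveE// linear_coordsE.
by apply: eq_bigr => j _; rewrite deriveE.
Qed.

(** The derivative of [g \o f] is ['D_('D_v f x) g (f x)], whose direction depends on [x], so the
    induction hypothesis does not apply to it directly. In coordinates it is a sum of products of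
    components of ['D_v f] with derivatives of [g] along the fixed vectors [cbase C j]. *)
Lemma Ck_on_comp (D F : normedModType R) k (A : set D) (B : set E)
    (f : D -> E) (g : E -> F) : open A -> open B ->
  (forall x, A x -> B (f x)) -> Ck_on k A f -> Ck_on k B g -> Ck_on k A (g \o f).
Proof.
move=> oA oB AB; elim: k g => [|k IH] g Hf Hg.
  by move=> x Ax; apply: continuous_comp; [exact: Hf|exact/Hg/AB].
have [df Df] := Hf; have [dg Dg] := Hg.
have dgf x : A x -> differentiable (g \o f) x.
  by move=> Ax; apply: differentiable_comp; [exact: df|exact/dg/AB].
split=> // v.
apply: (@Ck_on_eq _ _ _ _ _ (fun x => \sum_j ccoord j ('D_v f x) *: 'D_(cbase j)
  g (f x))) => //.
  move=> x Ax; have dfx := df x Ax; have dgx := dg _ (AB x Ax).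
  rewrite -diff_coordsE// [RHS](deriveE _ (dgf x Ax)) (diff_comp dfx dgx).
  by rewrite (deriveE _ dfx) (deriveE _ dgx).
apply: Ck_on_sum => // j; apply: Ck_on_scale => //.
  by apply: (Ck_on_linear_comp oA (@ccoord_continuous j)); exact: Df.
exact: (IH ('D_(cbase j) g) (Ck_onW Hf) (Dg _)).
Qed.

End Coordinates.

Section CoordsInstances.
Context {R : realType}.

Lemma Ck_on_mx (E : normedModType R) p q k (A : set E) (f : E -> 'M[R]_(p, q)) :
  open A -> (forall i j, Ck_on k A (fun x => f x i j : R^o)) -> Ck_on k A f.
Proof.
move=> oA H.
rewrite (_ : f = fun x => \sum_i \sum_j f x i j *: delta_mx i j); last first.
  by apply/funext => x; rewrite [LHS]matrix_sum_delta.
apply: Ck_on_sum => // i; apply: Ck_on_sum => // j.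
by apply: Ck_on_scale => //; exact: Ck_on_cst.
Qed.

Lemma continuous_mx (E : normedModType R) p q (f : E -> 'M[R]_(p, q)) :
  (forall i j, continuous (fun x => f x i j : R^o)) -> continuous f.
Proof.
move=> H x; suff : Ck_on 0 setT f by exact.
by apply: Ck_on_mx => [|i j y _]; [exact: openT|exact: H].
Qed.

Program Definition coords_rV m : coords (R := R) m 'rV[R]_m :=
  @Coords _ _ _ idfun idfun _ _ _ _.
Next Obligation. by move=> m x; exact: cvg_id. Qed.
Next Obligation. by move=> m x; exact: cvg_id. Qed.
Next Obligation. by []. Qed.
Next Obligation. by []. Qed.

Lemma linear_rV_continuous m (F : normedModType R) (l : {linear 'rV[R]_m -> F})
  : continuous l.
Proof. exact: (linear_coords_continuous (coords_rV m)). Qed.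

Definition const_row (r : R^o) : 'rV[R]_1 := const_mx r.
Lemma const_row_is_linear : linear const_row.
Proof. by move=> a u v; apply/rowP => i; rewrite !mxE. Qed.
HB.instance Definition _ := GRing.isLinear.Build R R^o 'rV[R]_1 _ const_row
  const_row_is_linear.

Definition const_row_inv (v : 'rV[R]_1) : R^o := v 0 0.
Lemma const_row_inv_is_linear : linear const_row_inv.
Proof. by move=> a u v; rewrite /const_row_inv !mxE. Qed.
HB.instance Definition _ :=
  GRing.isLinear.Build R 'rV[R]_1 R^o _ const_row_inv const_row_inv_is_linear.

Program Definition coords_R : coords (R := R) 1 R^o :=
  @Coords _ _ _ const_row const_row_inv _ (@linear_rV_continuous _ _ _) _ _.
Next Obligation.
apply: continuous_mx => i j.
by rewrite (_ : (fun _ => _) = idfun) ?funeqE => [|x]; [move=> x;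
  exact: cvg_id|rewrite mxE].
Qed.
Next Obligation. by move=> x; rewrite /= /const_row_inv /const_row mxE. Qed.
Next Obligation. by move=> x; apply/rowP => i;
  rewrite /= /const_row_inv /const_row !mxE ord1. Qed.

Program Definition coords_cV m : coords (R := R) m 'cV[R]_m :=
  @Coords _ _ _ trmx trmx _ (@linear_rV_continuous _ _ _) _ _.
Next Obligation.
move=> m; apply: continuous_mx => i j.
rewrite (_ : (fun _ => _) = (fun x : 'cV[R]_m => x j i)) ?funeqE => [|x];
  last by rewrite mxE.
exact: coord_continuous.
Qed.
Next Obligation. by move=> m x; exact: trmxK. Qed.
Next Obligation. by move=> m x; exact: trmxK. Qed.

Section Prod.
Context {E F : normedModType R} {p q : nat} (C : coords p E) (D : coords q F).

Definition prod_phi (x : E * F) : 'rV[R]_(p + q) := row_mx (cphi C x.1) (cphi D x.2).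
Lemma prod_phi_is_linear : linear prod_phi.
Proof. by move=> a u v; rewrite /prod_phi !linearP/= scale_row_mx add_row_mx. Qed.
HB.instance Definition _ :=
  GRing.isLinear.Build R (E * F)%type 'rV[R]_(p + q) _ prod_phi prod_phi_is_linear.

Definition prod_psi (v : 'rV[R]_(p + q)) : E * F := (cpsi C (lsubmx v),
  cpsi D (rsubmx v)).
Lemma prod_psi_is_linear : linear prod_psi.
Proof. by move=> a u v; rewrite /prod_psi !linearP. Qed.
HB.instance Definition _ :=
  GRing.isLinear.Build R 'rV[R]_(p + q) (E * F)%type _ prod_psi prod_psi_is_linear.

Program Definition coords_prod : coords (R := R) (p + q) (E * F)%type :=
  @Coords _ _ _ prod_phi prod_psi _ (@linear_rV_continuous _ _ _) _ _.
Next Obligation.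
apply: continuous_mx => i j; rewrite ord1.
case: (split_ordP j) => k ->.
  rewrite (_ : (fun _ => _) = (fun w => cphi C w 0 k : R^o) \o fst).
    move=> x; apply: continuous_comp; first exact: cvg_fst.
    exact: (@ccoord_continuous _ _ _ C).
  by apply/funext => x /=; rewrite row_mxEl.
rewrite (_ : (fun _ => _) = (fun w => cphi D w 0 k : R^o) \o snd).
  move=> x; apply: continuous_comp; first exact: cvg_snd.
  exact: (@ccoord_continuous _ _ _ D).
by apply/funext => x /=; rewrite row_mxEr.
Qed.
Next Obligation.
by case=> x y; rewrite /= /prod_psi /prod_phi/= row_mxKl row_mxKr !cphiK.
Qed.
Next Obligation.
by move=> v; rewrite /= /prod_phi /prod_psi/= !cpsiK hsubmxK.
Qed.

End Prod.

End CoordsInstances.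

(** * Germs of smooth maps; matrices and their inverses *)

Section SmoothNear.
Context {R : realType}.

(** [Ck_on k A f] is a conjunction of conditions at the points of [A] (see
    [Ck_onP]), so it makes sense at a single point; smoothness of the germ of
    [f] at [x] is that condition at all points near [x]. *)
Definition smooth_near (E F : normedModType R) (x : E) (f : E -> F) : Prop :=
  \forall y \near x, smooth_on [set y] f.

Lemma smooth_onP (E F : normedModType R) (A : set E) (f : E -> F) : open A ->
  smooth_on A f <-> forall x, A x -> smooth_near x f.
Proof.
move=> oA; split=> [H x Ax|H k].
  apply: filterS (open_nbhs_nbhs (conj oA Ax)) => y Ay k.
  exact: ((Ck_onP _ _ _).1 (H k)).
by apply/Ck_onP => x /H/nbhs_singleton; exact.
Qed.

Lemma smooth_nearP (E F : normedModType R) (x : E) (f : E -> F) :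
  smooth_near x f <-> exists A, [/\ open A, A x & smooth_on A f].
Proof.
split=> [|[A [oA Ax sA]]]; last exact: (smooth_onP f oA).1.
rewrite /smooth_near -nbhs_nearE nbhsE => -[A [oA Ax] H].
by exists A; split => // k; apply/Ck_onP => y /H.
Qed.

Lemma smooth_near_near (E F : normedModType R) (x : E) (f : E -> F) :
  smooth_near x f -> \forall y \near x, smooth_near y f.
Proof. by move=> /near_join. Qed.

Lemma smooth_near_eq (E F : normedModType R) (x : E) (f g : E -> F) :
  {near x, f =1 g} -> smooth_near x f -> smooth_near x g.
Proof.
move=> fg sf.
have : \forall y \near x, f y = g y /\ smooth_on [set y] f by exact: filterI.
rewrite -nbhs_nearE nbhsE => -[A [oA Ax] H].
apply/smooth_nearP; exists A; split => // k.
apply: (Ck_on_eq (f := f)) => // [y /H[]//|].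
by apply/Ck_onP => y /H[_].
Qed.

Section Pointwise.
Context {E F : normedModType R}.
Implicit Types (x v : E) (f g : E -> F).

Lemma smooth_near_differentiable x f : smooth_near x f -> differentiable f x.
Proof. by move=> /nbhs_singleton/(_ 1%N)[H _]; exact: H. Qed.

Lemma smooth_near_continuous x f : smooth_near x f -> {for x, continuous f}.
Proof. by move=> /smooth_near_differentiable/differentiable_continuous. Qed.

Lemma smooth_near_derive x f v : smooth_near x f -> smooth_near x ('D_v f).
Proof. by apply: filterS => y H k; exact: (H k.+1).2. Qed.

Lemma smooth_near_linear x (l : {linear E -> F}) : continuous l -> smooth_near x l.
Proof. by move=> cl; apply: nearW => y k; exact: Ck_on_linear. Qed.

Lemma smooth_near_cst x (w : F) : smooth_near x (cst w).
Proof. by apply: nearW => y k; exact: Ck_on_cst. Qed.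

Lemma smooth_nearD x f g : smooth_near x f -> smooth_near x g -> smooth_near x (f + g).
Proof.
move=> /smooth_nearP[A [oA Ax sA]] /smooth_nearP[B [oB Bx sB]].
apply/smooth_nearP; exists (A `&` B); split => //; first exact: openI.
move=> k; apply: Ck_onD; first exact: openI.
  by apply: Ck_on_subset (sA k) => ? [].
by apply: Ck_on_subset (sB k) => ? [].
Qed.

Lemma smooth_near_scale x (c : E -> R^o) f :
  smooth_near x c -> smooth_near x f -> smooth_near x (fun y => c y *: f y).
Proof.
move=> /smooth_nearP[A [oA Ax sA]] /smooth_nearP[B [oB Bx sB]].
apply/smooth_nearP; exists (A `&` B); split => //; first exact: openI.
move=> k; apply: Ck_on_scale; first exact: openI.
  by apply: Ck_on_subset (sA k) => ? [].
by apply: Ck_on_subset (sB k) => ? [].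
Qed.

Lemma smooth_near_sum x (I : Type) (r : seq I) (P : pred I) (f : I -> E -> F) :
  (forall i, smooth_near x (f i)) -> smooth_near x (fun y => \sum_(i <- r | P i) f i y).
Proof.
move=> H; elim: r => [|i r IH].
  rewrite (_ : (fun x => _) = cst 0); first exact: smooth_near_cst.
  by apply/funext => y; rewrite big_nil.
case: (boolP (P i)) => Pi; last first.
  by apply: smooth_near_eq IH; apply: nearW => y; rewrite big_cons (negbTE Pi).
apply: smooth_near_eq (smooth_nearD (H i) IH); apply: nearW => y.
by rewrite big_cons Pi.
Qed.

End Pointwise.

Lemma smooth_near_pair (E F G : normedModType R) x (f : E -> F) (g : E -> G) :
  smooth_near x f -> smooth_near x g -> smooth_near x (fun y => (f y, g y)).
Proof.
move=> /smooth_nearP[A [oA Ax sA]] /smooth_nearP[B [oB Bx sB]].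
apply/smooth_nearP; exists (A `&` B); split => //; first exact: openI.
move=> k; apply: Ck_on_pair; first exact: openI.
  by apply: Ck_on_subset (sA k) => ? [].
by apply: Ck_on_subset (sB k) => ? [].
Qed.

Lemma smooth_near_comp (D E F : normedModType R) m (C : coords m E) x
    (f : D -> E) (g : E -> F) :
  smooth_near x f -> smooth_near (f x) g -> smooth_near x (g \o f).
Proof.
move=> sf; have cf : f @ x --> f x by exact: smooth_near_continuous.
move: (sf) => /smooth_nearP[A [oA Ax sA]] /smooth_nearP[B [oB Bx sB]].
have : \forall y \near x, A y /\ B (f y).
  apply: filterI; first exact: (open_nbhs_nbhs (conj oA Ax)).
  exact: (cf _ (open_nbhs_nbhs (conj oB Bx))).
rewrite -nbhs_nearE nbhsE => -[V [oV Vx] H].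
apply/smooth_nearP; exists V; split => // k.
apply: (Ck_on_comp C oV oB) (sB k) => [y /H[]//|].
by apply: Ck_on_subset (sA k) => y /H[].
Qed.

Lemma smooth_near_linear_comp (D E F : normedModType R) x (f : D -> E)
  (l : {linear E -> F}) :
  continuous l -> smooth_near x f -> smooth_near x (l \o f).
Proof.
move=> cl /smooth_nearP[A [oA Ax sA]].
apply/smooth_nearP; exists A; split => // k.
exact: (Ck_on_linear_comp oA cl (sA k)).
Qed.

Lemma smooth_near_fst (E F : normedModType R) (z : E * F) : smooth_near z (@fst E F).
Proof. by have := @smooth_near_linear (E * F)%type E z fst; apply => x;
  exact: cvg_fst. Qed.

Lemma smooth_near_snd (E F : normedModType R) (z : E * F) : smooth_near z (@snd E F).
Proof. by have := @smooth_near_linear (E * F)%type F z snd; apply => x;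
  exact: cvg_snd. Qed.

Lemma smooth_nearM (E : normedModType R) x (f g : E -> R^o) :
  smooth_near x f -> smooth_near x g -> smooth_near x (fun y => f y * g y : R^o).
Proof. exact: smooth_near_scale. Qed.

Lemma smooth_near_prod (E : normedModType R) x (I : Type) (r : seq I) (P : pred I)
    (f : I -> E -> R^o) : (forall i, smooth_near x (f i)) ->
  smooth_near x (fun y => \prod_(i <- r | P i) f i y : R^o).
Proof.
move=> H; elim: r => [|i r IH].
  rewrite (_ : (fun x => _) = cst (1 : R^o)); first exact: smooth_near_cst.
  by apply/funext => y; rewrite big_nil.
case: (boolP (P i)) => Pi; last first.
  by apply: smooth_near_eq IH; apply: nearW => y; rewrite big_cons (negbTE Pi).
apply: smooth_near_eq (smooth_nearM (H i) IH); apply: nearW => y.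
by rewrite big_cons Pi.
Qed.

Lemma Ck_on_inv (E : normedModType R) k (A : set E) (f : E -> R^o) : open A ->
  (forall x, A x -> f x != 0) -> Ck_on k A f -> Ck_on k A (fun x => (f x)^-1 : R^o).
Proof.
move=> oA f0; elim: k => [|k IH] Hf.
  by move=> x Ax; apply: continuousV; [exact: f0|exact: Hf].
have [df Df] := Hf; have IHf := IH (Ck_onW Hf).
split=> [x Ax|v]; first by apply: differentiableV; [exact: df|exact: f0].
(* The factor [(f x)^-2] is split into two copies of the inverse, so that the induction hypothesis
   and the product rule suffice. *)
apply: (@Ck_on_eq _ _ _ _ _ (fun x => (f x)^-1 *: ((f x)^-1 *: ((-1 : R^o)
  *: 'D_v f x)))) => //.
  move=> x Ax; rewrite deriveV; [|exact: f0|by apply: diff_derivable; exact: df].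
  by rewrite scalerA -expr2 exprVn scaleN1r scaleNr scalerN.
apply: Ck_on_scale => //; apply: Ck_on_scale => //; apply: Ck_on_scale => //.
  exact: Ck_on_cst.
exact: Df.
Qed.

Lemma smooth_near_inv (E : normedModType R) x (f : E -> R^o) : f x != 0 ->
  smooth_near x f -> smooth_near x (fun y => (f y)^-1 : R^o).
Proof.
move=> f0 sf; have cf := smooth_near_continuous sf.
have : \forall y \near x, f y != 0 /\ smooth_on [set y] f.
  apply: filterI => //.
  exact: (cvgr_neq0 _ cf).
rewrite -nbhs_nearE nbhsE => -[V [oV Vx] H].
apply/smooth_nearP; exists V; split => // k.
apply: Ck_on_inv => // [y /H[]//|].
by apply/Ck_onP => y /H[].
Qed.

Definition mx_entry p q (i : 'I_p) (j : 'I_q) (M : 'M[R]_(p, q)) : R^o := M i j.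
Lemma mx_entry_is_linear p q i j : linear (@mx_entry p q i j).
Proof. by move=> a u v; rewrite /mx_entry !mxE. Qed.
HB.instance Definition _ p q i j :=
  GRing.isLinear.Build R 'M[R]_(p, q) R^o _ (@mx_entry p q i j)
    (mx_entry_is_linear i j).

Section Matrices.
Context {E : normedModType R}.

Lemma smooth_near_mxP x p q (M : E -> 'M[R]_(p, q)) :
  smooth_near x M <-> forall i j, smooth_near x (fun y => M y i j : R^o).
Proof.
split=> [sM i j|H].
  apply: (smooth_near_linear_comp (l := @mx_entry p q i j)) sM.
  exact: coord_continuous.
rewrite (_ : M = fun x => \sum_i \sum_j M x i j *: delta_mx i j); last first.
  by apply/funext => y; rewrite [LHS]matrix_sum_delta.
apply: smooth_near_sum => i; apply: smooth_near_sum => j.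
by apply: smooth_near_scale => //; exact: smooth_near_cst.
Qed.

Lemma smooth_near_mulmx x p q r (M : E -> 'M[R]_(p, q)) (N : E -> 'M[R]_(q, r)) :
  smooth_near x M -> smooth_near x N -> smooth_near x (fun y => M y *m N y).
Proof.
move=> /smooth_near_mxP sM /smooth_near_mxP sN; apply/smooth_near_mxP => i j.
apply: (smooth_near_eq (f := fun y => \sum_k M y i k * N y k j : R^o)).
  by apply: nearW => y; rewrite mxE.
by apply: smooth_near_sum => k; exact: smooth_nearM.
Qed.

Lemma smooth_near_det x p (M : E -> 'M[R]_p) :
  smooth_near x M -> smooth_near x (fun y => \det (M y) : R^o).
Proof.
move=> /smooth_near_mxP sM; apply: smooth_near_sum => s.
apply: smooth_nearM; first exact: smooth_near_cst.
by apply: smooth_near_prod => i; exact: sM.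
Qed.

Lemma near_unitmx x p (M : E -> 'M[R]_p) : smooth_near x M -> M x \in unitmx ->
  \forall y \near x, M y \in unitmx.
Proof.
move=> /smooth_near_det/smooth_near_continuous cM; rewrite unitmxE unitfE => M0.
apply: filterS (cvgr_neq0 _ cM M0) => y; by rewrite unitmxE unitfE.
Qed.

(** Cramer's rule makes the inverse a rational function of the entries. The formula agrees with
    [invmx] only on invertible matrices ([invmx] returns a singular matrix unchanged), but those
    fill a neighbourhood. *)
Lemma smooth_near_invmx x p (M : E -> 'M[R]_p) : smooth_near x M -> M x \in unitmx ->
  smooth_near x (fun y => invmx (M y)).
Proof.
move=> sM uM; apply: (smooth_near_eq (f := fun y => (\det (M y))^-1 *: \adj (M y))).
  by near=> y; rewrite /invmx; case: ifPn => // /negP[]; near: y; exact: near_unitmx.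
apply: smooth_near_scale.
  apply: smooth_near_inv; first by move: uM; rewrite unitmxE unitfE.
  exact: smooth_near_det.
apply/smooth_near_mxP => i j.
apply: (smooth_near_eq (f := fun y => cofactor (M y) j i : R^o)).
  by apply: nearW => y; rewrite mxE.
apply: smooth_nearM; first exact: smooth_near_cst.
apply: smooth_near_det; apply/smooth_near_mxP => k l.
apply: (smooth_near_eq (f := fun y => M y (lift j k) (lift i l) : R^o)).
  by apply: nearW => y; rewrite !mxE.
exact: ((smooth_near_mxP _ _).1 sM).
Unshelve. all: end_near. Qed.

End Matrices.

Lemma smooth_near_jacobian p q (x : 'rV[R]_p) (f : 'rV[R]_p -> 'rV[R]_q) :
  smooth_near x f -> smooth_near x (jacobian f).
Proof.
move=> sf; apply/smooth_near_mxP => i j.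
apply: (smooth_near_eq (f := fun y => 'D_(delta_mx 0 i) f y 0 j : R^o)).
  near=> y; rewrite deriveEjacobian -?rowE ?mxE//.
  by near: y; apply: filterS (smooth_near_near sf) => y;
    exact: smooth_near_differentiable.
by apply: ((smooth_near_mxP _ _).1 _ 0 j); exact: smooth_near_derive.
Unshelve. all: end_near. Qed.

End SmoothNear.

(** * Mean values and symmetry of second derivatives *)

Section MeanValue.
Context {R : realType} {E : normedModType R}.
Implicit Types (f : E -> R^o) (x v : E).

Lemma is_derive_line f x v (t : R^o) : derivable f (x + t *: v) v ->
  is_derive t (1 : R^o) (fun s : R^o => f (x + s *: v) : R^o) ('D_v f (x + t *: v)).
Proof.
have eqf : (fun h : R => h^-1 *: (((fun s : R^o => f (x + s *: v) : R^o) \o shift t)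
  (h *: (1 : R^o)) - f (x + t *: v)))
    = (fun h => h^-1 *: ((f \o shift (x + t *: v)) (h *: v) - f (x + t *: v))).
  apply/funext => h /=; congr (_ *: (f _ - _)).
  have -> : h *: (1 : R^o) = h by rewrite /GRing.scale/= mulr1.
  by rewrite scalerDl addrCA.
move=> df; apply: DeriveDef; first by rewrite /derivable eqf.
by rewrite /derive eqf.
Qed.

Lemma derivable_translate f x v c :
  derivable f (x + c) v -> derivable (fun y => f (y + c) : R^o) x v.
Proof.
rewrite /derivable; set g := fun h => _; set k := fun h => _.
by have -> : k = g by apply/funext => h; rewrite /k /g /= addrA.
Qed.

Lemma derive_translate f x v c : 'D_v (fun y => f (y + c) : R^o) x = 'D_v f (x + c).
Proof.
rewrite /derive; set g := fun h => _; set k := fun h => _.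
by have -> : k = g by apply/funext => h; rewrite /k /g /= addrA.
Qed.

Lemma derive_dirZ f x v (s : R) : differentiable f x -> 'D_(s *: v) f x = s * 'D_v f x.
Proof. by move=> df; rewrite !deriveE// linearZ. Qed.

(** Derivability is asked only in the direction of the segment, because [differentiable_partials]
    applies this lemma before full differentiability is known. *)
Lemma mean_value f x v :
  (forall t : R, 0 <= t <= 1 -> derivable f (x + t *: v) v) ->
  exists2 t : R, 0 <= t <= 1 & f (x + v) - f x = 'D_v f (x + t *: v).
Proof.
move=> df.
pose g := fun s : R^o => f (x + s *: v) : R^o.
have dg (t : R^o) : t \in `[0, 1]%R -> is_derive t (1 : R^o) g ('D_v f (x + t *: v)).
  by rewrite in_itv/= => t01; apply: is_derive_line; exact: df.
have dgo (t : R^o) : t \in `]0, 1[%R -> is_derive t (1 : R^o) g ('D_v f (x + t *: v)).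
  by rewrite in_itv/= => /andP[t0 t1]; apply: dg; rewrite in_itv/= !ltW.
have cg : {within `[0, 1], continuous g}.
  apply: derivable_within_continuous => t t01.
  by have [] := dg t t01.
have [t] := @MVT_segment R g (fun t => 'D_v f (x + t *: v)) 0 1 ler01 dgo cg.
by rewrite in_itv/= /g scale1r scale0r addr0 subr0 mulr1 => t01 ->; exists t.
Qed.

(** The left-hand side is symmetric in [u] and [v]: this is what identifies the
    two mixed derivatives in [smooth_near_schwarz]. *)
Lemma second_difference f x u v (d s : R) : 0 <= s -> s * (`|u| + `|v|) < d ->
  (forall z, ball x d z -> differentiable f z /\ differentiable ('D_u f) z) ->
  exists2 z, ball x d z & f (x + s *: u + s *: v) - f (x + s *: u) - (f (x + s *: v)
    - f x)
    = s ^+ 2 * 'D_v ('D_u f) z.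
Proof.
move=> s0 sd H.
have inb (t t' : R) : 0 <= t <= 1 -> 0 <= t' <= 1 ->
    ball x d (x + t *: (s *: u) + t' *: (s *: v)).
  move=> /andP[t0 t1] /andP[t'0 t'1].
  rewrite -ball_normE/= -addrA opprD addrA subrr sub0r normrN.
  apply: le_lt_trans (ler_normD _ _) _; apply: le_lt_trans sd.
  rewrite mulrDr !normrZ (ger0_norm t0) (ger0_norm t'0) (ger0_norm s0).
  by apply: lerD; rewrite ler_piMl// mulr_ge0.
have l01 : ((0 : R) <= (0 : R)) && ((0 : R) <= 1) by rewrite lexx ler01.
have l11 : ((0 : R) <= 1) && ((1 : R) <= 1) by rewrite lexx ler01.
(* [g] is the increment of [f] along [s *: v]. One mean value of [g] along [s *: u], then one of
   ['D_u f] along [s *: v], produce the mixed derivative. *)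
pose g y := f (y + s *: v) - f y : R^o.
have dg (t : R) : 0 <= t <= 1 ->
    derivable g (x + t *: (s *: u)) (s *: u) /\
    'D_(s *: u) g (x + t *: (s *: u)) =
      s * ('D_u f (x + t *: (s *: u) + s *: v) - 'D_u f (x + t *: (s *: u))).
  move=> t01.
  have [d1 _] := H _ (inb t 0 t01 l01); rewrite scale0r addr0 in d1.
  have [d2 _] := H _ (inb t 1 t01 l11); rewrite scale1r in d2.
  have d1' := @diff_derivable _ _ _ _ _ (s *: u) d1.
  have d2' := derivable_translate (@diff_derivable _ _ _ _ _ (s *: u) d2).
  split; first exact: derivableB.
  rewrite [LHS](deriveB d2' d1') derive_translate.
  by rewrite (derive_dirZ u s d1) (derive_dirZ u s d2) mulrBr.
have [t t01 gt] := mean_value (fun t t01 => (dg t t01).1).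
have [|t' t'01 ht] := @mean_value ('D_u f) (x + t *: (s *: u)) (s *: v).
  by move=> r r01; apply: diff_derivable; exact: (H _ (inb t r t01 r01)).2.
exists (x + t *: (s *: u) + t' *: (s *: v)); first exact: inb.
rewrite -[LHS]/(g (x + s *: u) - g x) gt (dg t t01).2 ht.
by rewrite (derive_dirZ v s (H _ (inb t t' t01 t'01)).2) mulrA.
Qed.

Lemma smooth_near_schwarz f x u v : smooth_near x f ->
  'D_u ('D_v f) x = 'D_v ('D_u f) x.
Proof.
move=> sf; apply/eqP; rewrite -subr_eq0 -normr_le0; apply/ler_addgt0Pr => e e0.
rewrite add0r.
have e20 : 0 < e / 2 by rewrite divr_gt0.
have c1 := smooth_near_continuous (smooth_near_derive v (smooth_near_derive u sf)).
have c2 := smooth_near_continuous (smooth_near_derive u (smooth_near_derive v sf)).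
move/cvgrPdist_lt: c1 => /(_ _ e20) c1; move/cvgrPdist_lt: c2 => /(_ _ e20) c2.
have : \forall z \near x, [/\ differentiable f z, differentiable ('D_u f) z,
    differentiable ('D_v f) z, `|'D_v ('D_u f) x - 'D_v ('D_u f) z| < e / 2 &
    `|'D_u ('D_v f) x - 'D_u ('D_v f) z| < e / 2].
  have dn g : smooth_near x g -> \forall z \near x, differentiable g z.
    by move=> /smooth_near_near; apply: filterS => z; exact: smooth_near_differentiable.
  have nI (P Q : set E) : nbhs x P -> nbhs x Q -> nbhs x (P `&` Q) by exact: filterI.
  have := nI _ _ (nI _ _ c1 c2) (nI _ _ (dn _ _ sf) (nI _ _
    (dn _ _ (smooth_near_derive u sf)) (dn _ _ (smooth_near_derive v sf)))).
  by apply: filterS => z [[h1 h2] [h3 [h4 h5]]]; exact: (And5 h3 h4 h5 h1 h2).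
move=> /nbhs_ballP[d /= d0 H].
(* With this scale the parallelogram with sides [s *: u] and [s *: v] stays inside the ball of
   radius [d]; the [+ 1] keeps the denominator positive when both vectors vanish. *)
pose s := d / (2 * (`|u| + `|v| + 1)).
have n0 : 0 < `|u| + `|v| + 1 by rewrite ltr_pwDr// addr_ge0.
have s0 : 0 < s by rewrite divr_gt0// mulr_gt0.
have sd : s * (`|u| + `|v|) < d.
  rewrite /s mulrAC ltr_pdivrMr ?mulr_gt0// ltr_pM2l//.
  by rewrite mulrDr mulr1 mulr2n mulrDl !mul1r ltr_pwDr// lerDl addr_ge0.
have [z1 bz1 E1] := second_difference (ltW s0) sd (fun z bz => let: And5 a b _ _ _ :=
  H z bz in conj a b).
have sd' : s * (`|v| + `|u|) < d by rewrite addrC.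
have [z2 bz2 E2] := second_difference (ltW s0) sd' (fun z bz => let: And5 a _ b _ _ :=
  H z bz in conj a b).
(* Both sides are the same second difference divided by [s ^+ 2]. The points [z1] and [z2] differ,
   but each value is within [e / 2] of the corresponding one at [x]. *)
have E12 : 'D_v ('D_u f) z1 = 'D_u ('D_v f) z2.
  apply: (@mulfI _ (s ^+ 2)); first by rewrite expf_neq0// gt_eqF.
  apply: etrans (esym E1) _; apply: etrans _ E2.
  rewrite [x + s *: v + s *: u]addrAC !opprB !addrA [LHS]addrAC [RHS]addrAC.
  by congr (_ + _); exact: addrAC.
have [_ _ _ H1 _] := H z1 bz1; have [_ _ _ _ H2] := H z2 bz2.
move: E12 H1 H2 => {E1 E2 c1 c2 H}.
generalize ('D_v ('D_u f) z1) ('D_u ('D_v f) z2) ('D_u ('D_v f) x) ('D_v ('D_u f) x).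
move=> p q r t <- H1 H2; rewrite -(subrKA p) (le_trans (ler_normD _ _))//.
by rewrite (splitr e) lerD// ltW// distrC.
Qed.

End MeanValue.

(** * Differentiability from continuous partial derivatives *)

Section Partials.
Context {R : realType} {E : normedModType R} {m : nat} (C : coords m E).

Lemma ccoord_bound : exists2 K : R, 0 < K & forall j (w : E),
  `|ccoord C j w| <= K * `|w|.
Proof.
have /choice[k Hk] : forall j, exists k : R, 0 < k /\ forall w,
  `|ccoord C j w| <= k * `|w|.
  move=> j; have [k k0 H] := linear_lipschitz (@ccoord_continuous _ _ _ C j).
  by exists k.
(* The [1] keeps the constant positive in dimension zero. *)
exists (1 + \sum_j k j).
  by rewrite ltr_pwDl// sumr_ge0// => j _; exact/ltW/(Hk j).1.
move=> j w; apply: le_trans ((Hk j).2 w) _; rewrite ler_wpM2r//.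
rewrite (bigD1 j)//= addrCA lerDl addr_ge0// sumr_ge0// => i _; exact/ltW/(Hk i).1.
Qed.

Lemma linear_funE (F : normedModType R) (l : E -> F) : linear l -> forall w,
  l w = \sum_j ccoord C j w *: l (cbase C j).
Proof.
move=> ll w; pose L : {linear E -> F} := HB.pack l (GRing.isLinear.Build R E F _ l ll).
exact: (linear_coordsE C L).
Qed.

(** The mean value theorem turns [f y - f x] into [a z (y - x)] with [z] on the segment, and [a z]
    is uniformly close to [a x] because it is so on the finitely many basis vectors. This serves the
    primitive in the Poincaré lemma, for which differentiation under the integral only provides
    directional derivatives. *)
Lemma differentiable_partials (f : E -> R^o) (a : E -> E -> R^o) x :
  (forall y, linear (a y)) ->
  (\forall y \near x, forall v, derivable f y v /\ 'D_v f y = a y v) ->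
  (forall v, {for x, continuous (a ^~ v)}) -> differentiable f x.
Proof.
move=> la Hf ca.
pose ax : {linear E -> R^o} := HB.pack (a x) (GRing.isLinear.Build R E R^o _ (a x)
  (la x)).
suff : is_diff x f ax by case.
have [K K0 HK] := ccoord_bound.
apply: is_diff_eps => [|e e0]; first exact: (linear_coords_continuous C).
(* With this tolerance each of the [m] coordinates contributes at most [e / m.+1%:R] times the norm
   of [y - x]; [m.+1] instead of [m] covers dimension zero. *)
have : \forall z \near x, (forall v, derivable f z v /\ 'D_v f z = a z v) /\
    forall j, `|a x (cbase C j) - a z (cbase C j)| <= e / (K * m.+1%:R).
  apply: filterI => //; apply: filter_forall => j.
  have := ca (cbase C j) => /cvgrPdist_le; apply.
  by rewrite divr_gt0// mulr_gt0.
move=> /nbhs_ballP[d /= d0 H].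
near=> y.
have by_ : ball x d y by near: y; exact: nbhsx_ballx.
have seg (t : R) : 0 <= t <= 1 -> ball x d (x + t *: (y - x)).
  move=> /andP[t0 t1]; move: by_; rewrite -!ball_normE/= opprD addrA subrr sub0r normrN.
  by rewrite distrC normrZ ger0_norm//; apply: le_lt_trans; rewrite ler_piMl.
have [|t t01] := @mean_value _ _ f x (y - x).
  by move=> t t01; exact: ((H _ (seg t t01)).1 _).1.
rewrite [x + (y - x)]addrC subrK => ->.
have [H1 H2] := H _ (seg t t01).
rewrite (H1 _).2; set z := x + _.
rewrite [a z _](linear_funE (la z)) [a x (_ - _)](linear_funE (la x)) -sumrB.
apply: le_trans (ler_norm_sum _ _ _) _.
apply: (@le_trans _ _ (\sum_(j < m) e / m.+1%:R * `|y - x|)).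
  apply: ler_sum => j _; rewrite -scalerBr normrZ distrC.
  apply: le_trans (ler_pM _ _ (HK j _) (H2 j)) _ => //.
  rewrite le_eqVlt; apply/orP; left; apply/eqP.
  have : m.+1%:R != 0 :> R by rewrite pnatr_eq0.
  have : K != 0 by rewrite gt_eqF.
  move: (m.+1%:R : R) => N K1 N1.
  by field; rewrite K1 N1.
rewrite sumr_const card_ord -mulrnAl ler_wpM2r// -mulr_natr mulrAC.
by rewrite ler_pdivrMr// ler_pM2l// ler_nat.
Unshelve. all: end_near. Qed.

End Partials.

(** * The inverse function theorem *)

(* Makes ['rV[R]_m] a [completeNormedModType], as Banach's theorem requires. *)
HB.instance Definition _ (R : realType) p q := Complete.on 'M[R]_(p, q).

Section DeriveLinear.
Context {R : realType}.

Lemma derive_linear_comp (D E F : normedModType R) (f : D -> E) (l : {linear E -> F})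
  x v :
  continuous l -> differentiable f x -> 'D_v (l \o f) x = l ('D_v f x).
Proof.
move=> cl df; have dl : differentiable l (f x) by exact: linear_differentiable.
rewrite (deriveE _ (differentiable_comp df dl)) (deriveE _ df).
by rewrite (diff_comp df dl) (diff_lin _ cl).
Qed.

Lemma derive_entry (D : normedModType R) p q (f : D -> 'M[R]_(p, q)) x v i j :
  differentiable f x -> 'D_v (fun y => f y i j : R^o) x = 'D_v f x i j.
Proof.
move=> df; have := @derive_linear_comp D _ _ f (@mx_entry R p q i j) x v.
by apply => //; exact: coord_continuous.
Qed.

Lemma derive_mulmxr (D : normedModType R) p q r (f : D -> 'M[R]_(p, q)) (M : 'M[R]_(q,
  r)) x v :
  continuous (mulmxr M : 'M[R]_(p, q) -> 'M[R]_(p, r)) ->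
  differentiable f x -> 'D_v (fun y => f y *m M) x = 'D_v f x *m M.
Proof.
move=> cM df; exact: (@derive_linear_comp D _ _ f (mulmxr M) x v cM df).
Qed.

Lemma mulmxr_continuous p q (M : 'M[R]_(p, q)) :
  continuous (mulmxr M : 'rV[R]_p -> 'rV[R]_q).
Proof. exact: linear_rV_continuous. Qed.

Lemma mulmxr_bound p q (M : 'M[R]_(p, q)) :
  exists2 K : R, 0 < K & forall v : 'rV[R]_p, `|v *m M| <= K * `|v|.
Proof. exact: linear_lipschitz (@mulmxr_continuous _ _ M). Qed.

End DeriveLinear.

(** * Lipschitz estimates near a critical point *)

Section Lipschitz.
Context {R : realType} {E : normedModType R} {m : nat} (C : coords m E).

Lemma ball_segment (a x y : E) (r t : R) : 0 <= t <= 1 ->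
  ball a r x -> ball a r y -> ball a r (x + t *: (y - x)).
Proof.
move=> /andP[t0 t1]; rewrite -!ball_normE/= => ax ay.
have -> : a - (x + t *: (y - x)) = (1 - t) *: (a - x) + t *: (a - y).
  have -> : a - y = (a - x) - (y - x) by rewrite opprB addrA subrK.
  by rewrite scalerBl scale1r [t *: (_ - (y - x))]scalerBr addrA subrK opprD addrA.
apply: le_lt_trans (ler_normD _ _) _; rewrite !normrZ (ger0_norm t0)
  ger0_norm ?subr_ge0//.
have [->|tn0] := eqVneq t 0; first by rewrite subr0 mul1r mul0r addr0.
have -> : r = (1 - t) * r + t * r by rewrite -mulrDl subrK mul1r.
apply: ler_ltD; first by rewrite ler_wpM2l ?subr_ge0// ltW.
by rewrite ltr_pM2l// lt0r tn0.
Qed.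

(** A derivative that vanishes at [a] is small near [a], and the mean value theorem on a convex ball
    converts this into a small Lipschitz constant. The radius ranges over all small positive numbers
    so that the entries of a matrix can share one. *)
Lemma lipschitz_near (f : E -> R^o) (a : E) (e : R) : 0 < e -> smooth_near a f ->
  (forall v, 'D_v f a = 0) ->
  \forall r \near 0^'+, forall x y, ball a r x -> ball a r y ->
    `|f x - f y| <= e * `|x - y|.
Proof.
move=> e0 sf Df0; have [K K0 HK] := ccoord_bound C.
pose d := e / (K * m.+1%:R).
have d0 : 0 < d by rewrite divr_gt0// mulr_gt0.
have : \forall z \near a, differentiable f z /\ forall j, `|'D_(cbase C j) f z| <= d.
  apply: filterI.
    by apply: filterS (smooth_near_near sf) => z; exact: smooth_near_differentiable.
  apply: filter_forall => j.
  have /cvgrPdist_le/(_ _ d0) := smooth_near_continuous (smooth_near_derive (cbase C j)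
    sf).
  by rewrite Df0; apply: filterS => z; rewrite sub0r normrN.
move=> /nbhs_ballP[r0 /= r00 H].
near=> r => x y ax ay.
have rr0 : r <= r0 by near: r; exact: nbhs_right_le.
have sub (t : R) : 0 <= t <= 1 -> ball a r0 (y + t *: (x - y)).
  by move=> t01; apply: (le_ball rr0); exact: ball_segment.
have [|t t01] := @mean_value _ _ f y (x - y).
  by move=> t t01; apply: diff_derivable; exact: (H _ (sub t t01)).1.
rewrite [y + (x - y)]addrC subrK => ->.
have [df Hd] := H _ (sub t t01).
rewrite (diff_coordsE C _ df).
apply: le_trans (ler_norm_sum _ _ _) _.
apply: (@le_trans _ _ (\sum_(j < m) e / m.+1%:R * `|x - y|)).
  apply: ler_sum => j _; rewrite normrZ.
  apply: le_trans (ler_pM _ _ (HK j _) (Hd j)) _ => //.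
  rewrite le_eqVlt; apply/orP; left; apply/eqP; rewrite /d.
  have : m.+1%:R != 0 :> R by rewrite pnatr_eq0.
  have : K != 0 by rewrite gt_eqF.
  move: (m.+1%:R : R) => N K1 N1.
  by field; rewrite K1 N1.
rewrite sumr_const card_ord -mulrnAl ler_wpM2r// -mulr_natr mulrAC.
by rewrite ler_pdivrMr// ler_pM2l// ler_nat.
Unshelve. all: end_near. Qed.

Lemma lipschitz_mx_near p q (f : E -> 'M[R]_(p, q)) (a : E) (e : R) : 0 < e ->
  smooth_near a f -> (forall v, 'D_v f a = 0) ->
  \forall r \near 0^'+, forall x y, ball a r x -> ball a r y ->
    `|f x - f y| <= e * `|x - y|.
Proof.
move=> e0 sf Df0.
have : \forall r \near 0^'+, forall ij : 'I_p * 'I_q, forall x y, ball a r x ->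
  ball a r y ->
    `|f x ij.1 ij.2 - f y ij.1 ij.2| <= e * `|x - y|.
  apply: filter_forall => -[i j]; apply: lipschitz_near => //=.
    exact: ((smooth_near_mxP _ _).1 sf).
  move=> v; rewrite derive_entry; last exact: smooth_near_differentiable.
  by rewrite Df0 mxE.
apply: filterS => r H x y ax ay.
rewrite [leLHS]/Num.Def.normr/= mx_normrE; apply: bigmax_le => [|ij _];
  last by rewrite !mxE; exact: H.
by rewrite mulr_ge0// ltW.
Qed.

End Lipschitz.

Section InverseFunction.
Context {R : realType} {m : nat}.
Implicit Types (f : 'rV[R]_m -> 'rV[R]_m) (a : 'rV[R]_m).

(** [f x = w] is solved by the fixed point of the contraction
    [x |-> w + (x - f x)]. *)
Lemma near_identity_open f a (r : R) x0 (s : R) : 0 < s ->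
  (forall x y, ball a r x -> ball a r y ->
     `|(x - f x) - (y - f y)| <= 2^-1 * `|x - y|) ->
  closed_ball x0 s `<=` ball a r ->
  forall w, `|w - f x0| <= s / 2 -> exists2 x, ball a r x & f x = w.
Proof.
move=> s0 lip sub w hw.
pose U := closed_ball x0 s.
pose psi x := w + (x - f x).
have Ux0 : U x0 by exact: closed_ballxx.
have UE x : U x = (`|x0 - x| <= s) by rewrite /U closed_ballE.
(* The ball is mapped into itself: half of [s] pays for [w - f x0], the other half for the
   contraction. *)
have psiU : {homo psi : x / U x >-> U x}.
  move=> x Ux; rewrite UE; rewrite UE in Ux.
  have := lip x0 x (sub _ Ux0) _; rewrite /psi.
  have -> : x0 - (w + (x - f x)) = (x0 - f x0 - (x - f x)) - (w - f x0).
    by apply/rowP => i; rewrite !mxE; ring.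
  move=> l; apply: le_trans (ler_normB _ _) _.
  rewrite (splitr s) lerD//; apply: le_trans (l _) _; first by apply: sub;
    rewrite -/U UE.
  by rewrite mulrC ler_wpM2r// invr_ge0.
pose P := mkfun psiU : {fun U >-> U}.
have cP : is_contraction P.
  exists (2^-1)%:nng; split; first by rewrite /= invf_lt1// ltr1n.
  move=> [x y] [/= Ux Uy] /=.
  have -> : P x - P y = (x - f x) - (y - f y).
    by rewrite /P/= /psi opprD addrACA subrr add0r.
  by apply: lip; exact: sub.
have cU : closed U by exact: closed_ball_closed.
have [|x Ux xP] := banach_fixed_point cP cU; first by exists x0.
exists x; first exact: sub.
have xP' : x = w + (x - f x) by exact: xP.
by have := congr1 (fun z => z - (x - f x)) xP'; rewrite addrK opprB addrC subrK.
Qed.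

(** After multiplication by the inverse Jacobian at [a], [h] differs from the identity by [phi],
    whose derivative vanishes at [a] and which is therefore a contraction by [2^-1] on a small ball.
    Injectivity and openness both follow from that estimate. The predicate [P] lets a caller confine
    [V] to points where its charts are defined. *)
Theorem inverse_function_rV f a (P : 'rV[R]_m -> Prop) :
  smooth_near a f -> jacobian f a \in unitmx -> (\forall x \near a, P x) ->
  exists V g, [/\ open V /\ V a, forall x, V x -> P x, open (f @` V),
    forall x, V x -> smooth_near x f /\ g (f x) = x &
    forall y, (f @` V) y -> smooth_near y g].
Proof.
move=> sf uf nP; pose T := invmx (jacobian f a).
have uT : T \in unitmx by rewrite unitmx_inv.
pose h x := f x *m T.
pose phi x := x - h x.
have sid x : smooth_near x (idfun : 'rV[R]_m -> 'rV[R]_m).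
  by apply: smooth_near_linear => z; exact: cvg_id.
have sh : smooth_near a h.
  by apply: smooth_near_mulmx => //; exact: smooth_near_cst.
have df := smooth_near_differentiable sf.
have sphi : smooth_near a phi.
  have -> : phi = idfun + (fun x => cst (-1 : R^o) x *: h x).
    by apply/funext => x; rewrite fctE/= scaleN1r.
  by apply: smooth_nearD => //; apply: smooth_near_scale => //; exact: smooth_near_cst.
have dphi0 v : 'D_v phi a = 0.
  have dh := smooth_near_differentiable sh.
  rewrite (deriveB (f := idfun)) ?derive_id//; [|exact: diff_derivable].
  rewrite derive_mulmxr//; last exact: mulmxr_continuous.
  by rewrite deriveEjacobian// /T mulmxK// subrr.
have lip := lipschitz_mx_near (coords_rV m) (e := 2^-1) _ sphi dphi0.
have /nbhs_ballP[r0 /= r00 Hr0] : \forall x \near a, smooth_near x f /\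
  jacobian f x \in unitmx /\ P x.
  have n1 := smooth_near_near sf.
  have n2 := near_unitmx (smooth_near_jacobian sf) uf.
  by near=> x; split; [|split]; near: x.
have [r [r0' rr0 lipr]] : exists r, [/\ 0 < r, r <= r0 &
    forall x y, ball a r x -> ball a r y -> `|phi x - phi y| <= 2^-1 * `|x - y|].
  near (0:R)^'+ => r; exists r; split => //.
  - by near: r; exact: nbhs_right_le.
  - by near: r; apply: lip; rewrite invr_gt0.
pose V := ball a r.
have oV : open V by exact: ball_open.
have Va : V a by exact: ballxx.
have VP x : V x -> smooth_near x f /\ jacobian f x \in unitmx /\ P x.
  by move=> /(le_ball rr0); exact: Hr0.
(* Since [x - y] is the sum of the increments of [phi] and [h], and the first takes up at most half
   of its norm, [h] has an inverse with Lipschitz constant [2]. *)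
have hlip x y : V x -> V y -> `|x - y| <= 2 * `|h x - h y|.
  move=> Vx Vy; have := lipr x y Vx Vy.
  have E : x - y = (phi x - phi y) + (h x - h y).
    by apply/rowP => i; rewrite /phi !mxE; ring.
  have := ler_normD (phi x - phi y) (h x - h y); rewrite -E => l1 l2.
  lra.
have injf x y : V x -> V y -> f x = f y -> x = y.
  move=> Vx Vy fxy; apply/eqP; rewrite -subr_eq0 -normr_le0.
  by apply: le_trans (hlip x y Vx Vy) _; rewrite /h fxy subrr normr0 mulr0.
have ofV : open (f @` V).
  rewrite openE => _ [x0 Vx0 <-].
  have /nbhs_ballP[s /= s0 Hs] : nbhs x0 V by exact: open_nbhs_nbhs.
  have s20 : 0 < s / 2 by rewrite divr_gt0.
  have sub : closed_ball x0 (s / 2) `<=` V.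
    move=> x; rewrite closed_ballE//= /closed_ball_/= => hx; apply: Hs.
    rewrite -ball_normE/=; apply: le_lt_trans hx _.
    by rewrite ltr_pdivrMr// mulr_natr mulr2n ltrDl.
  have surj := near_identity_open s20 lipr sub.
  have : \forall y \near f x0, `|h x0 - y *m T| <= s / 2 / 2.
    have /cvgrPdist_le := @mulmxr_continuous _ _ _ T (f x0).
    by apply; rewrite divr_gt0.
  apply: filterS => y; rewrite distrC => /surj[x Vx hx]; exists x => //.
  by apply: (can_inj (mulmxK uT)).
(* Off the image of [V] the inverse has the arbitrary value [a]. *)
pose g y := xget a [set x | V x /\ f x = y].
have gf x : V x -> g (f x) = x.
  move=> Vx; have : exists x', [set x' | V x' /\ f x' = f x] x' by exists x.
  by move=> /(xgetPex a)[Vg fg]; apply: injf.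
have Vg y : (f @` V) y -> V (g y) /\ f (g y) = y by move=> [x Vx <-]; rewrite gf.
have [K K0 HK] := mulmxr_bound T.
have glip y y' : (f @` V) y -> (f @` V) y' -> `|g y - g y'| <= 2 * K * `|y - y'|.
  move=> /Vg[Vy fy] /Vg[Vy' fy']; apply: le_trans (hlip _ _ Vy Vy') _.
  rewrite -mulrA ler_pM2l// /h fy fy' -mulmxBl; exact: HK.
have cg y : (f @` V) y -> {for y, continuous g}.
  move=> By; apply/(@cvgrPdist_le _ _ _ _ (nbhs_filter y)) => e e0.
  have : \forall y' \near y, (f @` V) y' /\ `|y - y'| <= e / (2 * K).
    apply: filterI; first exact: open_nbhs_nbhs.
    apply/nbhs_ballP; exists (e / (2 * K)); first by rewrite /= divr_gt0// mulr_gt0.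
    by move=> z; rewrite -ball_normE/= => /ltW.
  apply: filterS => y' [By' hy]; apply: le_trans (glip _ _ By By') _.
  by rewrite mulrC -ler_pdivlMr// mulr_gt0.
have dg y : (f @` V) y -> is_diff y g (mulmxr (invmx (jacobian f (g y))) : 'rV_m ->
  'rV_m).
  move=> By; have [Vy fy] := Vg y By; have [sfy [ufy _]] := VP _ Vy.
  set J := jacobian f (g y) in ufy *.
  apply: is_diff_eps => [|e e0]; first exact: mulmxr_continuous.
  have [K' K'0 HK'] := mulmxr_bound (invmx J).
  (* [2 * K] is a Lipschitz constant of [g] and [K'] bounds multiplication by the inverse Jacobian,
     so an error of this relative size in the expansion of [f] at [g y] becomes an error [e] for
     [g]. *)
  have e'0 : 0 < e / (2 * K * K') by rewrite divr_gt0// !mulr_gt0.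
  have dfy := smooth_near_differentiable sfy.
  have d1 := diff_eps dfy e'0.
  have d2 : \forall y' \near y, `|f (g y') - f (g y) - 'd f (g y)
    (g y' - g y)| <= e / (2 * K * K') * `|g y' - g y|.
    exact: (cg y By _ d1).
  have : nbhs y (f @` V) by exact: open_nbhs_nbhs.
  apply: filterS2 d2 => y' + By'; have [Vy' fy'] := Vg y' By'.
  rewrite fy fy' -deriveE// deriveEjacobian// -/J => H.
  have -> : g y' - g y - mulmxr (invmx J) (y' - y) = - ((y' - y - (g y' - g y) *m J)
    *m invmx J).
    by rewrite /= [(_ - _ *m J) *m _]mulmxBl mulmxK// opprB.
  rewrite normrN; apply: le_trans (HK' _) _.
  rewrite mulrC -ler_pdivlMr//; apply: le_trans H _.
  apply: le_trans (ler_wpM2l (ltW e'0) (glip _ _ By' By)) _.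
  rewrite le_eqVlt; apply/orP; left; apply/eqP.
  have : K != 0 by rewrite gt_eqF.
  have : K' != 0 by rewrite gt_eqF.
  by move=> K1 K2; field; rewrite K1 K2.
exists V, g; split => //.
- by move=> x /VP[_ []].
- by move=> x Vx; split; [exact: (VP x Vx).1|exact: gf].
(* Bootstrap: the derivative of [g] along [v] is a smooth function composed with [g] itself, so it
   is of class C^k as soon as [g] is, and [g] gains one order. *)
apply/smooth_onP => //; elim=> [|k IH]; first exact: cg.
split=> [y By|v]; first by have [] := dg y By.
apply: (@Ck_on_eq _ _ _ _ _ ((fun x => v *m invmx (jacobian f x)) \o g)) => //.
  move=> y By; have [d1 d2] := dg y By.
  by rewrite (deriveE _ d1) d2.
apply: (Ck_on_comp (coords_rV m) ofV oV) IH _ => [y /Vg[]//|].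
apply: (smooth_onP _ oV).2 => x Vx.
apply: smooth_near_mulmx; first exact: smooth_near_cst.
by apply: smooth_near_invmx; [apply: smooth_near_jacobian|]; have [? []] := VP x Vx.
Unshelve. all: end_near. Qed.

End InverseFunction.

(** * The Poincaré lemma *)

Section Poincare.
Context {R : realType}.
Notation mu := (@lebesgue_measure R).

Lemma within_continuous_line (g : R -> R) :
  (forall t : R, 0 <= t <= 1 -> {for t, continuous g}) ->
  {within `[(0:R), 1], continuous g}.
Proof.
move=> cg; apply: continuous_in_subspaceT => t.
by rewrite inE/= in_itv/=; exact: cg.
Qed.

Lemma pair_continuous (s t : R) :
  {for t, continuous (fun t : R => ((s : R^o), (t : R^o)))}.
Proof.
apply: (@smooth_near_continuous _ R^o (R^o * R^o)%type t (fun t : R^o => ((s : R^o),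
  t))).
apply: smooth_near_pair; first exact: smooth_near_cst.
by have := @smooth_near_linear R R^o R^o t idfun; apply => x; exact: cvg_id.
Qed.

Lemma derive_fst_line (f : R^o * R^o -> R^o) (s t : R^o) : differentiable f (s, t) ->
  is_derive s (1 : R^o) (fun s : R^o => f (s, t) : R^o) ('D_(1, 0) f (s, t)).
Proof.
have E (s' : R^o) : ((0 : R^o), t) + s' *: ((1 : R^o), (0 : R^o)) = (s', t).
  by congr (_, _); rewrite /= ?add0r /GRing.scale/= ?mulr1 ?mulr0 ?addr0.
move=> df.
have := @is_derive_line R _ f (0, t) (1, 0) s; rewrite E.
move=> /(_ (@diff_derivable _ _ _ _ _ _ df)).
by rewrite (_ : (fun s0 : R^o => _) = (fun s : R^o => f (s, t) : R^o))//;
  apply/funext => s'; rewrite E.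
Qed.

(** Differentiation under the integral sign. A constant dominates the partial derivative, because
    the latter is continuous on the compact rectangle where the first variable is at most [d] in
    absolute value and the second lies in the unit interval. *)
Lemma derivable_integral01 (f : R^o * R^o -> R^o) (d : R) : 0 < d ->
  (forall s t : R, `|s| <= d -> 0 <= t <= 1 -> smooth_near (s, t) f) ->
  let F s := (\int[mu]_(t in `[0%R, 1%R]) f (s, t))%R in
  derivable (F : R^o -> R^o) 0 1 /\
  'D_1 (F : R^o -> R^o) 0 = (\int[mu]_(t in `[0%R, 1%R]) 'D_(1, 0) f (0%R, t))%R.
Proof.
move=> d0 sf F.
have sd (s t : R) : `|s| <= d -> 0 <= t <= 1 -> differentiable f (s, t).
  by move=> hs ht; apply: smooth_near_differentiable; exact: sf.
pose K := `[- d, d]%classic `*` `[(0:R), 1]%classic : set (R^o * R^o).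
have cK : compact K by apply: compact_setX; exact: segment_compact.
have cD : {within K, continuous ('D_(1, 0) f)}.
  apply: continuous_in_subspaceT => -[s t]; rewrite inE => -[/=].
  rewrite !in_itv/= => hs ht; apply: smooth_near_continuous; apply: smooth_near_derive.
  by apply: sf => //; rewrite ler_norml.
have [M [Mr HM]] := compact_bounded (continuous_compact cD cK).
have {HM} HM : forall s t : R, `|s| <= d -> 0 <= t <= 1 -> `|'D_(1, 0) f (s,
  t)| <= `|M| + 1.
  move=> s t hs ht; apply: HM; first by rewrite (le_lt_trans (ler_norm M))// ltrDl.
  by exists (s, t) => //; split; rewrite /= in_itv/= -?ler_norml.
have I0 : [set` `]- d, d[%R] (0 : R) by rewrite /= in_itv/= oppr_lt0 d0.
have Id (s : R) : [set` `]- d, d[%R] s -> `|s| <= d.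
  by rewrite /= in_itv/= => /andP[h1 h2]; rewrite ler_norml !ltW.
have intf (s : R) : [set` `]- d, d[%R] s -> mu.-integrable `[0%R, 1%R]
  (EFin \o (fun t => f (s, t))).
  move=> /Id hs; apply: continuous_compact_integrable; first exact: segment_compact.
  apply: within_continuous_line => t ht.
  apply: (@continuous_comp _ _ _ (fun t : R => (s, t)) f).
    exact: pair_continuous.
  exact: smooth_near_continuous (sf s t hs ht).
have derf (s t : R) : [set` `]- d, d[%R] s -> [set` `[(0:R), 1]%R] t ->
  derivable (fun s : R => f (s, t) : R^o) s 1.
  by move=> /Id hs; rewrite /= in_itv/= => ht; have [] :=
    derive_fst_line (sd s t hs ht).
have intG : mu.-integrable `[0%R, 1%R] (EFin \o (fun=> `|M| + 1)).
  apply: continuous_compact_integrable; first exact: segment_compact.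
  by apply: within_continuous_line => t ht; exact: cst_continuous.
have derE (s t : R) : [set` `]- d, d[%R] s -> [set` `[(0:R), 1]%R] t ->
    partial1of2 (fun s t => f (s, t)) s t = 'D_(1, 0) f (s, t).
  move=> /Id hs; rewrite /= in_itv/= => ht.
  by rewrite partial1of2E; have [_ <-] := derive_fst_line (sd s t hs ht).
have Gub (s t : R) : [set` `]- d, d[%R] s -> [set` `[(0:R), 1]%R] t ->
   `|partial1of2 (fun s t => f (s, t)) s t| <= `|M| + 1.
  move=> hs ht; rewrite derE//; apply: HM; first exact: Id.
  by move: ht; rewrite /= in_itv.
have G0 (t : R) : 0 <= `|M| + 1 by rewrite addr_ge0.
split.
  exact: (@derivable_under_integral R _ _ mu (fun s t => f (s, t)) `[0%R, 1%R]%classic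
    (measurable_itv _) 0 (- d) d I0 intf derf _ G0 intG Gub).
have := (@differentiation_under_integral R _ _ mu (fun s t => f (s, t)) `[0%R,
  1%R]%classic
    (measurable_itv _) 0 (- d) d I0 intf derf _ G0 intG Gub).
rewrite derive1E => ->.
by apply: eq_Rintegral => t; rewrite inE => ht; exact: derE.
Qed.

Lemma FTC01 (g : R -> R^o) (G : R^o -> R^o) :
  (forall t : R, 0 <= t <= 1 -> {for t, continuous g} /\ is_derive (t : R^o) 1 G (g t))
    ->
  (\int[mu]_(t in `[0%R, 1%R]) g t)%R = G 1 - G 0.
Proof.
move=> H.
have cG (t : R) : 0 <= t <= 1 -> {for t, continuous (G : R -> R)}.
  move=> /H[_ [dG _]]; exact/differentiable_continuous/derivable1_diffP.
rewrite /Rintegral (@continuous_FTC2 R g G)//=.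
- by apply: within_continuous_line => t /H[].
- split.
  + by move=> t; rewrite in_itv/= => /andP[t0 t1]; have [|_ []] := H t;
    first by rewrite !ltW.
  + by apply: cvg_at_right_filter; apply: cG; rewrite lexx ler01.
  + by apply: cvg_at_left_filter; apply: cG; rewrite lexx ler01.
- move=> t; rewrite in_itv/= => /andP[t0 t1]; rewrite derive1E.
  by have [|_ []] := H t; first by rewrite !ltW.
Qed.

Context {E : normedModType R} {m : nat} (C : coords m E).

Lemma poincare_ball (x0 : E) (r : R) (a : E -> E -> R^o) :
  (forall y, linear (a y)) ->
  (forall y v, ball x0 r y -> smooth_near y (a ^~ v)) ->
  (forall y u v, ball x0 r y -> 'D_u (a ^~ v) y = 'D_v (a ^~ u) y) ->
  exists L : E -> R^o, forall y, ball x0 r y ->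
    smooth_near y L /\ forall v, 'D_v L y = a y v.
Proof.
move=> la sa ca.
(* By closedness, the derivative along [v] of the integrand is the derivative
   of [t * a (x0 + t *: (y - x0)) v] with respect to [t]. *)
pose L (y : E) := (\int[mu]_(t in `[0%R, 1%R]) a (x0 + t *: (y - x0)) (y - x0))%R : R^o.
have aE y w : a y w = \sum_j ccoord C j w *: a y (cbase C j) by exact: linear_funE.
have DaE y u w : ball x0 r y ->
    'D_u (a ^~ w) y = \sum_j ccoord C j w * 'D_u (a ^~ (cbase C j)) y.
  move=> hy.
  have -> : a ^~ w = \sum_j (fun y => ccoord C j w *: a y (cbase C j)).
    by apply/funext => z; rewrite aE fct_sumE.
  have da j : derivable (a ^~ (cbase C j)) y u.
    by apply/diff_derivable/smooth_near_differentiable; exact: sa.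
  rewrite derive_sum => [|j]; last exact: derivableZ.
  by apply: eq_bigr => j _; rewrite deriveZ.
have DL y v : ball x0 r y -> derivable L y v /\ 'D_v L y = a y v.
  move=> hy; pose w := y - x0.
  have hw : `|w| < r by rewrite distrC; move: hy; rewrite -ball_normE.
  (* Chosen so that [w + s *: v] keeps norm below [r] when the absolute value of [s] is at most [d];
     the factor [2] makes the inequality strict, the [+ 1] allows [v = 0]. *)
  pose d := (r - `|w|) / (2 * (`|v| + 1)).
  have v0 : 0 < `|v| + 1 by rewrite ltr_pwDr.
  have d0 : 0 < d by rewrite divr_gt0 ?subr_gt0// mulr_gt0.
  pose p (s t : R) := x0 + t *: (w + s *: v).
  have hp (s t : R) : `|s| <= d -> 0 <= t <= 1 -> ball x0 r (p s t).
    move=> hs /andP[t0 t1]; rewrite -ball_normE/= /p opprD addrA subrr sub0r normrN.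
    rewrite normrZ ger0_norm//; apply: (@le_lt_trans _ _ `|w + s *: v|).
      by rewrite ler_piMl.
    apply: le_lt_trans (ler_normD _ _) _; rewrite -ltrBrDl normrZ.
    apply: (@le_lt_trans _ _ (d * (`|v| + 1))).
      by apply: ler_pM => //; rewrite lerDl.
    by rewrite /d invfM mulrA mulfVK ?gt_eqF// ltr_pdivrMr// ltr_pMr ?subr_gt0// ltr1n.
  pose f (z : R^o * R^o) : R^o := a (p z.1 z.2) (w + z.1 *: v).
  have sf (s t : R) : `|s| <= d -> 0 <= t <= 1 -> smooth_near (s, t) f.
    move=> hs ht.
    have s1 : smooth_near ((s : R^o), (t : R^o)) (fun z : R^o * R^o => w + z.1 *: v).
      apply: smooth_nearD; first exact: smooth_near_cst.
      by apply: smooth_near_scale; [exact: smooth_near_fst|exact: smooth_near_cst].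
    have s2 : smooth_near ((s : R^o), (t : R^o)) (fun z : R^o * R^o => p z.1 z.2).
      apply: smooth_nearD; first exact: smooth_near_cst.
      by apply: smooth_near_scale => //; exact: smooth_near_snd.
    have -> : f = fun z : R^o * R^o => \sum_j ccoord C j (w + z.1 *: v)
      *: a (p z.1 z.2) (cbase C j).
      by apply/funext => z; rewrite /f aE.
    apply: smooth_near_sum => j; apply: smooth_near_scale.
      exact: (smooth_near_linear_comp (@ccoord_continuous _ _ _ C j) s1).
    have := smooth_near_comp C (g := a ^~ (cbase C j)) s2; apply.
    by apply: sa; exact: hp.
  have [dF DF] := derivable_integral01 d0 sf.
  have FE : (fun s : R => (\int[mu]_(t in `[0%R, 1%R]) f (s, t))%R) = (fun s =>
    L (s *: v + y)).
    apply/funext => s; apply: eq_Rintegral => t _; rewrite /f /p /w/=.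
    by rewrite -[s *: v + y - x0]addrA [s *: v + _]addrC.
  rewrite FE in dF DF.
  split; first exact/derivable1P.
  have -> : 'D_v L y = 'D_1 (fun s : R^o => L (s *: v + y) : R^o) 0.
    rewrite /derive; set g := fun h => _; set k := fun h => _.
    have -> : g = k; last by [].
    by apply/funext => h; rewrite /g /k/= scale0r add0r addr0 [h *: (1 : R^o)]mulr1.
  rewrite DF.
  have -> : a y v = (fun t : R^o => t * a (x0 + t *: w) v : R^o) 1 - (fun t : R^o =>
    t * a (x0 + t *: w) v : R^o) 0.
    by rewrite mul0r subr0 mul1r scale1r /w addrC subrK.
  have d00 : `|(0 : R)| <= d by rewrite normr0 ltW.
  have p0 t : p 0 t = x0 + t *: w by rewrite /p scale0r addr0.
  apply: (@FTC01 (fun t : R => 'D_(1, 0) f (0, t)) (fun t : R^o => t * a (x0 + t *: w)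
    v : R^o)) => t ht; split.
    apply: (@continuous_comp _ _ _ (fun t : R => (0, t)) ('D_(1, 0) f)).
      exact: pair_continuous.
    by apply: smooth_near_continuous; apply: smooth_near_derive; exact: sf.
  have hx := hp 0 t d00 ht; rewrite p0 in hx.
  have da u : differentiable (a ^~ u) (x0 + t *: w)
    by apply: smooth_near_differentiable; exact: sa.
  (* Both the base point and the vector depend on [s]. The product rule gives the value on [v] plus
     [t] times the derivative of [a ^~ w] along [v], and [ca] exchanges [v] and [w] in the
     latter. *)
  have -> : 'D_(1, 0) f (0, t) = t * 'D_w (a ^~ v) (x0 + t *: w) + a (x0 + t *: w)
    v * 1.
    have [_ <-] := derive_fst_line (smooth_near_differentiable (sf 0 t d00 ht)).
    pose c j (s : R^o) : R^o := ccoord C j (w + s *: v).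
    pose A j (s : R^o) : R^o := a ((x0 + t *: w) + s *: (t *: v)) (cbase C j).
    have -> : (fun s : R^o => f (s, t) : R^o) = \sum_j (c j * A j).
      apply/funext => s; rewrite fct_sumE /f /p /= aE; apply: eq_bigr => j _.
      have -> : x0 + t *: (w + s *: v) = x0 + t *: w + s *: (t *: v).
        by rewrite scalerDr addrA !scalerA [t * s]mulrC.
      by [].
    have dc j : is_derive (0 : R^o) 1 (c j) (ccoord C j v).
      have dl x : differentiable (ccoord C j) x by apply: linear_differentiable;
        exact: ccoord_continuous.
      have := @is_derive_line _ _ (ccoord C j)
        w v 0 (@diff_derivable _ _ _ _ _ v (dl _)).
      by rewrite (deriveE _ (dl _)) diff_lin//; exact: ccoord_continuous.
    have dA j : is_derive (0 : R^o) 1 (A j) (t * 'D_v (a ^~ (cbase C j)) (x0 + t *: w)).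
      have daj : differentiable (a ^~ (cbase C j)) (x0 + t *: w + 0 *: (t *: v)).
        by rewrite scale0r addr0.
      have := @is_derive_line _ _ (a ^~ (cbase C j)) (x0 + t *: w) (t *: v)
        0 (@diff_derivable _ _ _ _ _ (t *: v) daj).
      by rewrite (derive_dirZ v t daj) scale0r addr0.
    have dcA j : derivable (c j * A j) 0 1.
      by apply: derivableM; [have [] := dc j|have [] := dA j].
    rewrite derive_sum// (ca _ _ _ hx) (DaE _ _ _ hx) (aE _ v)
      mulr1 mulr_sumr -big_split/=.
    apply: eq_bigr => j _.
    have [d1 e1] := dc j; have [d2 e2] := dA j.
    rewrite (deriveM d1 d2) e1 e2 /c /A !scale0r !addr0 /GRing.scale/=.
    by congr (_ + _); [rewrite mulrCA|rewrite mulrC].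
  have D1 := @is_derive_line _ _ (a ^~ v) x0 w t (@diff_derivable _ _ _ _ _ w (da v)).
  exact: (@is_deriveM _ _ (fun t : R^o => t) _ _ _ _ _ (is_derive_id _ _) D1).
have dL y : ball x0 r y -> differentiable L y.
  move=> hy; apply: (differentiable_partials C la) => [|v].
    by apply: filterS (open_nbhs_nbhs (conj (ball_open x0 r) hy)) => z hz v; exact: DL.
  by apply: smooth_near_continuous; exact: sa.
exists L => y hy; split=> [|v]; last exact: (DL y v hy).2.
(* Continuity and differentiability come from [dL]. Every higher order is inherited from [a ^~ v],
   which equals ['D_v L] throughout the ball. *)
move: y hy; apply/smooth_onP; first exact: ball_open.
case=> [|k]; first by move=> y hy; exact/differentiable_continuous/dL.
split=> // v; apply: (@Ck_on_eq _ _ _ _ _ (a ^~ v)); first exact: ball_open.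
  by move=> y hy; rewrite (DL y v hy).2.
by apply: (smooth_onP _ (ball_open x0 r)).2 => y hy; exact: sa.
Qed.

End Poincare.

(** * Smooth maps between manifolds *)

Section Charts.
Context {R : realType} {E : normedModType R} {M : topologicalType}.
Implicit Types (c : chart E M) (x : M).

Lemma near_cdom c x : is_chart c -> cdom c x -> \forall z \near x, cdom c z.
Proof. by move=> [[oc _] _ _ _ _] cx; apply: open_nbhs_nbhs; split. Qed.

Lemma near_ccod c x : is_chart c -> cdom c x -> \forall y \near cto c x, ccod c y.
Proof. by move=> [[_ oc] H _ _ _] cx; apply: open_nbhs_nbhs; split=> //;
  exact: (H x cx).1. Qed.

Lemma cfromK c x : is_chart c -> cdom c x -> cfrom c (cto c x) = x.
Proof. by move=> [_ H _ _ _] /H[]. Qed.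

Lemma ccod_cto c x : is_chart c -> cdom c x -> ccod c (cto c x).
Proof. by move=> [_ H _ _ _] /H[]. Qed.

Lemma ctoK c y : is_chart c -> ccod c y -> cto c (cfrom c y) = y.
Proof. by move=> [_ _ H _ _] /H[]. Qed.

Lemma cdom_cfrom c y : is_chart c -> ccod c y -> cdom c (cfrom c y).
Proof. by move=> [_ _ H _ _] /H[]. Qed.

Lemma cfrom_cvg c x : is_chart c -> cdom c x -> cfrom c y @[y --> cto c x] --> x.
Proof.
move=> hc cx; have [_ _ _ _ H] := hc.
by have := H _ (ccod_cto hc cx); rewrite /prop_for /continuous_at cfromK.
Qed.

Lemma cto_cvg c x : is_chart c -> cdom c x -> cto c z @[z --> x] --> cto c x.
Proof. by move=> [_ _ _ H _] cx; exact: H. Qed.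

Lemma near_cfrom c x (P : M -> Prop) : is_chart c -> cdom c x ->
  (\forall z \near x, P z) -> \forall y \near cto c x, P (cfrom c y).
Proof. by move=> hc cx; exact: (cfrom_cvg hc cx). Qed.

Lemma near_cto c x (P : E -> Prop) : is_chart c -> cdom c x ->
  (\forall y \near cto c x, P y) -> \forall z \near x, P (cto c z).
Proof. by move=> hc cx; exact: (cto_cvg hc cx). Qed.

Lemma open_cto c (O : set E) : is_chart c -> open O -> open (cdom c `&` cto c @^-1` O).
Proof.
move=> hc oO; rewrite openE => z [cz Oz]; apply: filterI; first exact: near_cdom.
by apply: near_cto => //; exact: open_nbhs_nbhs.
Qed.

Lemma open_cfrom c (O : set M) : is_chart c -> open O ->
  open (ccod c `&` cfrom c @^-1` O).
Proof.
move=> hc oO; rewrite openE => y [cy Oy].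
have cz := cdom_cfrom hc cy; rewrite -(ctoK hc cy).
apply: filterI; first exact: near_ccod.
by apply: near_cfrom => //; exact: open_nbhs_nbhs.
Qed.

End Charts.

(** * Atlases, smoothness at a point and the chain rule in charts *)

Section SmoothAtlas.
Context {R : realType}.

(** Stated over an arbitrary model space, so that the manifold, its square, the cotangent bundle and
    the real line are handled uniformly; transition maps are required to be smooth at points of the
    manifold rather than on overlaps. *)
Definition smooth_atlas (E : normedModType R) (M : topologicalType)
  (A : charted_space E M) :=
  [/\ forall c, atlas A c -> is_chart c,
      forall x, atlas A (chart_at A x) /\ cdom (chart_at A x) x &
      forall c d x, atlas A c -> atlas A d -> cdom c x -> cdom d x ->
        smooth_near (cto c x) (cto d \o cfrom c)].

(** The pointwise counterpart of [smooth_map] (see [smooth_mapP]). It speaks of all charts, which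
    makes it convenient to use; [smooth_pt_chart] shows that one pair of charts is enough to
    establish it. *)
Definition smooth_pt (E F : normedModType R) (M N : topologicalType)
    (A : charted_space E M) (B : charted_space F N) (f : M -> N) (x : M) :=
  {for x, continuous f} /\
  forall c d, atlas A c -> atlas B d -> cdom c x -> cdom d (f x) ->
    smooth_near (cto c x) (cto d \o f \o cfrom c).

Lemma atlas_chart (E : normedModType R) (M : topologicalType) (A : charted_space E M)
  c :
  smooth_atlas A -> atlas A c -> is_chart c.
Proof. by move=> [H _ _]; exact: H. Qed.

Lemma atlas_chart_at (E : normedModType R) (M : topologicalType)
  (A : charted_space E M) x :
  smooth_atlas A -> atlas A (chart_at A x).
Proof. by move=> [_ H _]; have [] := H x. Qed.

Lemma cdom_chart_at (E : normedModType R) (M : topologicalType) (A : charted_space E M)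
  x :
  smooth_atlas A -> cdom (chart_at A x) x.
Proof. by move=> [_ H _]; have [] := H x. Qed.

Lemma is_chart_at (E : normedModType R) (M : topologicalType) (A : charted_space E M)
  x :
  smooth_atlas A -> is_chart (chart_at A x).
Proof. by move=> hA; exact/(atlas_chart hA)/atlas_chart_at. Qed.

Section TwoManifolds.
Context {E F : normedModType R} {M N : topologicalType}.
Context {A : charted_space E M} {B : charted_space F N}.
Implicit Types (f g : M -> N) (x : M).

Lemma smooth_pt_near f x c d : smooth_atlas A -> smooth_atlas B ->
  {for x, continuous f} -> atlas A c -> atlas B d -> cdom c x -> cdom d (f x) ->
  \forall y \near cto c x, [/\ ccod c y, cdom c (cfrom c y) & cdom d (f (cfrom c y))].
Proof.
move=> hA hB cf Ac Bd cx dfx; have hc := atlas_chart hA Ac; have hd :=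
  atlas_chart hB Bd.
have n1 := near_ccod hc cx.
have n2 := near_cfrom hc cx (near_cdom hc cx).
have n3 := near_cfrom hc cx (cf _ (near_cdom hd dfx)).
by near=> y; split; near: y.
Unshelve. all: end_near. Qed.

Lemma smooth_mapP (U : set M) f : smooth_atlas A -> smooth_atlas B -> open U ->
  smooth_map A B U f <-> forall x, U x -> smooth_pt A B f x.
Proof.
move=> hA hB oU.
have op c d : (forall x, U x -> {for x, continuous f}) -> atlas A c -> atlas B d ->
    open (ccod c `&` cfrom c @^-1` (U `&` f @^-1` cdom d)).
  move=> cf Ac Bd; apply: open_cfrom; first exact: atlas_chart hA Ac.
  rewrite openE => x [Ux dfx]; apply: filterI; first exact: open_nbhs_nbhs.
  by apply: cf => //; apply: near_cdom => //; exact: atlas_chart hB Bd.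
split=> [[cf sf] x Ux|H].
  split; first exact: cf.
  move=> c d Ac Bd cx dfx; apply: ((smooth_onP _ (op c d cf Ac Bd)).1 (sf c d Ac Bd)).
  have hc := atlas_chart hA Ac.
  by split; [exact: ccod_cto|rewrite /= cfromK].
have cf x : U x -> {for x, continuous f} by move=> /H[].
split=> // c d Ac Bd; apply/(smooth_onP _ (op c d cf Ac Bd)) => y [cy [Uy dy]].
have hc := atlas_chart hA Ac.
rewrite -(ctoK hc cy); apply: (H _ Uy).2 => //; exact: cdom_cfrom.
Qed.

Lemma tangent_map_eq f g x : smooth_atlas A -> smooth_atlas B -> {near x, f =1 g} ->
  smooth_pt A B f x -> tangent_map A B g x = tangent_map A B f x.
Proof.
move=> hA hB fg [cf sf]; have fgx := nbhs_singleton fg.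
rewrite /tangent_map -fgx; apply: near_eq_diff.
  have := near_cfrom (is_chart_at x hA) (cdom_chart_at x hA) fg.
  by apply: filterS => y /= ->.
apply: smooth_near_differentiable; apply: sf;
  do ?[exact: atlas_chart_at|exact: cdom_chart_at].
Qed.

(** A coordinate expression cannot tell whether [f] leaves the domain of [d], hence the separate
    assumption that it stays there near [x]. This is how continuity is obtained for maps into or out
    of the cotangent bundle, whose topology is only known through charts. *)
Lemma chart_continuous f x c d : smooth_atlas A -> smooth_atlas B ->
  atlas A c -> atlas B d -> cdom c x -> (\forall z \near x, cdom d (f z)) ->
  {for cto c x, continuous (cto d \o f \o cfrom c)} -> {for x, continuous f}.
Proof.
move=> hA hB Ac Bd cx dfx cg; have hc := atlas_chart hA Ac; have hd :=
  atlas_chart hB Bd.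
have fE : {near x, cfrom d \o (cto d \o f \o cfrom c) \o cto c =1 f}.
  have n1 := near_cdom hc cx.
  near=> z; have cz : cdom c z by near: z.
  have dfz : cdom d (f z) by near: z.
  by rewrite /= (cfromK hc cz) (cfromK hd dfz).
rewrite /prop_for /continuous_at -(nbhs_singleton fE).
apply: cvg_trans; first exact: near_eq_cvg fE.
apply: continuous_comp; first exact: cto_cvg.
apply: continuous_comp; first exact: cg.
rewrite /prop_for /continuous_at /= (cfromK hc cx) (cfromK hd (nbhs_singleton dfx)).
by apply: cfrom_cvg => //; exact: nbhs_singleton dfx.
Unshelve. all: end_near. Qed.

End TwoManifolds.

Lemma smooth_pt_id (E : normedModType R) (M : topologicalType) (A : charted_space E M)
  x :
  smooth_atlas A -> smooth_pt A A id x.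
Proof. by move=> [_ _ H]; split; [exact: cvg_id|move=> c d Ac Ad cx dx; exact: H]. Qed.

Section Composition.
Context {E F G : normedModType R} {M N P : topologicalType} {m n : nat}.
Context {A : charted_space E M} {B : charted_space F N} {B' : charted_space G P}.
Implicit Types (f : M -> N) (g : N -> P) (x : M).

Lemma comp_chart_eq f g x c d (e : chart G P) : smooth_atlas A -> smooth_atlas B ->
  {for x, continuous f} -> atlas A c -> atlas B d -> cdom c x -> cdom d (f x) ->
  {near cto c x, (cto e \o g \o cfrom d) \o (cto d \o f \o cfrom c) =1
    cto e \o (g \o f) \o cfrom c}.
Proof.
move=> hA hB cf Ac Bd cx dfx.
have := smooth_pt_near hA hB cf Ac Bd cx dfx.
by apply: filterS => y [_ _ dy] /=; rewrite (cfromK (atlas_chart hB Bd)).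
Qed.

Lemma smooth_near_chart_comp (D : coords n F) f g x c d (e : chart G P)
  : smooth_atlas A -> smooth_atlas B ->
  {for x, continuous f} -> atlas A c -> atlas B d -> cdom c x -> cdom d (f x) ->
  smooth_near (cto c x) (cto d \o f \o cfrom c) ->
  smooth_near (cto d (f x)) (cto e \o g \o cfrom d) ->
  smooth_near (cto c x) (cto e \o (g \o f) \o cfrom c).
Proof.
move=> hA hB cf Ac Bd cx dfx sf sg.
apply: smooth_near_eq (comp_chart_eq g e hA hB cf Ac Bd cx dfx) _.
apply: (smooth_near_comp D) => //.
by rewrite /= cfromK//; exact: atlas_chart hA Ac.
Qed.

Lemma smooth_pt_comp (D : coords n F) f g x : smooth_atlas A -> smooth_atlas B ->
  smooth_pt A B f x -> smooth_pt B B' g (f x) -> smooth_pt A B' (g \o f) x.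
Proof.
move=> hA hB [cf sf] [cg sg]; split; first exact: continuous_comp.
move=> c e Ac B'e cx efx.
have Bd := atlas_chart_at (f x) hB; have dfx := cdom_chart_at (f x) hB.
by apply: (smooth_near_chart_comp D hA hB cf Ac Bd cx dfx); [exact: sf|exact: sg].
Qed.

(** The chain rule in arbitrary charts. With [id] for one or both of the maps it also yields the
    rules for changing charts. *)
Lemma diff_chart_comp f g x c d e u : smooth_atlas A -> smooth_atlas B ->
  smooth_pt A B f x -> smooth_pt B B' g (f x) ->
  atlas A c -> atlas B d -> atlas B' e -> cdom c x -> cdom d (f x) -> cdom e (g (f x))
    ->
  'd (cto e \o g \o cfrom d) (cto d (f x)) ('d (cto d \o f \o cfrom c) (cto c x) u)
  = 'd (cto e \o (g \o f) \o cfrom c) (cto c x) u.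
Proof.
move=> hA hB [cf sf] [cg sg] Ac Bd B'e cx dfx egx.
have d1 := smooth_near_differentiable (sf c d Ac Bd cx dfx).
have d2 := smooth_near_differentiable (sg d e Bd B'e dfx egx).
have E1 : (cto d \o f \o cfrom c) (cto c x) = cto d (f x).
  by rewrite /= cfromK//; exact: atlas_chart hA Ac.
rewrite -E1 in d2 *.
rewrite (near_eq_diff (comp_chart_eq g e hA hB cf Ac Bd cx dfx)).
  by rewrite (diff_comp d1 d2).
exact: differentiable_comp.
Qed.

Lemma tangent_map_comp f g x u : smooth_atlas A -> smooth_atlas B -> smooth_atlas B' ->
  smooth_pt A B f x -> smooth_pt B B' g (f x) ->
  tangent_map A B' (g \o f) x u = tangent_map B B' g (f x) (tangent_map A B f x u).
Proof.
move=> hA hB hB' sf sg.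
by rewrite /tangent_map diff_chart_comp//;
  do ?[exact: atlas_chart_at|exact: cdom_chart_at].
Qed.

End Composition.

Section Transitions.
Context {E : normedModType R} {M : topologicalType} {A : charted_space E M}.

Lemma diff_chart_id x c u : smooth_atlas A -> atlas A c -> cdom c x ->
  'd (cto c \o cfrom c) (cto c x) u = u.
Proof.
move=> hA Ac cx; have hc := atlas_chart hA Ac.
have n1 : {near cto c x, idfun =1 cto c \o cfrom c}.
  by apply: filterS (near_ccod hc cx) => y cy /=; rewrite ctoK.
have di : differentiable (idfun : E -> E) (cto c x) by exact: ex_diff.
rewrite (near_eq_diff n1 di); have -> // : 'd idfun (cto c x) = idfun :> (E -> E).
exact: diff_val.
Qed.

Lemma diff_transitionK x c d u : smooth_atlas A -> atlas A c -> atlas A d ->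
  cdom c x -> cdom d x ->
  'd (cto c \o cfrom d) (cto d x) ('d (cto d \o cfrom c) (cto c x) u) = u.
Proof.
move=> hA Ac Ad cx dx; rewrite -[RHS](diff_chart_id u hA Ac cx).
have H := @diff_chart_comp E E E M M M A A A id id x c d c u hA hA
  (smooth_pt_id x hA) (smooth_pt_id x hA) Ac Ad Ac cx dx cx.
exact: H.
Qed.

Lemma tangent_map_id x u : smooth_atlas A -> tangent_map A A id x u = u.
Proof.
by move=> hA; apply: diff_chart_id; [|exact: atlas_chart_at|exact: cdom_chart_at].
Qed.

End Transitions.

Section ChartCriterion.
Context {E F : normedModType R} {M N : topologicalType} {m n : nat}.
Context (C : coords m E) (D : coords n F).
Context {A : charted_space E M} {B : charted_space F N}.

Lemma smooth_pt_chart (f : M -> N) x c d : smooth_atlas A -> smooth_atlas B ->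
  {for x, continuous f} -> atlas A c -> atlas B d -> cdom c x -> cdom d (f x) ->
  smooth_near (cto c x) (cto d \o f \o cfrom c) -> smooth_pt A B f x.
Proof.
move=> hA hB cf Ac Bd cx dfx sf; split=> // c' d' Ac' Bd' cx' dfx'.
have [_ _ tA] := hA; have [_ _ tB] := hB.
have s1 : smooth_near (cto c' x) (cto d \o f \o cfrom c').
  have cid : {for x, continuous (id : M -> M)} by exact: cvg_id.
  have H := smooth_near_chart_comp C hA hA cid Ac' Ac cx' cx (tA c' c x Ac' Ac cx' cx)
    sf.
  exact: H.
exact: (@smooth_near_chart_comp _ _ _ _ _ _ _ _ _ D f id x c' d d' hA hB cf Ac' Bd cx'
  dfx s1 (tB d d' _ Bd Bd' dfx dfx')).
Qed.

End ChartCriterion.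

End SmoothAtlas.

Section Model.
Context {R : realType}.

Lemma smooth_near_id (E : normedModType R) (x : E) : smooth_near x (idfun : E -> E).
Proof. by have := @smooth_near_linear R E E x idfun; apply => y; exact: cvg_id. Qed.

Lemma smooth_atlas_model (E : normedModType R) : smooth_atlas (model_charted E).
Proof.
split=> [c ->|x|c d x -> -> _ _] /=; last exact: smooth_near_id.
- split=> //=; first by split; exact: openT.
  + by move=> x _; exact: cvg_id.
  + by move=> x _; exact: cvg_id.
- by [].
Qed.

Lemma diff_fstE (E F : normedModType R) (z u : E * F) :
  'd (@fst E F) z u = u.1.
Proof.
have c1 : continuous (fst : {linear (E * F)%type -> E}) by move=> x; exact: cvg_fst.
by rewrite (@diff_lin _ _ _ (fst : {linear (E * F)%type -> E}) z c1).
Qed.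

Lemma diff_sndE (E F : normedModType R) (z u : E * F) :
  'd (@snd E F) z u = u.2.
Proof.
have c1 : continuous (snd : {linear (E * F)%type -> F}) by move=> x; exact: cvg_snd.
by rewrite (@diff_lin _ _ _ (snd : {linear (E * F)%type -> F}) z c1).
Qed.

End Model.

(** * Product manifolds *)

Section Products.
Context {R : realType} {E F G : normedModType R} {M N P : topologicalType} {m n : nat}.
Context (C : coords m E) (D : coords n F).
Context {A : charted_space E M} {B : charted_space F N} {A' : charted_space G P}.
Hypothesis (hA : smooth_atlas A) (hB : smooth_atlas B) (hA' : smooth_atlas A').

Lemma openX (S T : topologicalType) (O : set S) (O' : set T) : open O -> open O' ->
  open (O `*` O').
Proof.
move=> oO oO'; rewrite openE => -[x y] [/= Ox Oy].
by exists (O, O') => //; split; exact: open_nbhs_nbhs.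
Qed.

Lemma is_chart_prod (c : chart E M) (d : chart F N) : is_chart c -> is_chart d ->
  is_chart (prod_chart c d).
Proof.
move=> hc hd; have [[oc oc'] c1 c2 c3 c4] := hc; have [[od od'] d1 d2 d3 d4] := hd.
split=> /=.
- by split; exact: openX.
- by move=> [x y] [/= cx dy]; have [? ->] := c1 x cx; have [? ->] := d1 y dy.
- by move=> [x y] [/= cx dy]; have [? ->] := c2 x cx; have [? ->] := d2 y dy.
- move=> [x y] [/= cx dy]; apply: cvg_pair.
    by apply: (@cvg_comp _ _ _ fst (cto c)); [exact: cvg_fst|exact: c3].
  by apply: (@cvg_comp _ _ _ snd (cto d)); [exact: cvg_snd|exact: d3].
- move=> [x y] [/= cx dy]; apply: cvg_pair.
    by apply: (@cvg_comp _ _ _ fst (cfrom c)); [exact: cvg_fst|exact: c4].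
  by apply: (@cvg_comp _ _ _ snd (cfrom d)); [exact: cvg_snd|exact: d4].
Qed.

Lemma smooth_atlas_prod : smooth_atlas (prod_charted A B).
Proof.
have [a1 a2 a3] := hA; have [b1 b2 b3] := hB; split=> /=.
- by move=> k [c [d [Ac Bd ->]]]; apply: is_chart_prod; [exact: a1|exact: b1].
- move=> [x y] /=; have [Ac cx] := a2 x; have [Bd dy] := b2 y; split=> //.
  by exists (chart_at A x), (chart_at B y).
- move=> _ _ [x y] [c1 [d1 [Ac1 Bd1 ->]]] [c2 [d2 [Ac2 Bd2 ->]]] /= [/= h1 h2]
  [/= h3 h4].
  apply: smooth_near_pair.
    have := @smooth_near_comp _ _ _ _ _ C (cto c1 x, cto d1 y) fst (cto c2 \o cfrom c1).
    by apply; [exact: smooth_near_fst|exact: a3].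
  have := @smooth_near_comp _ _ _ _ _ D (cto c1 x, cto d1 y) snd (cto d2 \o cfrom d1).
  by apply; [exact: smooth_near_snd|exact: b3].
Qed.

Lemma smooth_pt_fst z : smooth_pt (prod_charted A B) A fst z.
Proof.
split; first exact: cvg_fst.
move=> _ c2 [c1 [d1 [Ac1 Bd1 ->]]] Ac2 [/= h1 h2] h3; have [_ _ a3] := hA.
have := @smooth_near_comp _ _ _ _ _ C (cto c1 z.1, cto d1 z.2) fst (cto c2 \o cfrom c1).
by apply; [exact: smooth_near_fst|exact: a3].
Qed.

Lemma smooth_pt_snd z : smooth_pt (prod_charted A B) B snd z.
Proof.
split; first exact: cvg_snd.
move=> _ d2 [c1 [d1 [Ac1 Bd1 ->]]] Bd2 [/= h1 h2] h3; have [_ _ b3] := hB.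
have := @smooth_near_comp _ _ _ _ _ D (cto c1 z.1, cto d1 z.2) snd (cto d2 \o cfrom d1).
by apply; [exact: smooth_near_snd|exact: b3].
Qed.

Lemma smooth_pt_pair (f : P -> M) (g : P -> N) x :
  smooth_pt A' A f x -> smooth_pt A' B g x ->
  smooth_pt A' (prod_charted A B) (fun z => (f z, g z)) x.
Proof.
move=> [cf sf] [cg sg]; split; first exact: cvg_pair.
move=> c _ A'c [c1 [d1 [Ac1 Bd1 ->]]] h1 [/= h2 h3].
have := @smooth_near_pair _ _ _ _ (cto c x) (cto c1 \o f \o cfrom c)
  (cto d1 \o g \o cfrom c).
by apply; [exact: sf|exact: sg].
Qed.

(** The preferred chart of a product is the product of the preferred charts, so tangent vectors to
    the product are literally pairs. *)
Lemma tangent_map_pair (f : P -> M) (g : P -> N) x u :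
  smooth_pt A' A f x -> smooth_pt A' B g x ->
  tangent_map A' (prod_charted A B) (fun z => (f z, g z)) x u =
  (tangent_map A' A f x u, tangent_map A' B g x u).
Proof.
move=> [cf sf] [cg sg]; rewrite /tangent_map.
have df := smooth_near_differentiable (sf _ _ (atlas_chart_at x hA')
  (atlas_chart_at (f x) hA)
  (cdom_chart_at x hA') (cdom_chart_at (f x) hA)).
have dg := smooth_near_differentiable (sg _ _ (atlas_chart_at x hA')
  (atlas_chart_at (g x) hB)
  (cdom_chart_at x hA') (cdom_chart_at (g x) hB)).
exact: (congr1 (fun h => h u) (diff_pair df dg)).
Qed.

Lemma tangent_map_fst z u : tangent_map (prod_charted A B) A fst z u = u.1.
Proof.
rewrite /tangent_map /= -(diff_fstE (cto (chart_at A z.1) z.1, cto (chart_at B z.2)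
  z.2) u).
have n0 := near_ccod (is_chart_at z.1 hA) (cdom_chart_at z.1 hA).
have n1 : \forall y \near (cto (chart_at A z.1) z.1, cto (chart_at B z.2) z.2),
    ccod (chart_at A z.1) y.1.
  by apply: (@cvg_fst _ _ (nbhs (cto (chart_at A z.1) z.1)) (nbhs (cto (chart_at B z.2)
    z.2))).
rewrite (near_eq_diff (f := fst)) => [//||]; last first.
  by apply: smooth_near_differentiable; exact: smooth_near_fst.
by apply: filterS n1 => y cy /=; rewrite ctoK//; exact: is_chart_at.
Qed.

Lemma tangent_map_snd z u : tangent_map (prod_charted A B) B snd z u = u.2.
Proof.
rewrite /tangent_map /= -(diff_sndE (cto (chart_at A z.1) z.1, cto (chart_at B z.2)
  z.2) u).
have n0 := near_ccod (is_chart_at z.2 hB) (cdom_chart_at z.2 hB).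
have n1 : \forall y \near (cto (chart_at A z.1) z.1, cto (chart_at B z.2) z.2),
    ccod (chart_at B z.2) y.2.
  by apply: (@cvg_snd _ _ (nbhs (cto (chart_at A z.1) z.1)) (nbhs (cto (chart_at B z.2)
    z.2))).
rewrite (near_eq_diff (f := snd)) => [//||]; last first.
  by apply: smooth_near_differentiable; exact: smooth_near_snd.
by apply: filterS n1 => y cy /=; rewrite ctoK//; exact: is_chart_at.
Qed.

End Products.

(** * Local diffeomorphisms from injective tangent maps *)

Section InverseFunctionManifold.
Context {R : realType} {E F : normedModType R} {M N : topologicalType} {m : nat}.
Context (C : coords m E) (D : coords m F).
Context {A : charted_space E M} {B : charted_space F N}.

Lemma tangent_map_injective (f : M -> N) (g : N -> M) x u : smooth_atlas A ->
  smooth_atlas B ->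
  smooth_pt A B f x -> smooth_pt B A g (f x) -> {near x, g \o f =1 id} ->
  tangent_map B A g (f x) (tangent_map A B f x u) = u.
Proof.
move=> hA hB sf sg gf.
rewrite -tangent_map_comp// -[RHS](tangent_map_id x u hA).
have s1 := smooth_pt_comp D hA hB sf sg.
by rewrite -(tangent_map_eq hA hA gf s1).
Qed.

Lemma local_diffeomorphism_tangent (U : set M) (f : M -> N) x :
  smooth_atlas A -> smooth_atlas B -> local_diffeomorphism A B U f -> U x ->
  smooth_pt A B f x /\ forall u, tangent_map A B f x u = 0 -> u = 0.
Proof.
move=> hA hB H Ux; have [V [oV Vx VU ofV [g [gf sf sg]]]] := H x Ux.
have sfx := (smooth_mapP _ hA hB oV).1 sf x Vx.
have sgx := (smooth_mapP _ hB hA ofV).1 sg (f x) (ex_intro2 _ _ x Vx erefl).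
split=> // u fu0; rewrite -(tangent_map_injective (g := g) u hA hB sfx sgx); last first.
  by apply: filterS (open_nbhs_nbhs (conj oV Vx)) => y; exact: gf.
by rewrite fu0 /tangent_map linear0.
Qed.

(** The two model spaces may differ (pairs of rows for the square of the manifold, a row and a
    column for the cotangent bundle). The coordinate expression is conjugated by [cphi] and [cpsi]
    into a map from row vectors to row vectors of one length, where injectivity of the differential
    means an invertible Jacobian. *)
Lemma inverse_function_manifold (U : set M) (f : M -> N) :
  smooth_atlas A -> smooth_atlas B -> open U ->
  (forall x, U x -> smooth_pt A B f x) ->
  (forall x u, U x -> tangent_map A B f x u = 0 -> u = 0) ->
  local_diffeomorphism A B U f.
Proof.
move=> hA hB oU sf injf x Ux.
pose c := chart_at A x; pose d := chart_at B (f x).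
have Ac : atlas A c := atlas_chart_at x hA; have cx : cdom c x := cdom_chart_at x hA.
have Bd : atlas B d := atlas_chart_at (f x) hB; have dfx : cdom d (f x) :=
  cdom_chart_at (f x) hB.
have hc : is_chart c := is_chart_at x hA; have hd : is_chart d := is_chart_at (f x) hB.
pose fl := cto d \o f \o cfrom c.
have sfl : smooth_near (cto c x) fl := (sf x Ux).2 c d Ac Bd cx dfx.
pose h := cphi D \o (fl \o cpsi C); pose a := cphi C (cto c x).
have psia : cpsi C a = cto c x by rewrite /a cphiK.
have sh1 : smooth_near a (fl \o cpsi C).
  apply: (smooth_near_comp C); last by rewrite psia.
  by apply: smooth_near_linear; exact: cpsi_continuous.
have sh : smooth_near a h.
  by apply: smooth_near_linear_comp => //; exact: cphi_continuous.
have dpsi : differentiable (cpsi C) a by apply: linear_differentiable;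
  exact: cpsi_continuous.
have dfl := smooth_near_differentiable sfl.
have dfl' : differentiable fl (cpsi C a) by rewrite psia.
have uh : jacobian h a \in unitmx.
  rewrite -row_free_unit; apply/inj_row_free => v vJ.
  have dh := smooth_near_differentiable sh.
  move: vJ; rewrite -deriveEjacobian// derive_linear_comp; [|exact: cphi_continuous|];
    last first.
    exact: smooth_near_differentiable.
  rewrite (deriveE _ (differentiable_comp dpsi dfl')) (diff_comp dpsi dfl')/=.
  rewrite (diff_lin _ (@cpsi_continuous _ _ _ C)) => /(congr1 (cpsi D)).
  rewrite cphiK linear0 psia => /(injf x _ Ux) v0.
  by rewrite -(cpsiK C v) v0 linear0.
(* Keeps the neighbourhood given by the inverse function theorem, and its image, inside the charts
   and [U], so that everything can be carried back to the manifolds. *)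
pose P v := [/\ ccod c (cpsi C v), U (cfrom c (cpsi C v))
  & cdom d (f (cfrom c (cpsi C v)))].
have nP : \forall v \near a, P v.
  have nU : \forall z \near x, U z by exact: open_nbhs_nbhs.
  have n1 := smooth_pt_near hA hB (sf x Ux).1 Ac Bd cx dfx.
  have n2 := near_cfrom hc cx nU.
  have n3 : \forall y \near cto c x, [/\ ccod c y, U (cfrom c y)
    & cdom d (f (cfrom c y))].
    by apply: filterS (filterI n1 n2) => y [[? _ ?] ?].
  have cpa : cpsi C v @[v --> a] --> cto c x by rewrite -psia; exact: cpsi_continuous.
  exact: (cpa _ n3).
have [V [g [[oV Va] VP ohV Vh hVg]]] := inverse_function_rV sh uh nP.
pose W := cdom c `&` cto c @^-1` (cphi C @^-1` V).
have oW : open W.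
  apply: open_cto => //; apply: open_comp => // y _; exact: cphi_continuous.
have hE z : W z -> [/\ U z, cdom d (f z) & h (cphi C (cto c z)) = cphi D (cto d (f z))].
  move=> [cz Vz]; have [] := VP _ Vz; rewrite cphiK (cfromK hc cz) => _ Uz dz.
  by split=> //; rewrite /h /fl /= cphiK (cfromK hc cz).
(* The inclusion from right to left uses [P]: without [f] staying in the domain of [d], equality of
   coordinates would not give equality of points. *)
have fWE : f @` W = cdom d `&` cto d @^-1` (cphi D @^-1` (h @` V)).
  apply/seteqP; split=> [_ [z Wz <-]|w [dw [v Vv vw]]].
    have [_ dz hz] := hE z Wz; split=> //=.
    by exists (cphi C (cto c z)) => //; exact: Wz.2.
  have [cv Uv dv] := VP v Vv.
  exists (cfrom c (cpsi C v)).
    split; first exact: cdom_cfrom.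
    by rewrite /= (ctoK hc cv) cpsiK.
  rewrite -(cfromK hd dv) -(cfromK hd dw); congr (cfrom d _).
  by apply: (can_inj (cphiK D)).
have ofW : open (f @` W).
  rewrite fWE; apply: open_cto => //; apply: open_comp => // y _;
    exact: cphi_continuous.
pose g0 w := cfrom c (cpsi C (g (cphi D (cto d w)))).
have g0f z : W z -> g0 (f z) = z.
  move=> Wz; have [_ dz hz] := hE z Wz.
  by rewrite /g0 -hz (Vh _ Wz.2).2 cphiK (cfromK hc Wz.1).
exists W; split=> //; first by move=> z /hE[].
exists g0; split=> //.
  by apply/(smooth_mapP _ hA hB oW) => z /hE[Uz _ _]; exact: sf.
apply/(smooth_mapP _ hB hA ofW) => w fWw.
have nW : \forall w' \near w, (f @` W) w' by exact: open_nbhs_nbhs.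
have cg0 w' : (f @` W) w' -> [/\ cdom d w', cdom c (g0 w') &
    ccod c (cpsi C (g (cphi D (cto d w'))))].
  move=> fW; have : (f @` W) w' by [].
  rewrite fWE => -[dw' [v Vv vw]]; split=> //.
    by case: fW => z Wz <-; rewrite g0f//; exact: Wz.1.
  by rewrite -vw (Vh v Vv).2; have [] := VP v Vv.
have [dw cw _] := cg0 w fWw.
have sg0 : smooth_near (cto d w) (cto c \o g0 \o cfrom d).
  apply: (@smooth_near_eq _ _ _ _ (cpsi C \o (g \o cphi D))).
    have n1 := near_cfrom hd dw nW.
    have n2 := near_ccod hd dw.
    apply: filterS (filterI n1 n2) => y [/cg0[_ _]].
    move=> + cy; rewrite (ctoK hd cy) => cc.
    by rewrite /= /g0 (ctoK hd cy) (ctoK hc cc).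
  apply: smooth_near_linear_comp; first exact: cpsi_continuous.
  apply: (smooth_near_comp (coords_rV m)).
    by apply: smooth_near_linear; exact: cphi_continuous.
  by apply: hVg; move: fWw; rewrite fWE => -[_].
have cont : {for w, continuous g0}.
  apply: (chart_continuous hB hA Bd Ac dw); last exact: smooth_near_continuous.
  by apply: filterS nW => w' /cg0[].
exact: (smooth_pt_chart D C hB hA cont Bd Ac dw cw sg0).
Qed.

End InverseFunctionManifold.

(** * Closed one-forms on manifolds *)

Section SchwarzVector.
Context {R : realType} {D E : normedModType R} {m : nat} (C : coords m E).

Lemma derive_ccoord (f : D -> E) x v j : differentiable f x ->
  'D_v (ccoord C j \o f) x = ccoord C j ('D_v f x).
Proof. by move=> df; apply: derive_linear_comp => //; exact: ccoord_continuous. Qed.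

Lemma smooth_near_ccoord (f : D -> E) x j : smooth_near x f ->
  smooth_near x (ccoord C j \o f).
Proof. by apply: smooth_near_linear_comp; exact: ccoord_continuous. Qed.

Lemma schwarz_vector (f : D -> E) x u v j : smooth_near x f ->
  ccoord C j ('D_u ('D_v f) x) = ccoord C j ('D_v ('D_u f) x).
Proof.
move=> sf.
have H w w' : ccoord C j ('D_w ('D_w' f) x) = 'D_w ('D_w' (ccoord C j \o f)) x.
  rewrite -derive_ccoord; last exact/smooth_near_differentiable/smooth_near_derive.
  apply: near_eq_derive; apply: filterS (smooth_near_near sf) => y sy.
  by rewrite /= derive_ccoord//; exact: smooth_near_differentiable.
by rewrite H H; apply: smooth_near_schwarz; exact: smooth_near_ccoord.
Qed.

End SchwarzVector.

Section OneForms.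
Context {R : realType} {E : normedModType R} {M : topologicalType} {m : nat}.
Context (C : coords m E) {A : charted_space E M} (hA : smooth_atlas A).
Implicit Types (th : @one_form R E M A) (c d : chart E M) (x : M).

Definition linear_form th := forall x, linear (th x).

Definition smooth_form_pt th x := forall c, atlas A c -> cdom c x ->
  forall v, smooth_near (cto c x) (fun y => local_form th c y v).

(** Vanishing of the exterior derivative, but read in any chart. [ext_deriv] only uses the preferred
    chart of each point, while a primitive on a ball requires closedness at all its points in a
    single chart. *)
Definition closed_in th c (y : E) := forall u v,
  'D_u (fun y => local_form th c y v) y = 'D_v (fun y => local_form th c y u) y.

Lemma local_formE th c y v : local_form th c y v =
  th (cfrom c y) ('d (cto (chart_at A (cfrom c y)) \o cfrom c) y v).
Proof. by []. Qed.

Lemma local_form_linear th c y : linear_form th -> linear (local_form th c y).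
Proof. by move=> lth a u v; rewrite !local_formE linearP lth. Qed.

Lemma local_form_cto th c x v : atlas A c -> cdom c x ->
  local_form th c (cto c x) v = th x ('d (cto (chart_at A x) \o cfrom c) (cto c x) v).
Proof. by move=> Ac cx; rewrite local_formE (cfromK (atlas_chart hA Ac) cx). Qed.

Lemma diff_transition_comp x c d e v : atlas A c -> atlas A d -> atlas A e ->
  cdom c x -> cdom d x -> cdom e x ->
  'd (cto e \o cfrom d) (cto d x) ('d (cto d \o cfrom c) (cto c x) v) =
  'd (cto e \o cfrom c) (cto c x) v.
Proof.
move=> Ac Ad Ae cx dx ex.
have H := @diff_chart_comp _ E E E M M M A A A id id x c d e v hA hA
  (smooth_pt_id x hA) (smooth_pt_id x hA) Ac Ad Ae cx dx ex.
exact: H.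
Qed.

Lemma local_form_transition th c d x v : atlas A c -> atlas A d -> cdom c x ->
  cdom d x ->
  local_form th c (cto c x) v =
  local_form th d (cto d x) ('d (cto d \o cfrom c) (cto c x) v).
Proof.
move=> Ac Ad cx dx; rewrite !local_form_cto// diff_transition_comp//.
  exact: atlas_chart_at.
exact: cdom_chart_at.
Qed.

Lemma near_transition c d x : atlas A c -> atlas A d -> cdom c x -> cdom d x ->
  \forall y \near cto c x, [/\ ccod c y, cdom c (cfrom c y) & cdom d (cfrom c y)].
Proof.
move=> Ac Ad cx dx.
have H := @smooth_pt_near _ E E M M A A id x c d hA hA (@cvg_id _ (nbhs x)) Ac Ad cx dx.
exact: H.
Qed.

(** The second derivatives of the transition map cancel by symmetry. *)
Lemma closed_transition th c d x : linear_form th -> smooth_form_pt th x ->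
  atlas A c -> atlas A d -> cdom c x -> cdom d x ->
  closed_in th d (cto d x) -> closed_in th c (cto c x).
Proof.
move=> lth sth Ac Ad cx dx cl u v.
have [_ _ tA] := hA; pose psi := cto d \o cfrom c.
have spsi : smooth_near (cto c x) psi := tA c d x Ac Ad cx dx.
have psix : psi (cto c x) = cto d x by rewrite /psi/= (cfromK (atlas_chart hA Ac) cx).
pose b j y := local_form th d y (cbase C j).
have sb j : smooth_near (cto d x) (b j) by exact: sth.
have formE w : {near cto c x, (fun y => \sum_j ccoord C j ('D_w psi y) *: b j (psi y))
  =1
    (fun y => local_form th c y w)}.
  have n1 := near_transition Ac Ad cx dx; have n2 := smooth_near_near spsi.
  near=> y; have [cy cfy dfy] : [/\ ccod c y, cdom c (cfrom c y) & cdom d (cfrom c y)]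
    by near: y.
  have sy : smooth_near y psi by near: y.
  have yE : y = cto c (cfrom c y) by rewrite (ctoK (atlas_chart hA Ac) cy).
  rewrite [in RHS]yE (local_form_transition _ _ Ac Ad cfy dfy) -yE.
  rewrite (linear_funE C (local_form_linear _ _ lth)).
  by apply: eq_bigr => j _; rewrite deriveE//; exact: smooth_near_differentiable.
have dpsi := smooth_near_differentiable spsi.
(* A field constant in [c] is not constant in [d]: the first sum comes from differentiating the
   transported field ['D_w' psi], the last term from differentiating the form with that field
   frozen. *)
have formD w w' : 'D_w (fun y => local_form th c y w') (cto c x) =
    \sum_j (ccoord C j ('D_w ('D_w' psi) (cto c x)) * b j (cto d x)) +
    'D_('D_w psi (cto c x)) (fun y => local_form th d y ('D_w' psi (cto c x)))
      (cto d x).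
  rewrite -(near_eq_derive _ (formE w')).
  pose g j : E -> R^o := (fun y => ccoord C j ('D_w' psi y) *: b j (psi y)).
  have dg j : differentiable (fun y => ccoord C j ('D_w' psi y)) (cto c x).
    by apply/smooth_near_differentiable/smooth_near_ccoord/smooth_near_derive.
  have dbpsi j : differentiable (b j \o psi) (cto c x).
    apply: differentiable_comp => //; rewrite psix; exact: smooth_near_differentiable.
  have -> : (fun y => \sum_j ccoord C j ('D_w' psi y) *: b j (psi y)) = \sum_j g j.
    by apply/funext => y; rewrite fct_sumE.
  rewrite derive_sum => [|j]; last first.
    by apply: diff_derivable; apply: differentiable_scale; [exact: dg|exact: dbpsi].
  have -> : (fun y => local_form th d y ('D_w' psi (cto c x))) =
      \sum_j (fun y => ccoord C j ('D_w' psi (cto c x)) *: b j y).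
    apply/funext => y; rewrite fct_sumE.
    exact: (linear_funE C (local_form_linear _ _ lth)).
  have db j v' : derivable (b j) (cto d x)
    v' by apply/diff_derivable/smooth_near_differentiable.
  rewrite derive_sum => [|j]; last exact: derivableZ.
  rewrite -big_split/=; apply: eq_bigr => j _.
  rewrite (derive_scale w (dg j) (dbpsi j)) [LHS]addrC -psix; congr (_ + _).
    rewrite -(derive_ccoord C _ _ (smooth_near_differentiable (smooth_near_derive w'
      spsi))).
    by [].
  have dbx : differentiable (b j) (psi (cto c x)).
    by rewrite psix; exact: smooth_near_differentiable.
  rewrite deriveZ; last exact: diff_derivable.
  rewrite (deriveE _ (dbpsi j)) (diff_comp dpsi dbx) (deriveE w dpsi).
  by rewrite (deriveE _ dbx).
have S : \sum_j (ccoord C j ('D_u ('D_v psi) (cto c x)) * b j (cto d x)) =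
    \sum_j (ccoord C j ('D_v ('D_u psi) (cto c x)) * b j (cto d x)).
  by apply: eq_bigr => j _; rewrite (schwarz_vector C u v j spsi).
apply: etrans (formD u v) _; apply: etrans _ (esym (formD v u)).
exact: (f_equal2 (@GRing.add R^o) S (cl ('D_u psi (cto c x)) ('D_v psi (cto c x)))).
Unshelve. all: end_near. Qed.

Lemma local_form_differential (L : M -> R^o) c x v : smooth_pt A (model_charted R^o)
  L x ->
  atlas A c -> cdom c x ->
  local_form (differential A L) c (cto c x) v = 'D_v (L \o cfrom c) (cto c x).
Proof.
move=> sL Ac cx; rewrite local_form_cto//.
have Lm : atlas (model_charted R^o) (Chart setT setT id id) by [].
have h1 := atlas_chart_at x hA; have h2 := cdom_chart_at x hA.
have H := @diff_chart_comp _ E E R^o M M R^o A A (model_charted R^o)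
  id L x c (chart_at A x) _ v hA hA
  (smooth_pt_id x hA) sL Ac h1 Lm cx h2 I.
rewrite deriveE; first exact: H.
by apply: smooth_near_differentiable; exact: (sL.2 c _ Ac Lm cx I).
Qed.

(** Closedness of [dL] is the symmetry of the second derivatives of [L] in the chart. *)
Lemma closed_differential (V : set M) (L : M -> R^o) c x : open V -> V x ->
  (forall z, V z -> smooth_pt A (model_charted R^o) L z) ->
  atlas A c -> cdom c x -> closed_in (differential A L) c (cto c x).
Proof.
move=> oV Vx sL Ac cx u v; have hc := atlas_chart hA Ac.
have Lm : atlas (model_charted R^o) (Chart setT setT id id) by [].
have E1 w : {near cto c x, 'D_w (L \o cfrom c) =1 (fun y =>
  local_form (differential A L) c y w)}.
  have n1 := near_cfrom hc cx (open_nbhs_nbhs (conj oV Vx)).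
  have n2 := near_ccod hc cx.
  apply: filterS (filterI n1 n2) => y [Vy cy].
  have := local_form_differential w (sL _ Vy) Ac (cdom_cfrom hc cy).
  by rewrite (ctoK hc cy) => ->.
rewrite -(near_eq_derive u (E1 v)) -(near_eq_derive v (E1 u)).
apply: smooth_near_schwarz; exact: ((sL x Vx).2 c _ Ac Lm cx I).
Qed.

Lemma poincare_manifold th (U : set M) : linear_form th -> open U ->
  (forall x, U x -> smooth_form_pt th x) ->
  (forall x, U x -> closed_in th (chart_at A x) (cto (chart_at A x) x)) ->
  forall x, U x -> exists V (L : M -> R^o), [/\ open V, V x, V `<=` U,
    smooth_map A (model_charted R^o) V L &
    forall z, V z -> differential A L z = th z].
Proof.
move=> lth oU sth cth x Ux; pose c := chart_at A x.
have Ac : atlas A c := atlas_chart_at x hA; have cx : cdom c x := cdom_chart_at x hA.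
have hc : is_chart c := is_chart_at x hA.
have : \forall y \near cto c x, ccod c y /\ U (cfrom c y).
  apply: filterI; first exact: near_ccod.
  by apply: (near_cfrom hc cx); exact: open_nbhs_nbhs.
move=> /nbhs_ballP[r /= r0 Hr].
have [|||L0 HL0] := @poincare_ball _ _ _ C (cto c x) r (local_form th c).
- by move=> y; exact: local_form_linear.
- move=> y v /Hr[cy Uy]; rewrite -(ctoK hc cy).
  by apply: sth => //; exact: cdom_cfrom.
(* Closedness is given at each point in the preferred chart there and is moved to the one chart [c]
   in which the ball lives. *)
- move=> y u v /Hr[cy Uy]; have cz := cdom_cfrom hc cy; rewrite -(ctoK hc cy).
  apply: (@closed_transition th c (chart_at A (cfrom c y)) (cfrom c y)) => //.
  + exact: sth.
  + exact: atlas_chart_at.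
  + exact: cdom_chart_at.
  + exact: cth.
pose V := cdom c `&` cto c @^-1` ball (cto c x) r.
have oV : open V by apply: open_cto => //; exact: ball_open.
have VU : V `<=` U by move=> z [cz /Hr[_]]; rewrite (cfromK hc cz).
pose L := L0 \o cto c.
have LE z : V z -> {near cto c z, L0 =1 L \o cfrom c}.
  move=> [cz _]; apply: filterS (near_ccod hc cz) => y cy.
  by rewrite /L/= (ctoK hc cy).
have Lm : atlas (model_charted R^o) (Chart setT setT id id) by [].
have hm := @smooth_atlas_model R R^o.
have sL z : V z -> smooth_pt A (model_charted R^o) L z.
  move=> Vz; have [cz bz] := Vz; have [sz _] := HL0 _ bz.
  have cL : {for z, continuous L}.
    by apply: continuous_comp; [exact: cto_cvg|exact: smooth_near_continuous].
  apply: (smooth_pt_chart C (coords_R) hA hm cL Ac Lm cz I).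
  exact: smooth_near_eq (LE z Vz) sz.
exists V, L; split=> //.
- by split=> //; exact: ballxx.
- exact/(smooth_mapP _ hA hm oV).
- move=> z Vz; have [cz bz] := Vz; have [sz Dz] := HL0 _ bz.
  apply/funext => u.
  have h1 := atlas_chart_at z hA; have h2 := cdom_chart_at z hA.
  have H := @diff_chart_comp _ E E R^o M M R^o A A (model_charted R^o) id L z
    (chart_at A z) c _ u hA hA (smooth_pt_id z hA) (sL z Vz) h1 Ac Lm h2 cz I.
  rewrite /differential /tangent_map; apply: etrans (esym H) _.
  rewrite [LHS](_ : _ = 'd L0 (cto c z) ('d (cto c \o id \o cfrom (chart_at A z))
    (cto (chart_at A z) z) u)).
    rewrite -deriveE; last exact: smooth_near_differentiable.
    rewrite Dz local_form_cto//; congr (th z _).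
    exact: (diff_transitionK u hA h1 Ac h2 cz).
  have E0 := near_eq_diff (LE z Vz) (smooth_near_differentiable sz).
  exact: (congr1 (fun h : E -> R^o => h _) E0).
Qed.

End OneForms.

(** * The cotangent bundle *)

Section DiffComponents.
Context {R : realType} {D E F : normedModType R}.

Lemma fst_diff (f : D -> E * F) x u : differentiable f x ->
  ('d f x u).1 = 'd (fun y => (f y).1) x u.
Proof.
move=> df; rewrite -!deriveE//; last first.
  apply: (@differentiable_comp _ _ _ _ f fst) => //.
  exact/smooth_near_differentiable/smooth_near_fst.
have c1 : continuous (fst : {linear (E * F)%type -> E}) by move=> z; exact: cvg_fst.
exact: (esym (@derive_linear_comp R D _ _ f (fst : {linear (E * F)%type -> E})
  x u c1 df)).
Qed.

Lemma snd_diff (f : D -> E * F) x u : differentiable f x ->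
  ('d f x u).2 = 'd (fun y => (f y).2) x u.
Proof.
move=> df; rewrite -!deriveE//; last first.
  apply: (@differentiable_comp _ _ _ _ f snd) => //.
  exact/smooth_near_differentiable/smooth_near_snd.
have c1 : continuous (snd : {linear (E * F)%type -> F}) by move=> z; exact: cvg_snd.
exact: (esym (@derive_linear_comp R D _ _ f (snd : {linear (E * F)%type -> F})
  x u c1 df)).
Qed.

Lemma diff_comp_fst (f : E -> D) (z u : E * F) : differentiable f z.1 ->
  'd (fun y : E * F => f y.1) z u = 'd f (z.1) u.1.
Proof.
move=> df; have d1 : differentiable (@fst E F)
  z by exact/smooth_near_differentiable/smooth_near_fst.
have H := diff_comp d1 df.
apply: etrans (congr1 (fun h => h u) H) _.
by rewrite /= diff_fstE.
Qed.

Lemma diff_comp_snd (f : F -> D) (z u : E * F) : differentiable f z.2 ->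
  'd (fun y : E * F => f y.2) z u = 'd f (z.2) u.2.
Proof.
move=> df; have d1 : differentiable (@snd E F)
  z by exact/smooth_near_differentiable/smooth_near_snd.
have H := diff_comp d1 df.
apply: etrans (congr1 (fun h => h u) H) _.
by rewrite /= diff_sndE.
Qed.

End DiffComponents.

Lemma smooth_manifold_atlas (R : realType) (n : nat) (Q : topologicalType)
  (A : charted_space 'rV[R]_n Q) : is_smooth_manifold A -> smooth_atlas A.
Proof.
move=> [_ h1 h2 h3]; split=> // c d x Ac Ad cx dx.
have hc := h1 c Ac; have hd := h1 d Ad.
have oV : open (ccod c `&` cfrom c @^-1` cdom d).
  by apply: open_cfrom => //; have [[]] := hd.
apply: ((smooth_onP _ oV).1 (h3 c d Ac Ad)).
by split; [exact: ccod_cto|rewrite /= (cfromK hc cx)].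
Qed.

Section Cotangent.
Context {R : realType} {n : nat} {Q : topologicalType}.
Context {A : charted_space 'rV[R]_n Q}.
Hypothesis hA : smooth_atlas A.
Implicit Types (c d e : chart 'rV[R]_n Q) (z : cotangent A).

Local Notation cot := (cotangent_chart A).
Local Notation T := ('rV[R]_n * 'cV[R]_n)%type.

Lemma mulmx_jacobian p q (f : 'rV[R]_p -> 'rV[R]_q) x v : v *m jacobian f x = 'd f x v.
Proof. by rewrite /jacobian mul_rV_lin1. Qed.

(** Vectors are rows and Jacobians act on the right, so the chain rule multiplies them in the order
    in which the charts are traversed. *)
Lemma jacobian_transitionM x c d e : atlas A c -> atlas A d -> atlas A e ->
  cdom c x -> cdom d x -> cdom e x ->
  jacobian (cto d \o cfrom c) (cto c x) *m jacobian (cto e \o cfrom d) (cto d x) =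
  jacobian (cto e \o cfrom c) (cto c x).
Proof.
move=> Ac Ad Ae cx dx ex.
have H v := diff_transition_comp hA v Ac Ad Ae cx dx ex.
move: (mulmx_jacobian (cto d \o cfrom c) (cto c x)) (mulmx_jacobian (cto e \o cfrom d)
  (cto d x))
  (mulmx_jacobian (cto e \o cfrom c) (cto c x)).
generalize (jacobian (cto d \o cfrom c) (cto c x)) (jacobian (cto e \o cfrom d)
  (cto d x))
  (jacobian (cto e \o cfrom c) (cto c x)) => J1 J2 J3 E1 E2 E3.
by apply/row_matrixP => i; rewrite !rowE mulmxA E1 E2 E3; exact: H.
Qed.

Lemma jacobian_transition1 x c : atlas A c -> cdom c x ->
  jacobian (cto c \o cfrom c) (cto c x) = 1%:M.
Proof.
move=> Ac cx; have H v := diff_chart_id v hA Ac cx.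
move: (mulmx_jacobian (cto c \o cfrom c) (cto c x)).
generalize (jacobian (cto c \o cfrom c) (cto c x)) => J E.
by apply/row_matrixP => i; rewrite !rowE mulmx1 E; exact: H.
Qed.

(** Covectors change by the Jacobian of the inverse transition. The preferred chart at the base
    point, through which both bundle charts pass, cancels. *)
Lemma cotangent_transition c d (y : T) : atlas A c -> atlas A d ->
  ccod c y.1 -> cdom d (cfrom c y.1) ->
  cto (cot d) (cfrom (cot c) y) =
  (cto d (cfrom c y.1), jacobian (cto c \o cfrom d) (cto d (cfrom c y.1)) *m y.2).
Proof.
move=> Ac Ad cy dy; rewrite /=; set q := cfrom c y.1.
have cq : cdom c q := cdom_cfrom (atlas_chart hA Ac) cy.
have E := jacobian_transitionM Ad (atlas_chart_at q hA) Ac dy (cdom_chart_at q hA) cq.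
have H (J1 J2 J3 : 'M[R]_n) : J1 *m J2 = J3 ->
    (cto d q, J1 *m (J2 *m y.2)) = (cto d q, J3 *m y.2) by move=> <-; rewrite mulmxA.
exact: (H _ _ _ E).
Qed.

Lemma smooth_cotangent_transition c d (y : T) : atlas A c -> atlas A d ->
  ccod c y.1 -> cdom d (cfrom c y.1) -> smooth_near y (cto (cot d) \o cfrom (cot c)).
Proof.
move=> Ac Ad cy dy; have hc := atlas_chart hA Ac; have hd := atlas_chart hA Ad.
have [_ _ tA] := hA; set q := cfrom c y.1 in dy *.
have cq : cdom c q := cdom_cfrom hc cy.
have yE : cto c q = y.1 := ctoK hc cy.
pose psi := cto d \o cfrom c.
have spsi : smooth_near y.1 psi by rewrite -yE; exact: tA.
have sjac : smooth_near (psi y.1) (jacobian (cto c \o cfrom d)).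
  by apply: smooth_near_jacobian; exact: tA.
have s1 : smooth_near y (psi \o fst).
  by have := @smooth_near_comp _ _ _ _ _ (coords_rV n) y fst psi; apply => //;
    exact: smooth_near_fst.
have s2 : smooth_near y (jacobian (cto c \o cfrom d) \o (psi \o fst)).
  exact: (smooth_near_comp (coords_rV n) s1 sjac).
have s3 : smooth_near y (fun y' : T => (psi y'.1, jacobian (cto c \o cfrom d)
  (psi y'.1) *m y'.2)).
  by apply: smooth_near_pair => //; apply: smooth_near_mulmx => //;
    exact: smooth_near_snd.
apply: smooth_near_eq s3.
have n1 : \forall y' \near y.1, ccod c y' /\ cdom d (cfrom c y').
  rewrite -yE; have := near_transition hA Ac Ad cq dy.
  by apply: filterS => y' [].
have n2 : \forall y' \near y, ccod c y'.1 /\ cdom d (cfrom c y'.1).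
  by have c1 : {for y, continuous (@fst 'rV[R]_n 'cV[R]_n)} by [exact: cvg_fst];
    exact: (c1 _ n1).
by apply: filterS n2 => y' [h1 h2]; rewrite /= -cotangent_transition.
Qed.

(** The topology of the bundle is defined through the charts, so [cfrom] is continuous by
    construction, and continuity of [cto] reduces to that of the transition maps. *)
Lemma is_chart_cotangent c : atlas A c -> is_chart (cot c).
Proof.
move=> Ac; have hc := atlas_chart hA Ac; have [[oc oc'] _ _ _ _] := hc.
have cotK (y : T) : ccod (cot c) y -> cdom (cot c) (cfrom (cot c) y) /\ cto (cot c)
  (cfrom (cot c) y) = y.
  move=> [/= cy _]; have cq := cdom_cfrom hc cy; split=> //.
  apply: etrans (cotangent_transition Ac Ac cy cq) _; rewrite (ctoK hc cy).
  have E := jacobian_transition1 Ac cq; rewrite (ctoK hc cy) in E.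
  have H (J : 'M[R]_n) : J = 1%:M -> (y.1, J *m y.2) = y.
    by move=> ->; rewrite mul1mx; case: y {cy cq E}.
  exact: (H _ E).
split=> //.
- split; last by apply: openX => //; exact: openT.
  move=> d Ad y [/= dy _] cq.
  have hd := atlas_chart hA Ad.
  have n1 : \forall y' \near y.1, cdom c (cfrom d y').
    rewrite -(ctoK hd dy); apply: (near_cfrom hd (cdom_cfrom hd dy)).
    exact: near_cdom.
  by have c1 : {for y, continuous (@fst 'rV[R]_n 'cV[R]_n)} by [exact: cvg_fst];
    exact: (c1 _ n1).
- move=> z /= cz; split; first by split=> //; exact: ccod_cto.
  have Ak := atlas_chart_at z.1 hA; have kz := cdom_chart_at z.1 hA.
  have E := etrans (jacobian_transitionM Ak Ac Ak kz cz kz)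
    (jacobian_transition1 Ak kz).
  have H (J1 J2 : 'M[R]_n) : J1 *m J2 = 1%:M -> (z.1, J1 *m (J2 *m z.2)) = z.
    by move=> J12; rewrite mulmxA J12 mul1mx; case: z {cz Ak kz E}.
  by rewrite (cfromK hc cz); exact: (H _ _ E).
- move=> z cz B; rewrite nbhsE => -[V [oV Vz] VB].
  have oW : open [set z' : cotangent A | cdom c z'.1 /\ V (cto (cot c) z')].
    move=> d Ad y [dy _] [cq Vq].
    have hd := atlas_chart hA Ad.
    have s := smooth_cotangent_transition Ad Ac dy cq.
    have n1 : \forall y' \near y, V ((cto (cot c) \o cfrom (cot d)) y').
      by apply: (smooth_near_continuous s); exact: open_nbhs_nbhs.
    have n2 : \forall y' \near y.1, cdom c (cfrom d y').
      rewrite -(ctoK hd dy); apply: (near_cfrom hd (cdom_cfrom hd dy)).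
      exact: near_cdom.
    have n3 : \forall y' \near y, cdom c (cfrom d y'.1).
      by have c1 : {for y, continuous (@fst 'rV[R]_n 'cV[R]_n)} by [exact: cvg_fst];
        exact: (c1 _ n2).
    by apply: filterS (filterI n1 n3) => y' [].
  have : nbhs z [set z' : cotangent A | cdom c z'.1 /\ V (cto (cot c) z')]
    by exact: open_nbhs_nbhs.
  by apply: filterS => z' [_ /VB].
- move=> y cy B; rewrite nbhsE => -[V [oV Vz] VB].
  by apply: filterS (oV c Ac y cy Vz) => y' /VB.
Qed.

Lemma smooth_atlas_cotangent : smooth_atlas (cotangent_charted A).
Proof.
split.
- by move=> _ [c Ac <-]; exact: is_chart_cotangent.
- move=> z; split; last exact: (cdom_chart_at z.1 hA).
  by exists (chart_at A z.1) => //; exact: atlas_chart_at.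
- move=> _ _ z [c Ac <-] [d Ad <-] cz dz.
  have hc := atlas_chart hA Ac.
  apply: (smooth_cotangent_transition Ac Ad) => /=; first exact: ccod_cto.
  by rewrite (cfromK hc cz).
Qed.

Lemma smooth_pt_cotangent_proj z : smooth_pt (cotangent_charted A)
  A (@cotangent_proj _ _ _ A) z.
Proof.
have hT := smooth_atlas_cotangent.
have Ac := atlas_chart_at z.1 hA; have cz := cdom_chart_at z.1 hA; set c :=
  chart_at A z.1 in Ac cz.
have Tc : atlas (cotangent_charted A) (cot c) by exists c.
have hc := atlas_chart hA Ac.
have s : smooth_near (cto (cot c) z) (cto c \o @cotangent_proj _ _ _ A \o cfrom (cot
  c)).
  have := @smooth_near_comp _ _ _ _ _ (coords_rV n) (cto (cot c) z)
    fst (cto c \o cfrom c).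
  apply; first exact: smooth_near_fst.
  by have [_ _ tA] := hA; exact: tA.
have nd : \forall z' \near z, cdom c (cotangent_proj z').
  exact: (near_cdom (atlas_chart hT Tc) cz).
have cont : {for z, continuous (@cotangent_proj _ _ _ A)}.
  by apply: (chart_continuous hT hA Tc Ac cz nd); exact: smooth_near_continuous.
exact: (smooth_pt_chart (coords_prod (coords_rV n) (coords_cV n)) (coords_rV n)
  hT hA cont Tc Ac cz cz s).
Qed.

Lemma tangent_map_cotangent_proj z (u : T) :
  tangent_map (cotangent_charted A) A (@cotangent_proj _ _ _ A) z u = u.1.
Proof.
have cz := cdom_chart_at z.1 hA; have Ac := atlas_chart_at z.1 hA.
have [_ _ tA] := hA.
set c := chart_at A z.1 in cz Ac *.
have d1 : differentiable (cto c \o cfrom c) (cto (cot c) z).1.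
  by apply: smooth_near_differentiable; exact: tA.
have H := @diff_comp_fst R _ _ 'cV[R]_n (cto c \o cfrom c) (cto (cot c) z) u d1.
exact: (etrans H (diff_chart_id u.1 hA Ac cz)).
Qed.

(** The Liouville form is [p dq] in every bundle chart: the Jacobian acting on the vector and the
    one acting on the covector are inverse to each other. *)
Lemma local_form_liouville c (y u : T) : atlas A c -> ccod c y.1 ->
  local_form (@liouville_form _ _ _ A) (cot c) y u = (u.1 *m y.2) 0 0.
Proof.
move=> Ac cy; have hc := atlas_chart hA Ac.
rewrite local_formE /liouville_form tangent_map_cotangent_proj /covector_at.
set q := cfrom c y.1.
have cq : cdom c q := cdom_cfrom hc cy.
have yE : cto c q = y.1 := ctoK hc cy.
have Ak := atlas_chart_at q hA; have kq := cdom_chart_at q hA; set k := chart_at A q in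
  Ak kq.
have s := smooth_near_differentiable (smooth_cotangent_transition Ac Ak cy kq).
have [_ _ tA] := hA.
have d1 : differentiable (cto k \o cfrom c) y.1.
  by apply: smooth_near_differentiable; rewrite -yE; exact: tA.
have E1 : ('d (cto (cot k) \o cfrom (cot c))
  y u).1 = u.1 *m jacobian (cto k \o cfrom c) y.1.
  rewrite (fst_diff u s) mulmx_jacobian.
  exact: (@diff_comp_fst R _ _ 'cV[R]_n (cto k \o cfrom c) y u d1).
rewrite [X in (X *m _) _ _]E1 /=.
have E := etrans (jacobian_transitionM Ac Ak Ac cq kq cq) (jacobian_transition1 Ac cq).
have H (J1 J2 : 'M[R]_n) : J1 *m J2 = 1%:M ->
    (u.1 *m J1 *m (J2 *m y.2)) 0 0 = (u.1 *m y.2) 0 0.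
  by move=> J12; rewrite -mulmxA [X in u.1 *m X]mulmxA J12 mul1mx.
by rewrite yE in E; exact: (H _ _ E).
Qed.

(** The two-form [dq /\ dp], which is minus the exterior derivative of [p dq]. *)
Definition standard_form (u v : T) : R := (u.1 *m v.2) 0 0 - (v.1 *m u.2) 0 0.

Lemma canonical_symplectic_formE z (u v : T) :
  @canonical_symplectic_form _ _ _ A z u v = standard_form u v.
Proof.
have hT := smooth_atlas_cotangent.
have D (w w' : T) : 'D_w (fun y => local_form (@liouville_form _ _ _ A)
  (cot (chart_at A z.1)) y w')
    (cto (cot (chart_at A z.1)) z) = (w'.1 *m w.2) 0 0.
  have Ac := atlas_chart_at z.1 hA; have cz := cdom_chart_at z.1 hA.
  set c := chart_at A z.1 in Ac cz *; have hc := atlas_chart hA Ac.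
  pose l (y : T) : 'cV[R]_1 := w'.1 *m y.2.
  have l1 : linear l by move=> a y y'; rewrite /l /= mulmxDr -scalemxAr.
  pose L : {linear T -> 'cV[R]_1} := HB.pack l (GRing.isLinear.Build R T 'cV[R]_1 _ l
    l1).
  have cL : continuous L.
    exact: (linear_coords_continuous (coords_prod (coords_rV n) (coords_cV n))).
  have dL y : differentiable L y by exact: linear_differentiable.
  rewrite -[RHS]/(l w 0 0).
  transitivity ('D_w (fun y => L y 0 0 : R^o) (cto (cot c) z)).
    apply: near_eq_derive.
    have := near_ccod (is_chart_cotangent Ac) cz.
    by apply: filterS => y [cy _]; rewrite local_form_liouville.
  rewrite (@derive_entry R T 1 1 L (cto (cot c) z) w 0 0 (dL _)) (deriveE _ (dL _)).
  by rewrite (diff_lin _ cL).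
by rewrite /canonical_symplectic_form /ext_deriv /= !D opprB.
Qed.

End Cotangent.

(** * Discrete Lagrangians and Lagrangian immersions *)

Section Generating.
Context {R : realType} {n : nat} {Q : topologicalType}.
Context {A : charted_space 'rV[R]_n Q}.
Hypothesis hA : smooth_atlas A.
Implicit Types (c d : chart 'rV[R]_n Q) (x : Q * Q) (u v w : 'rV[R]_n).

Local Notation cot := (cotangent_chart A).
Local Notation T := ('rV[R]_n * 'cV[R]_n)%type.
Local Notation V2 := ('rV[R]_n * 'rV[R]_n)%type.
Local Notation A2 := (prod_charted A A).
Local Notation TA := (cotangent_charted A).
Local Notation C2 := (coords_prod (coords_rV n) (coords_rV n)).
Local Notation CT := (coords_prod (coords_rV n) (coords_cV n)).

Let hA2 : smooth_atlas A2 := smooth_atlas_prod (coords_rV n) (coords_rV n) hA hA.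
Let hT : smooth_atlas TA := smooth_atlas_cotangent hA.

Lemma prod_chart_atlas c d : atlas A c -> atlas A d -> atlas A2 (prod_chart c d).
Proof. by move=> Ac Ad; exists c, d. Qed.

Lemma cotangent_chart_atlas c : atlas A c -> atlas TA (cot c).
Proof. by move=> Ac; exists c. Qed.

Lemma covector_at_linear (z : cotangent A) : linear (covector_at z).
Proof. by move=> a u v; rewrite /covector_at mulmxDl -scalemxAl !mxE. Qed.

Lemma covector_at_chart c (z : cotangent A) u : covector_at z
    ('d (cto (chart_at A z.1) \o cfrom c) (cto c z.1) u) =
  (u *m (cto (cot c) z).2) 0 0.
Proof.
rewrite /covector_at -(mulmx_jacobian (cto (chart_at A z.1) \o cfrom c)).
by rewrite -mulmxA.
Qed.

Lemma derive_pairing (D : normedModType R) (f : D -> T) w y t : differentiable f y ->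
  is_derive y t (fun y => (w *m (f y).2) 0 0 : R^o) ((w *m ('d f y t).2) 0 0).
Proof.
move=> df; rewrite -(deriveE _ df).
pose l (z : T) : R^o := (w *m z.2) 0 0.
have l1 : linear l by move=> a z z'; rewrite /l /= mulmxDr -scalemxAr !mxE.
pose L : {linear T -> R^o} := HB.pack l (GRing.isLinear.Build R T R^o _ l l1).
have cL : continuous L by exact: (linear_coords_continuous CT).
apply: DeriveDef; last exact: (derive_linear_comp t cL df).
have dL : differentiable L (f y) by exact: linear_differentiable.
exact: (diff_derivable (differentiable_comp df dL)).
Qed.

Lemma diff_prod_transition c d (e e' : chart 'rV[R]_n Q) (y t : V2) :
  differentiable (cto e \o cfrom c) y.1 -> differentiable (cto e' \o cfrom d) y.2 ->
  'd (cto (prod_chart e e') \o cfrom (prod_chart c d)) y t =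
  ('d (cto e \o cfrom c) (y.1) t.1, 'd (cto e' \o cfrom d) (y.2) t.2).
Proof.
move=> d1 d2.
have f1 : differentiable (fst : V2 -> 'rV[R]_n)
  y by exact/smooth_near_differentiable/smooth_near_fst.
have f2 : differentiable (snd : V2 -> 'rV[R]_n)
  y by exact/smooth_near_differentiable/smooth_near_snd.
have g1 := differentiable_comp f1 d1; have g2 := differentiable_comp f2 d2.
apply: etrans (congr1 (fun h => h t) (diff_pair g1 g2)) _.
by congr (_, _); [exact: diff_comp_fst|exact: diff_comp_snd].
Qed.

(** Differentials of transition maps are invertible, so injectivity of a tangent map may be used in
    any pair of charts. *)
Lemma diff_chart_injective (E' F' : normedModType R) (M N : topologicalType)
    (B : charted_space E' M) (B' : charted_space F' N) (f : M -> N) (z : M)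
    (c : chart E' M) (d : chart F' N) :
  smooth_atlas B -> smooth_atlas B' -> smooth_pt B B' f z ->
  (forall u : E', tangent_map B B' f z u = 0 -> u = 0) ->
  atlas B c -> atlas B' d -> cdom c z -> cdom d (f z) ->
  forall u : E', 'd (cto d \o f \o cfrom c) (cto c z) u = 0 -> u = 0.
Proof.
move=> hB hB' sf injf Bc Bd cz dz u du0.
have Bk := atlas_chart_at z hB; have kz := cdom_chart_at z hB.
have Bk' := atlas_chart_at (f z) hB'; have kz' := cdom_chart_at (f z) hB'.
have H1 := @diff_chart_comp _ _ _ _ _ _ _ B B B' id f z c _ _ u hB hB (smooth_pt_id z
  hB) sf Bc Bk Bk' cz kz kz'.
have H2 := @diff_chart_comp _ _ _ _ _ _ _ B B' B' f id z c _ _ u hB hB' sf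
  (smooth_pt_id (f z) hB') Bc Bd Bk' cz dz kz'.
have H3 : tangent_map B B' f z ('d (cto (chart_at B z) \o cfrom c) (cto c z) u) = 0.
  apply: (etrans H1); apply: (etrans (esym H2)).
  by rewrite du0 linear0.
rewrite -(diff_transitionK u hB Bc Bk cz kz) (injf _ H3).
exact: linear0.
Qed.

(** Momenta are [q0]-derivatives of [L], and their variation in [q1] is wanted, whereas [D12]
    differentiates in the opposite order; Schwarz's theorem exchanges the two. The transpose appears
    because the row [w] is contracted with the second index of [D12]. *)
Lemma D12_pairing (L : Q * Q -> R^o) x c d w i : atlas A c -> atlas A d ->
  cdom c x.1 -> cdom d x.2 ->
  smooth_pt A2 (model_charted R^o) L x ->
  'D_(0, w) ('D_(delta_mx 0 i, 0) (L \o cfrom (prod_chart c d))) (cto (prod_chart c d)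
    x) =
  (w *m (D12 L c d x)^T) 0 i.
Proof.
move=> Ac Ad cx dx sL; set k := prod_chart c d.
have Lm : atlas (model_charted R^o) (Chart setT setT id id) by [].
have sk : smooth_near (cto k x) (L \o cfrom k) := sL.2 _ _ (prod_chart_atlas Ac Ad)
  Lm (conj cx dx) I.
pose g : V2 -> R^o := 'D_(delta_mx 0 i, 0) (L \o cfrom k).
have dg : differentiable g (cto k x) by apply/smooth_near_differentiable/smooth_near_derive.
pose l v : R^o := 'D_(0, v) g (cto k x).
have l1 : linear l.
  move=> a v v'; rewrite /l !deriveE// -linearP; congr ('d g _ _).
  by congr (_, _); rewrite /= scaler0 addr0.
have lE := linear_funE (coords_rV n) l1 w.
rewrite -[LHS]/(l w) lE mxE; apply: eq_bigr => j _.
have -> : (D12 L c d x)^T j i =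
    'D_(delta_mx 0 i, 0) ('D_(0, delta_mx 0 j) (L \o cfrom k)) (cto k x)
      by rewrite /D12 !mxE.
exact: (congr1 (fun z : R => w 0 j * z) (smooth_near_schwarz (0, delta_mx 0 j)
  (delta_mx 0 i, 0) sk)).
Qed.

Section Form.
Variables (F : Q * Q -> cotangent A) (Gt : Q * Q -> Q) (U : set (Q * Q)).
Hypothesis oU : open U.
Hypothesis sF : forall x, U x -> smooth_pt A2 TA F x.
Hypothesis pF : forall x, U x -> x.1 = (F x).1.
Hypothesis sGt : forall x, U x -> smooth_pt A2 A Gt x.
Hypothesis UG : forall x, U x -> U (x.2, Gt x).

Let G2 x := (x.2, Gt x).

(** The pullback by [gamma] of the difference of the two Liouville forms; its
    local primitives [L] satisfy [D1 L x = - F x] and [D2 L x = F (x.2, Gt x)],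
    and its exterior derivative is the pullback of [- Omega]. *)
Definition generating_form : @one_form R V2 (Q * Q)%type A2 :=
  fun x t => covector_at (F (x.2, Gt x)) t.2 - covector_at (F x) t.1.
Local Notation alpha := generating_form.

Lemma generating_form_linear : linear_form alpha.
Proof.
move=> x a t t'; rewrite /alpha /= !covector_at_linear.
by rewrite scalerBr opprD addrACA.
Qed.

Lemma smooth_pt_shift x : U x -> smooth_pt A2 A2 G2 x.
Proof.
move=> Ux; apply: smooth_pt_pair; last exact: sGt.
exact: (smooth_pt_snd (coords_rV n) hA).
Qed.

Lemma smooth_pt_Fshift x : U x -> smooth_pt A2 TA (F \o G2) x.
Proof.
move=> Ux; apply: (smooth_pt_comp C2 hA2 hA2 (smooth_pt_shift Ux)).
exact: sF (UG Ux).
Qed.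

(** The derivative of [pF]. It fixes the [q] components in the pullback of the symplectic form, so
    that only [p] components remain to be compared. *)
Lemma tangent_F_fst x t : U x -> (tangent_map A2 TA F x t).1 = t.1.
Proof.
move=> Ux; have sp := smooth_pt_cotangent_proj hA (F x).
rewrite -(tangent_map_cotangent_proj hA (F x)) -(tangent_map_comp _ hA2 hT hA (sF Ux)
  sp).
rewrite -[RHS](tangent_map_fst (B := A) hA x t).
have E : {near x, fst =1 @cotangent_proj _ _ _ A \o F}.
  by apply: filterS (open_nbhs_nbhs (conj oU Ux)) => z /pF.
by rewrite (tangent_map_eq hA2 hA E (smooth_pt_fst (coords_rV n) hA x)).
Qed.

Lemma tangent_Fshift_fst x t : U x -> (tangent_map A2 TA (F \o G2) x t).1 = t.2.
Proof.
move=> Ux.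
rewrite (tangent_map_comp _ hA2 hA2 hT (smooth_pt_shift Ux) (sF (UG Ux))).
rewrite (tangent_F_fst _ (UG Ux)).
rewrite (tangent_map_pair hA hA hA2 _ (smooth_pt_snd (coords_rV n) hA x) (sGt Ux)) /=.
exact: tangent_map_snd.
Qed.

(** In coordinates the form is [p1 dq1 - p0 dq0], with [p0] and [p1] the fibre components of [F] at
    the point and at its image under [G2]. *)
Lemma local_form_generating c d (y t : V2) : atlas A c -> atlas A d ->
  ccod c y.1 -> ccod d y.2 -> U (cfrom c y.1, cfrom d y.2) ->
  local_form alpha (prod_chart c d) y t =
  (t.2 *m ((cto (cot d) \o (F \o G2) \o cfrom (prod_chart c d)) y).2) 0 0 -
  (t.1 *m ((cto (cot c) \o F \o cfrom (prod_chart c d)) y).2) 0 0.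
Proof.
move=> Ac Ad cy dy Uy; have hc := atlas_chart hA Ac; have hd := atlas_chart hA Ad.
rewrite local_formE /=; set q := cfrom c y.1 in Uy *; set q' := cfrom d y.2 in Uy *.
have [_ _ tA] := hA.
have cq : cdom c q := cdom_cfrom hc cy; have dq : cdom d q' := cdom_cfrom hd dy.
have d1 : differentiable (cto (chart_at A q) \o cfrom c) y.1.
  apply: smooth_near_differentiable; rewrite -(ctoK hc cy).
  by apply: tA => //; [exact: atlas_chart_at|exact: cdom_chart_at].
have d2 : differentiable (cto (chart_at A q') \o cfrom d) y.2.
  apply: smooth_near_differentiable; rewrite -(ctoK hd dy).
  by apply: tA => //; [exact: atlas_chart_at|exact: cdom_chart_at].
have E := diff_prod_transition t d1 d2.
rewrite /alpha [X in covector_at _ X.2 - _]E [X in _ - covector_at _ X.1]E /=.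
have e1 : q = (F (q, q')).1 := pF Uy; have e2 : q' = (F (q', Gt (q, q'))).1 :=
  pF (UG Uy).
have H1 := covector_at_chart c (F (q, q')) t.1.
have H2 := covector_at_chart d (F (q', Gt (q, q'))) t.2.
rewrite -e1 (ctoK hc cy) in H1; rewrite -e2 (ctoK hd dy) in H2.
by congr (_ - _); [exact: H2|exact: H1].
Qed.

Lemma near_local_form_generating x c d t : U x -> atlas A c -> atlas A d ->
  cdom c x.1 -> cdom d x.2 ->
  {near cto (prod_chart c d) x,
    (fun y => (t.2 *m ((cto (cot d) \o (F \o G2) \o cfrom (prod_chart c d)) y).2) 0 0 -
    (t.1 *m ((cto (cot c) \o F \o cfrom (prod_chart c d)) y).2) 0 0 : R^o) =1
    (fun y => local_form alpha (prod_chart c d) y t)}.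
Proof.
move=> Ux Ac Ad cx dx.
have hk : is_chart (prod_chart c d) := atlas_chart hA2 (prod_chart_atlas Ac Ad).
have kx : cdom (prod_chart c d) x by [].
have n1 := near_ccod hk kx.
have n2 := near_cfrom hk kx (open_nbhs_nbhs (conj oU Ux)).
by apply: filterS (filterI n1 n2) => y [[h1 h2] h3]; rewrite -local_form_generating.
Qed.

Lemma smooth_near_F x c d : U x -> atlas A c -> atlas A d -> cdom c x.1 -> cdom d x.2 ->
  smooth_near (cto (prod_chart c d) x) (cto (cot c) \o F \o cfrom (prod_chart c d)).
Proof.
move=> Ux Ac Ad cx dx; apply: (sF Ux).2 => //;
  [exact: prod_chart_atlas|exact: cotangent_chart_atlas|].
by rewrite /= -(pF Ux).
Qed.

Lemma smooth_near_Fshift x c d : U x -> atlas A c -> atlas A d -> cdom c x.1 ->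
  cdom d x.2 ->
  smooth_near (cto (prod_chart c d) x) (cto (cot d) \o (F \o G2)
    \o cfrom (prod_chart c d)).
Proof.
move=> Ux Ac Ad cx dx; apply: (smooth_pt_Fshift Ux).2 => //;
  [exact: prod_chart_atlas|exact: cotangent_chart_atlas|].
by rewrite /= -(pF (UG Ux)).
Qed.

Lemma smooth_generating_form x : U x -> smooth_form_pt alpha x.
Proof.
move=> Ux k [c [d [Ac Ad ->]]] [cx dx] t.
apply: smooth_near_eq (near_local_form_generating t Ux Ac Ad cx dx) _.
have pairing w (f : V2 -> T) y : smooth_near y f -> smooth_near y (fun y =>
  (w *m (f y).2) 0 0 : R^o).
  move=> sf.
  have s2 : smooth_near y (fun y => (f y).2).
    by apply: (smooth_near_comp CT sf); exact: smooth_near_snd.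
  by apply: ((smooth_near_mxP _ _).1 _ 0 0); apply: smooth_near_mulmx => //;
    exact: smooth_near_cst.
pose f1 y : R^o := (t.2 *m ((cto (cot d) \o (F \o G2) \o cfrom (prod_chart c d)) y).2)
  0 0.
pose f2 y : R^o := (t.1 *m ((cto (cot c) \o F \o cfrom (prod_chart c d)) y).2) 0 0.
have s1 : smooth_near (cto (prod_chart c d) x) f1 by apply: pairing;
  exact: smooth_near_Fshift.
have s2 : smooth_near (cto (prod_chart c d) x) f2 by apply: pairing;
  exact: smooth_near_F.
have s3 := smooth_nearD s1 (smooth_near_scale (smooth_near_cst _ (-1 : R^o)) s2).
have E : f1 + (fun y => cst (-1 : R^o) y *: f2 y) = (fun y : V2 => f1 y - f2 y : R^o).
  by apply/funext => y; rewrite fctE/= scaleN1r.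
by rewrite E in s3; exact: s3.
Qed.

(** Compared in coordinates rather than through naturality of the exterior derivative: the [q]
    components of the two tangent vectors are [t.1] and [t.2], and both sides are the same
    combination of derivatives of the [p] components. *)
Lemma pullback_Omega x t t' : U x ->
  pullback2 A2 (gamma F Gt) (@Omega _ _ _ A) x t t' =
  'D_t' (fun y => local_form alpha (chart_at A2 x) y t) (cto (chart_at A2 x) x) -
  'D_t (fun y => local_form alpha (chart_at A2 x) y t') (cto (chart_at A2 x) x).
Proof.
move=> Ux.
have Tg s : tangent_map A2 (cotangent2_charted A) (gamma F Gt) x s =
    (tangent_map A2 TA F x s, tangent_map A2 TA (F \o G2) x s).
  exact: (tangent_map_pair hT hT hA2 s (sF Ux) (smooth_pt_Fshift Ux)).
have Ac := atlas_chart_at x.1 hA; have cx := cdom_chart_at x.1 hA.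
have Ad := atlas_chart_at x.2 hA; have dx := cdom_chart_at x.2 hA.
set k := chart_at A2 x.
have DE s s' : 'D_s (fun y => local_form alpha k y s') (cto k x) =
    (s'.2 *m (tangent_map A2 TA (F \o G2) x s).2)
      0 0 - (s'.1 *m (tangent_map A2 TA F x s).2) 0 0.
  rewrite -(near_eq_derive s (near_local_form_generating s' Ux Ac Ad cx dx)).
  have d1 := smooth_near_differentiable (smooth_near_F Ux Ac Ad cx dx).
  have d2 := smooth_near_differentiable (smooth_near_Fshift Ux Ac Ad cx dx).
  have [p1 D1] := derive_pairing s'.1 s d1; have [p2 D2] := derive_pairing s'.2 s d2.
  apply: etrans (deriveB p2 p1) _; rewrite D1 D2 /tangent_map /=.
  by rewrite -(pF Ux) -(pF (UG Ux)).
rewrite /pullback2 /Omega !Tg /pullback2.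
rewrite !(canonical_symplectic_formE hA) !(tangent_map_snd hT) !(tangent_map_fst hT)
  /= !DE.
move: (tangent_F_fst t Ux) (tangent_F_fst t' Ux) (tangent_Fshift_fst t Ux)
  (tangent_Fshift_fst t' Ux).
generalize (tangent_map A2 TA F x t) (tangent_map A2 TA F x t')
  (tangent_map A2 TA (F \o G2) x t) (tangent_map A2 TA (F \o G2) x t') => a a' b b'.
by rewrite /standard_form => -> -> -> ->; ring.
Qed.

Lemma lagrangian_closed x : U x ->
  (forall t t', pullback2 A2 (gamma F Gt) (@Omega _ _ _ A) x t t' = 0) <->
  closed_in alpha (chart_at A2 x) (cto (chart_at A2 x) x).
Proof.
move=> Ux; split=> [H t t'|H t t'].
  by have := H t' t; rewrite (pullback_Omega t' t Ux) => /eqP; rewrite subr_eq0 => /eqP.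
rewrite (pullback_Omega t t' Ux); apply/eqP; rewrite subr_eq0; apply/eqP; exact: H.
Qed.

Lemma diff_F_fst x c d (t : V2) : U x -> atlas A c -> atlas A d -> cdom c x.1 ->
  cdom d x.2 ->
  ('d (cto (cot c) \o F \o cfrom (prod_chart c d)) (cto (prod_chart c d) x) t).1 = t.1.
Proof.
move=> Ux Ac Ad cx dx; set k := prod_chart c d.
have df := smooth_near_differentiable (smooth_near_F Ux Ac Ad cx dx).
rewrite (fst_diff t df) -(diff_fstE (cto k x) t).
have hk : is_chart k := atlas_chart hA2 (prod_chart_atlas Ac Ad).
have kx : cdom k x by [].
have n1 := near_ccod hk kx.
have n2 := near_cfrom hk kx (open_nbhs_nbhs (conj oU Ux)).
have E : {near cto k x, (fst : V2 -> 'rV[R]_n) =1 (fun y => ((cto (cot c)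
  \o F \o cfrom k) y).1)}.
  apply: filterS (filterI n1 n2) => y [[h1 h2] h3].
  by rewrite /= -(pF h3) /= (ctoK (atlas_chart hA Ac) h1).
have E2 := near_eq_diff E (smooth_near_differentiable (smooth_near_fst (cto k x))).
exact: (congr1 (fun h : V2 -> 'rV[R]_n => h t) E2).
Qed.

(** If [w] is killed by the transpose of [D12], then [(0, w)] is killed by the differential of [F]:
    its base component vanishes because [F] covers the first projection, its fibre component because
    it is minus [w] times that transpose. *)
Lemma generating_regular (V : set (Q * Q)) (L : Q * Q -> R^o) x c d :
  open V -> V `<=` U -> V x ->
  (forall z, V z -> smooth_pt A2 (model_charted R^o) L z) ->
  (forall z, V z -> differential A2 L z = alpha z) ->
  (forall t, tangent_map A2 TA F x t = 0 -> t = 0) ->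
  atlas A c -> atlas A d -> cdom c x.1 -> cdom d x.2 -> D12 L c d x \in unitmx.
Proof.
move=> oV VU Vx sL dL injF Ac Ad cx dx; set k := prod_chart c d; have Ux := VU x Vx.
rewrite -unitmx_tr -row_free_unit; apply/inj_row_free => w w0.
have hk : is_chart k := atlas_chart hA2 (prod_chart_atlas Ac Ad).
have kx : cdom k x by [].
have df := smooth_near_differentiable (smooth_near_F Ux Ac Ad cx dx).
have dfG := smooth_near_differentiable (smooth_near_Fshift Ux Ac Ad cx dx).
pose t : V2 := (0, w).
suff /(diff_chart_injective hA2 hT (sF Ux) injF (prod_chart_atlas Ac Ad)
  (cotangent_chart_atlas Ac) kx)H :
    'd (cto (cot c) \o F \o cfrom k) (cto k x) t = 0.
  have /H : cdom (cot c) (F x) by rewrite /= -(pF Ux).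
  by case.
have f1 := diff_F_fst t Ux Ac Ad cx dx.
have f2 : ('d (cto (cot c) \o F \o cfrom k) (cto k x) t).2 = 0.
  apply/colP => i.
  have D := D12_pairing w i Ac Ad cx dx (sL x Vx).
  have n1 := near_ccod hk kx.
  have n2 := near_cfrom hk kx (open_nbhs_nbhs (conj oV Vx)).
  pose s : V2 := (delta_mx 0 i, 0).
  have E1 : {near cto k x, (fun y => local_form alpha k y s) =1 'D_s (L \o cfrom k)}.
    apply: filterS (filterI n1 n2) => y [h1 h2].
    have := local_form_differential hA2 s (sL _ h2) (prod_chart_atlas Ac Ad)
      (cdom_cfrom hk h1).
    rewrite (ctoK hk h1) => <-.
    by rewrite /local_form (dL _ h2).
  rewrite w0 mxE -(near_eq_derive t E1) in D.
  rewrite -(near_eq_derive t (near_local_form_generating s Ux Ac Ad cx dx)) in D.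
  have [p1 D1] := derive_pairing s.1 t df; have [p2 D2] := derive_pairing s.2 t dfG.
  have D3 := etrans (esym (deriveB p2 p1)) D.
  rewrite D1 D2 mul0mx [X in X - _]mxE sub0r in D3.
  move/eqP: D3; rewrite oppr_eq0 -rowE mxE => /eqP ->.
  by rewrite mxE.
move: f1 f2; rewrite -/k; generalize ('d (cto (cot c) \o F \o cfrom k) (cto k x) t).
by move=> [a b] /= -> ->.
Qed.

End Form.
End Generating.

Arguments dl_dom {R n Q A U} d i _.
Arguments dl_fun {R n Q A U} d i _.

(** * The two implications *)

Section Variational.
Context {R : realType} {n : nat} {Q : topologicalType}.
Context {A : charted_space 'rV[R]_n Q}.
Hypothesis hA : smooth_atlas A.
Implicit Types (c d : chart 'rV[R]_n Q) (x : Q * Q) (u v w : 'rV[R]_n).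

Local Notation cot := (cotangent_chart A).
Local Notation T := ('rV[R]_n * 'cV[R]_n)%type.
Local Notation V2 := ('rV[R]_n * 'rV[R]_n)%type.
Local Notation A2 := (prod_charted A A).
Local Notation TA := (cotangent_charted A).
Local Notation C2 := (coords_prod (coords_rV n) (coords_rV n)).
Local Notation CT := (coords_prod (coords_rV n) (coords_cV n)).

Let hA2 : smooth_atlas A2 := smooth_atlas_prod (coords_rV n) (coords_rV n) hA hA.
Let hT : smooth_atlas TA := smooth_atlas_cotangent hA.
Let hm : smooth_atlas (model_charted R^o) := smooth_atlas_model R^o.

Variables (U : set (Q * Q)) (Gt : Q * Q -> Q).
Hypothesis oU : open U.
Hypothesis sGt : forall x, U x -> smooth_pt A2 A Gt x.
Hypothesis UG : forall x, U x -> U (x.2, Gt x).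

Lemma covector_at0 (z : cotangent A) : covector_at z 0 = 0.
Proof. by rewrite /covector_at mul0mx mxE. Qed.

Lemma covector_at_inj (z z' : cotangent A) : z.1 = z'.1 -> covector_at z =1
  covector_at z' -> z = z'.
Proof.
move=> e1 e2; rewrite [z]surjective_pairing [z']surjective_pairing e1; congr (_, _).
by apply/colP => i; have := e2 (delta_mx 0 i); rewrite /covector_at -!rowE !mxE.
Qed.

Lemma continuous_tail (t : Q * Q * Q) :
  {for t, continuous (fun t : Q * Q * Q => (t.1.2, t.2))}.
Proof.
apply: cvg_pair; last exact: cvg_snd.
by apply: (@cvg_comp _ _ _ fst snd); [exact: cvg_fst|exact: cvg_snd].
Qed.

Lemma continuous_shift_fst (t : Q * Q * Q) : U t.1 ->
  {for t, continuous (fun t : Q * Q * Q => (t.1.2, Gt t.1))}.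
Proof.
move=> Ut; apply: cvg_pair.
  by apply: (@cvg_comp _ _ _ fst snd); [exact: cvg_fst|exact: cvg_snd].
apply: (@cvg_comp _ _ _ fst Gt); first exact: cvg_fst.
exact: (sGt Ut).1.
Qed.

Lemma variational_of_lagrangian (F : Q * Q -> cotangent A) :
  local_diffeomorphism A2 TA U F -> (forall x, U x -> x.1 = cotangent_proj (F x)) ->
  lagrangian_immersion U (gamma F Gt) -> variational A U Gt.
Proof.
move=> dF pF [_ lag].
have sF x : U x -> smooth_pt A2 TA F x.
  by move=> Ux; have [] := local_diffeomorphism_tangent CT hA2 hT dF Ux.
have injF x : U x -> forall t, tangent_map A2 TA F x t = 0 -> t = 0.
  by move=> Ux; have [] := local_diffeomorphism_tangent CT hA2 hT dF Ux.
pose alpha := generating_form F Gt.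
have la : linear_form alpha := generating_form_linear F Gt.
have sa x : U x -> smooth_form_pt alpha x.
  exact: (smooth_generating_form hA oU sF pF sGt UG).
have ca x : U x -> closed_in alpha (chart_at A2 x) (cto (chart_at A2 x) x).
  by move=> Ux; apply/(lagrangian_closed hA oU sF pF sGt UG Ux) => t t'; exact: lag.
(* The points of [U] themselves serve as indices of the discrete Lagrangian: one local primitive is
   chosen around each. *)
have /choice[f Hf] : forall i : {x | U x}, exists VL : set (Q * Q) * (Q * Q -> R^o),
    [/\ open VL.1, VL.1 (sval i), VL.1 `<=` U,
     smooth_map A2 (model_charted R^o) VL.1 VL.2 &
     forall z, VL.1 z -> differential A2 VL.2 z = alpha z].
  move=> [x Ux]; have [V [L H]] := poincare_manifold C2 hA2 la oU sa ca Ux.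
  by exists (V, L).
have cover : \bigcup_i (f i).1 = U.
  apply/seteqP; split=> [x [i _ fx]|x Ux]; first by have [_ _ H _ _] := Hf i; exact: H.
  by exists (exist _ x Ux) => //; have [] := Hf (exist _ x Ux).
pose L : discrete_lagrangian A U := @DiscreteLagrangian R n Q A U {x | U x}
  (fun i => (f i).1) (fun i => (f i).2)
  (fun i => let: And5 h _ _ _ _ := Hf i in h) cover
  (fun i => let: And5 _ _ _ h _ := Hf i in h)
  (fun i j x fi fj => let: And5 _ _ _ _ hi := Hf i in let: And5 _ _ _ _ hj := Hf j in
     etrans (hi x fi) (esym (hj x fj))).
have dLE i x : dl_dom L i x -> differential A2 (dl_fun L i) x = alpha x.
  by have [_ _ _ _] := Hf i; exact.
exists L.
  move=> i x fx c d Ac Ad cx dx; have [h1 h2 h3 h4 h5] := Hf i.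
  apply: (generating_regular hA oU sF pF sGt UG h1 h3 fx _ h5 (injF x (h3 x fx))
    Ac Ad cx dx).
  exact/(smooth_mapP _ hA2 hm h1).
(* Equality of momenta can be inverted only inside a set [V] on which [F] is injective, so both the
   candidate [(q1, q2)] and the true continuation must lie in one such [V]. On the graph the two
   coincide, and the local diffeomorphism property at that point supplies [V]. *)
exists [set t : Q * Q * Q | U t.1 /\ exists V : set (Q * Q), [/\ open V, V `<=` U,
  (forall y z, V y -> V z -> F y = F z -> y = z), V (t.1.2, t.2) & V (t.1.2, Gt t.1)]].
split.
- rewrite openE => t [Ut [V [oV VU iV V1 V2]]].
  have n1 : \forall s \near t, V (s.1.2, s.2).
    exact: (@continuous_tail t _ (open_nbhs_nbhs (conj oV V1))).
  have n2 : \forall s \near t, V (s.1.2, Gt s.1).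
    exact: (@continuous_shift_fst t Ut _ (open_nbhs_nbhs (conj oV V2))).
  have n3 : \forall s \near t, U s.1.
    have c1 : {for t, continuous (@fst (Q * Q) Q)} by exact: cvg_fst.
    exact: (c1 _ (open_nbhs_nbhs (conj oU Ut))).
  apply: filterS (filterI n1 (filterI n2 n3)) => s [h1 [h2 h3]].
  by split=> //; exists V.
- by move=> q0 q1 q2 [/= Uq [V [_ VU _ V1 _]]]; split=> //; exact: VU.
- move=> q0 q1 Uq; split=> //=.
  have [V [oV V1 VU _ [g [gF _ _]]]] := dF _ (UG Uq).
  exists V; split=> // y z Vy Vz Fyz.
  by rewrite -(gF y Vy) Fyz gF.
- move=> q0 q1 q2 [/= Uq [V [oV VU iV V1 V2]]].
  have Uq12 := VU _ V1.
  have DEL i j v : dl_dom L i (q1, q2) -> dl_dom L j (q0, q1) ->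
      D1 A (dl_fun L i) (q1, q2) v + D2 A (dl_fun L j) (q0, q1) v =
      covector_at (F (q1, Gt (q0, q1))) v - covector_at (F (q1, q2)) v.
    move=> hi hj; rewrite /D1 /D2 (dLE i _ hi) (dLE j _ hj) /alpha /generating_form /=.
    by rewrite !covector_at0 sub0r subr0 addrC.
  split=> [q2E i j hi hj v|H].
    by rewrite (DEL i j v hi hj) q2E subrr.
  have [i _ hi] : (\bigcup_i (f i).1) (q1, q2) by rewrite cover.
  have [j _ hj] : (\bigcup_i (f i).1) (q0, q1) by rewrite cover.
  have FE : F (q1, q2) = F (q1, Gt (q0, q1)).
    apply: covector_at_inj.
      by rewrite -[LHS](pF _ Uq12) -[RHS](pF _ (UG Uq)).
    move=> v; have := H i j hi hj v; rewrite (DEL i j v hi hj) => /eqP.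
    by rewrite subr_eq0 => /eqP.
  by have [] := iV _ _ V1 V2 FE.
Qed.

Section Momentum.
Variable L : discrete_lagrangian A U.

(** The common differential of the local Lagrangians, extended by [0] off [U]. *)
Definition lagrangian_form : @one_form R V2 (Q * Q)%type A2 := fun x =>
  if pselect (exists i, dl_dom L i x) is left e
  then differential A2 (dl_fun L (projT1 (cid e))) x else cst 0.

Lemma lagrangian_formE i x : dl_dom L i x ->
  lagrangian_form x = differential A2 (dl_fun L i) x.
Proof.
move=> hi; rewrite /lagrangian_form; case: pselect => [e|[]]; last by exists i.
by apply: dl_compat => //; exact: projT2 (cid e).
Qed.

Lemma lagrangian_form_linear : linear_form lagrangian_form.
Proof.
move=> x; rewrite /lagrangian_form; case: pselect => [e|_] a t t'.
  by rewrite /differential /tangent_map linearP.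
by rewrite scaler0 addr0.
Qed.

(** The discrete Legendre transform [(q0, - D1 L)], with components in the preferred chart at
    [q0]. *)
Definition momentum_map (x : Q * Q) : cotangent A :=
  (x.1, \col_j - lagrangian_form x (delta_mx 0 j, 0)).
Local Notation F := momentum_map.

Lemma covector_at_momentum x u : covector_at (F x) u = - lagrangian_form x (u, 0).
Proof.
pose l u : R^o := lagrangian_form x (u, 0).
have l1 : linear l.
  move=> a v v'; rewrite /l -lagrangian_form_linear; congr (lagrangian_form x _).
  by congr (_, _); rewrite /= scaler0 addr0.
have lE := linear_funE (coords_rV n) l1 u.
rewrite -[lagrangian_form x (u, 0)]/(l u) lE /covector_at mxE -sumrN.
by apply: eq_bigr => j _; rewrite mxE mulrN.
Qed.

Lemma dl_dom_subset i : dl_dom L i `<=` U.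
Proof. by move=> x hi; rewrite -(dl_cover L); exists i. Qed.

Lemma open_dl_dom i : open (dl_dom L i).
Proof. exact: dl_open. Qed.

Lemma dl_smooth_pt i x : dl_dom L i x -> smooth_pt A2 (model_charted R^o) (dl_fun L i)
  x.
Proof.
exact: ((smooth_mapP _ hA2 hm (@open_dl_dom i)).1 (dl_smooth i) x).
Qed.

(** The components in [momentum_map] refer to a chart that moves with the base point. In a fixed
    chart they are minus the [q0]-derivatives of one coordinate expression of [L], which is visibly
    smooth. *)
Lemma momentum_chart i x c d : dl_dom L i x -> atlas A c -> atlas A d -> cdom c x.1 ->
  cdom d x.2 ->
  {near cto (prod_chart c d) x,
    (fun y => (y.1, \col_j - 'D_(delta_mx 0 j, 0)
      (dl_fun L i \o cfrom (prod_chart c d)) y)) =1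
    cto (cot c) \o F \o cfrom (prod_chart c d)}.
Proof.
move=> hi Ac Ad cx dx; set k := prod_chart c d.
have Ak : atlas A2 k := prod_chart_atlas Ac Ad.
have hk : is_chart k := atlas_chart hA2 Ak.
have kx : cdom k x by [].
have [_ _ tA] := hA.
have n1 := near_ccod hk kx.
have n2 := near_cfrom hk kx (open_nbhs_nbhs (conj (@open_dl_dom i) hi)).
apply: filterS (filterI n1 n2) => y [ky hy].
have hc := atlas_chart hA Ac; have [cy dy] := ky.
rewrite [RHS]surjective_pairing; congr (_, _); first by rewrite /= (ctoK hc cy).
apply/colP => j; rewrite mxE.
set x' := cfrom k y in hy *.
have yE : cto k x' = y := ctoK hk ky.
have [cx' dx'] : cdom k x' := cdom_cfrom hk ky.
have H1 := covector_at_chart c (F x') (delta_mx 0 j).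
rewrite -rowE mxE in H1; apply: etrans _ H1.
rewrite covector_at_momentum (lagrangian_formE hy); congr (- _).
have H2 := local_form_differential hA2 (delta_mx 0 j, 0) (dl_smooth_pt hy)
  Ak (conj cx' dx').
rewrite yE in H2; apply: etrans (esym H2) _.
have H3 := local_form_cto hA2 (differential A2 (dl_fun L i)) (delta_mx 0 j, 0)
  Ak (conj cx' dx').
rewrite -yE; apply: etrans H3 _.
have d1 : differentiable (cto (chart_at A x'.1) \o cfrom c) (cto k x').1.
  by apply: smooth_near_differentiable; apply: tA => //;
    [exact: atlas_chart_at|exact: cdom_chart_at].
have d2 : differentiable (cto (chart_at A x'.2) \o cfrom d) (cto k x').2.
  by apply: smooth_near_differentiable; apply: tA => //;
    [exact: atlas_chart_at|exact: cdom_chart_at].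
have E := diff_prod_transition (delta_mx 0 j, 0) d1 d2.
have E0 := etrans E (congr1 (pair _)
  (linear0 ('d (cto (chart_at A x'.2) \o cfrom d) ((cto k x').2)))).
exact: (congr1 (differential A2 (dl_fun L i) x') E0).
Qed.

Lemma smooth_momentum_expr i x c d : dl_dom L i x -> atlas A c -> atlas A d ->
  cdom c x.1 -> cdom d x.2 ->
  smooth_near (cto (prod_chart c d) x)
    (fun y : V2 => (y.1, \col_j - 'D_(delta_mx 0 j, 0)
      (dl_fun L i \o cfrom (prod_chart c d)) y)).
Proof.
move=> hi Ac Ad cx dx; set k := prod_chart c d.
have Lm : atlas (model_charted R^o) (Chart setT setT id id) by [].
have sk : smooth_near (cto k x) (dl_fun L i \o cfrom k) :=
  (dl_smooth_pt hi).2 _ _ (prod_chart_atlas Ac Ad) Lm (conj cx dx) I.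
apply: smooth_near_pair; first exact: smooth_near_fst.
apply/smooth_near_mxP => j j'.
have s := smooth_near_scale (smooth_near_cst (cto k x) (-1 : R^o))
  (smooth_near_derive (delta_mx 0 j, 0) sk).
have E : (fun y => cst (-1 : R^o) y *: 'D_(delta_mx 0 j, 0) (dl_fun L i \o cfrom k) y) =
    (fun y : V2 => (\col_j - 'D_(delta_mx 0 j, 0) (dl_fun L i \o cfrom k) y)
      j j' : R^o).
  by apply/funext => y; rewrite mxE /= scaleN1r.
by rewrite E in s; exact: s.
Qed.

Lemma smooth_pt_momentum x : U x -> smooth_pt A2 TA F x.
Proof.
rewrite -(dl_cover L) => -[i _ hi].
have Ac := atlas_chart_at x.1 hA; have cx := cdom_chart_at x.1 hA.
have Ad := atlas_chart_at x.2 hA; have dx := cdom_chart_at x.2 hA.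
set c := chart_at A x.1 in Ac cx; set d := chart_at A x.2 in Ad dx.
have s := smooth_near_eq (momentum_chart hi Ac Ad cx dx)
  (smooth_momentum_expr hi Ac Ad cx dx).
have nd : \forall z \near x, cdom (cot c) (F z).
  have c1 : {for x, continuous (@fst Q Q)} by exact: cvg_fst.
  exact: (c1 _ (near_cdom (atlas_chart hA Ac) cx)).
have cont : {for x, continuous F}.
  apply: (chart_continuous hA2 hT (prod_chart_atlas Ac Ad) (cotangent_chart_atlas Ac)
    (conj cx dx) nd).
  exact: smooth_near_continuous.
exact: (smooth_pt_chart C2 CT hA2 hT cont (prod_chart_atlas Ac Ad)
  (cotangent_chart_atlas Ac) (conj cx dx) cx s).
Qed.

(** In a chart the differential of [(q0, q1) |-> (q0, - D1 L)] is block triangular, with diagonal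
    blocks the identity and, up to sign and transposition, [D12]. *)
Lemma momentum_injective x t : regular L -> U x -> tangent_map A2 TA F x t = 0 -> t = 0.
Proof.
move=> reg Ux Ft; have : U x by []. rewrite -{1}(dl_cover L) => -[i _ hi].
have Ac := atlas_chart_at x.1 hA; have cx := cdom_chart_at x.1 hA.
have Ad := atlas_chart_at x.2 hA; have dx := cdom_chart_at x.2 hA.
set c := chart_at A x.1 in Ac cx; set d := chart_at A x.2 in Ad dx.
set k := prod_chart c d.
have se := smooth_momentum_expr hi Ac Ad cx dx.
have E := near_eq_diff (momentum_chart hi Ac Ad cx dx) (smooth_near_differentiable se).
have Ft0 : 'd (cto (cot c) \o F \o cfrom k) (cto k x) t = 0 by exact: Ft.
rewrite E in Ft0.
have t1 : t.1 = 0.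
  have := congr1 fst Ft0; rewrite (fst_diff t (smooth_near_differentiable se)).
  by rewrite (diff_fstE (cto k x) t).
have t2 : t.2 = 0.
  have H := congr1 snd Ft0; rewrite (snd_diff t (smooth_near_differentiable se)) in H.
  have s2 : smooth_near (cto k x) (fun y : V2 => \col_j - 'D_(delta_mx 0 j, 0)
    (dl_fun L i \o cfrom k) y).
    by have := smooth_near_comp CT se (smooth_near_snd _).
  have d2 := smooth_near_differentiable s2.
  rewrite -(deriveE _ d2) in H.
  have uD := reg i x hi c d Ac Ad cx dx.
  have w0 : t.2 *m (D12 (dl_fun L i) c d x)^T = 0.
    apply/rowP => j.
    have sg : smooth_near (cto k x) ('D_(delta_mx 0 j, 0) (dl_fun L i \o cfrom k)).
      have Lm : atlas (model_charted R^o) (Chart setT setT id id) by [].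
      apply: smooth_near_derive.
      exact: ((dl_smooth_pt hi).2 _ _ (prod_chart_atlas Ac Ad) Lm (conj cx dx) I).
    have dg := @diff_derivable _ _ _ _ _ t (smooth_near_differentiable sg).
    have Hj : 'D_t (- 'D_(delta_mx 0 j, 0) (dl_fun L i \o cfrom k)) (cto k x) = 0.
      have E1 : - 'D_(delta_mx 0 j, 0) (dl_fun L i \o cfrom k) =
          (fun y : V2 => (\col_j - 'D_(delta_mx 0 j, 0) (dl_fun L i \o cfrom k) y)
            j 0 : R^o).
        by apply/funext => y; rewrite mxE.
      rewrite E1; apply: etrans (@derive_entry R V2 n 1 _ (cto k x) t j 0 d2) _.
      apply: etrans (congr1 (fun M : 'cV[R]_n => M j 0) H) _.
      by rewrite mxE.
    have tE : t = (0, t.2) by rewrite -t1 -surjective_pairing.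
    have Dt := D12_pairing t.2 j Ac Ad cx dx (dl_smooth_pt hi).
    rewrite -tE in Dt; apply: etrans (esym Dt) _.
    have DN := etrans (esym (deriveN dg)) Hj.
    by move/eqP: DN; rewrite oppr_eq0 mxE => /eqP.
  have uT : (D12 (dl_fun L i) c d x)^T \in unitmx by rewrite unitmx_tr.
  by rewrite -[t.2](mulmxK uT) w0 mul0mx.
by rewrite [t]surjective_pairing t1 t2.
Qed.

Lemma lagrangian_of_regular : regular L ->
  (forall x, U x -> discrete_euler_lagrange L x.1 x.2 (Gt x)) ->
  [/\ local_diffeomorphism A2 TA U F, forall x, U x -> x.1 = cotangent_proj (F x) &
    lagrangian_immersion U (gamma F Gt)].
Proof.
move=> reg del.
have sF := smooth_pt_momentum.
have injF x t : U x -> tangent_map A2 TA F x t = 0 ->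
  t = 0 by exact: momentum_injective.
have pF x : U x -> x.1 = (F x).1 by [].
split=> //.
  exact: (inverse_function_manifold C2 CT hA2 hT oU sF injF).
have sG x : U x -> smooth_pt A2 TA (F \o (fun x => (x.2, Gt x))) x.
  by move=> Ux; exact: (smooth_pt_Fshift hA sF sGt UG Ux).
have hT2 : smooth_atlas (cotangent2_charted A) := smooth_atlas_prod CT CT hT hT.
split.
  split; first apply/(smooth_mapP _ hA2 hT2 oU) => x Ux.
    exact: (smooth_pt_pair (sF x Ux) (sG x Ux)).
  (* The first component of [gamma F Gt] is [F], whose tangent map is already injective. *)
  move=> x Ux t t' Tt.
  have Tg s : tangent_map A2 (cotangent2_charted A) (gamma F Gt) x s =
      (tangent_map A2 TA F x s, tangent_map A2 TA (F \o (fun x => (x.2, Gt x))) x s).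
    exact: (tangent_map_pair hT hT hA2 s (sF x Ux) (sG x Ux)).
  move: Tt; rewrite !Tg => -[Tt _].
  apply/eqP; rewrite -subr_eq0; apply/eqP; apply: (injF x _ Ux).
  apply: etrans (linearB _ _ _) _.
  by apply/eqP; rewrite subr_eq0; apply/eqP.
move=> x Ux; apply/(lagrangian_closed hA oU sF pF sGt UG Ux).
have alphaE z : U z -> generating_form F Gt z = lagrangian_form z.
  move=> Uz; apply/funext => t; rewrite /generating_form !covector_at_momentum opprK.
  have [i _ hi] : (\bigcup_i dl_dom L i) (z.2, Gt z) by rewrite dl_cover; exact: UG.
  have [j _ hj] : (\bigcup_i dl_dom L i) z by rewrite dl_cover.
  have hj' : dl_dom L j (z.1, z.2) by rewrite -surjective_pairing.
  have := del z Uz i j hi hj' t.2.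
  rewrite /D1 /D2 -(lagrangian_formE hi) -(lagrangian_formE hj') -surjective_pairing.
  move=> /eqP; rewrite addrC addr_eq0 => /eqP <-.
  have := lagrangian_form_linear z 1 (0, t.2) (t.1, 0); rewrite !scale1r => <-.
  congr (lagrangian_form z _); rewrite [RHS]surjective_pairing; congr (_, _).
    by rewrite /= add0r.
  by rewrite /= addr0.
have [i _ hi] : (\bigcup_i dl_dom L i) x by rewrite dl_cover.
set k := chart_at A2 x.
have Ak : atlas A2 k := atlas_chart_at x hA2; have kx : cdom k x := cdom_chart_at x hA2.
have cl := closed_differential hA2 (@open_dl_dom i) hi (fun z hz => dl_smooth_pt hz)
  Ak kx.
have hk : is_chart k := is_chart_at x hA2.
have E s : {near cto k x, (fun y => local_form (differential A2 (dl_fun L i)) k y s) =1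
    (fun y => local_form (generating_form F Gt) k y s)}.
  have n2 := near_cfrom hk kx (open_nbhs_nbhs (conj (@open_dl_dom i) hi)).
  apply: filterS n2 => y hy.
  by rewrite /local_form (alphaE _ (dl_dom_subset hy)) (lagrangian_formE hy).
move=> t t'.
apply: etrans (esym (near_eq_derive t (E t'))) _.
apply: etrans (cl t t') _.
exact: (near_eq_derive t' (E t)).
Qed.

End Momentum.

End Variational.

Theorem proposition3p2 (R : realType) (n : nat) (Q : topologicalType)
    (A : charted_space 'rV[R]_n Q) (hA : is_smooth_manifold A)
    (U : set (Q * Q)) (hU : open U)
    (Gt : Q * Q -> Q) (hGt : smooth_map (prod_charted A A) A U Gt)
    (hclosed : forall q0 q1, U (q0, q1) -> U (q1, Gt (q0, q1))) :
  variational A U Gt <->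
  exists F : Q * Q -> cotangent A,
    [/\ local_diffeomorphism (prod_charted A A) (cotangent_charted A) U F,
        forall x, U x -> x.1 = cotangent_proj (F x) &
        lagrangian_immersion U (gamma F Gt)].
Proof.
have hA' := smooth_manifold_atlas hA.
have hA2 := smooth_atlas_prod (coords_rV n) (coords_rV n) hA' hA'.
have sGt := (smooth_mapP _ hA2 hA' hU).1 hGt.
have UG x : U x -> U (x.2, Gt x).
  by move=> Ux; have := @hclosed x.1 x.2; rewrite -surjective_pairing; exact.
split=> [[L reg [W [_ _ WU HW]]]|[F [dF pF lag]]].
  exists (momentum_map L); apply: (lagrangian_of_regular hA' hU sGt UG reg) => x Ux.
  (* The equivalence on [W] is used only on the graph of [Gt], where its left-hand side is an
     identity. *)
  apply/HW; last by rewrite -surjective_pairing.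
  by have := WU x.1 x.2; rewrite -surjective_pairing; exact.
exact: (variational_of_lagrangian hA' hU sGt UG dF pF lag).
Qed.
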